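(* Let $p>3$ be a prime. If $p\equiv1\pmod8$, write $p=x^2+2y^2$ with integers $x,y$ and $4\mid x-1$; then $$\sum_{k=0}^{p-1}(16k+3)\binom{-3/8}k^4\equiv3p(-1)^{y/2}\Big(2x-\frac p{2x}-\frac{p^2}{8x^3}\Big)\pmod{p^4}.$$ If $p\equiv3\pmod8$, write $p=x^2+2y^2$ with integers $x,y$ and $4\mid y-1$; then $$\sum_{k=0}^{p-1}(16k+3)\binom{-3/8}k^4\equiv p\Big(-2y+\frac p{4y}+\frac{p^2}{32y^3}\Big)\pmod{p^4}.$$ If $p\equiv5\pmod8$, then $$\sum_{k=0}^{p-1}(16k+3)\binom{-3/8}k^4\equiv(-1)^{\frac{p-5}8}\frac{84p^2}{\binom{(3p+1)/4}{(3p+1)/8}}\pmod{p^3},$$ and if $p\equiv7\pmod8$, then $$\sum_{k=0}^{p-1}(16k+3)\binom{-3/8}k^4\equiv(-1)^{\frac{p-7}8}\frac{10p^2}{\binom{(p+1)/4}{(p+1)/8}}\pmod{p^3}.$$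
   Context: The general binomial coefficient is $\binom a0=1$, $\binom ak=a(a-1)\cdots(a-k+1)/k!$ for $k\ge1$. Congruences are in the ring of rationals with denominators prime to $p$. *)

(* Defs.v *)
From mathcomp Require Import all_boot all_order all_algebra.

Set Implicit Arguments.
Unset Strict Implicit.
Unset Printing Implicit Defensive.

Import Order.TTheory GRing.Theory Num.Theory.
Local Open Scope ring_scope.

Definition gbinom (a : rat) (k : nat) : rat :=
  (\prod_(i < k) (a - i%:R)) / (k`!)%:R.

(* Membership in the ring Z_(p), for p prime. *)
Definition pintegral (p : nat) (r : rat) : bool := coprime p `|denq r|%N.

(* Congruence modulo the ideal p ^ n Z_(p) of Z_(p); that both sides lie in
   Z_(p) is part of the relation. *)
Definition pcongr (p n : nat) (a b : rat) : Prop :=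
  [/\ pintegral p a, pintegral p b
    & exists2 c : rat, pintegral p c & a - b = p%:R ^+ n * c].

(* Main.v *)
(* The sum is 8 P(0) for the very-well-poised series P(z) = sum_k (a + 2k)
   prod_(j < k) (a + j) ((a + j)^3 + z) / ((j + 1) ((j + 1)^3 - z)) with a = 3/8.
   Let 0 <= n < p with p | n + a, and d = -(n + a). The series P(d^3) terminates
   and has a product formula (WZ method), and P(d^3) = P(0) mod p^4 because the
   difference is of second order: one factor p^3 comes from d^3 and another p
   from the antisymmetry k -> n - k of the terms at a = -n.

   If p = 5 or 7 mod 8, the product is divisible by p^2 and its cofactor is
   computed mod p from Wilson's theorem. If p = 1 or 3 mod 8, it is p times a
   p-adic unit V modulo p^4. A duplication argument turns V into
   T = (1/2)_N / ((1/8)_K (3/8)_L), N = (p - 1)/2, and T into a Jacobi sum, as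
   follows. Lift to Z/p^3 (to Z[i]/p^3 if p = 3 mod 8) by Teichmueller
   representatives the values phi(u) = u^-K (1 - u)^N, u^(p - 1) = 1 (resp.
   u^(p + 1) = 1); extrapolating quadratically from the exponents N + m (p - 1),
   m = 0, 1, 2, to the exponent (p^3 - 1)/2 expresses the sum of the lifts by
   binomial coefficients, that is, by T. The values phi(u) are 8th roots of unity and
   phi(1/u) = phi(u)^3, so the sum is X + Y sqrt(-2); the usual norm computation
   gives X^2 + 2 Y^2 = p, and products of phi over the fibres of u -> u^m
   determine X and Y modulo 4. Hence T is up to sign the p-adic unit root of
   t^2 - 2 X t + p, whose expansion 2X - p/(2X) - p^2/(8X^3) is the right-hand
   side (when p = 3 mod 8, only T^2 = -2 V^2 holds, and V is expanded in Y). *)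
From HB Require Import structures.
Require Import Defs.
From mathcomp Require Import all_boot all_order all_algebra all_solvable all_field.
From mathcomp Require Import ring lra zify.
Set Implicit Arguments.
Unset Strict Implicit.
Unset Printing Implicit Defensive.
Import Order.TTheory GRing.Theory Num.Theory.
Local Open Scope ring_scope.

(** * Very-well-poised series *)

(** Writing n + 3/8 = p c, one finds c = 3/8, 1/8, 7/8, 5/8 for p = 1, 3, 5, 7 mod 8. The product
    always contains p c; it contains a second multiple of p, the factor 3/4 + (2n - p) = p (2c - 1)
    of (3/4)_n, exactly when 2n >= p, that is c > 1/2. Hence the two kinds of congruence.

    The duplication step rests on the products of 1 + p t / j over j <= N. Since the sum of 1/j^2
    over j <= N vanishes modulo p, they behave modulo p^3 like exp(p t H), H the harmonic sum, so
    that relations between them become linear relations between the values of t. This gives only T^4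
    and then T^2; the sign is a separate problem, solved modulo p by counting how often phi takes a
    given value.

    For p = 3 mod 8 the eighth roots of unity lie only in F_(p^2), and u runs through its elements
    of norm 1. Also T^2 = -2 V^2 has no rational square root on the right, so the equation of T is
    multiplied by its conjugate, which leaves an equation in V^2 and Y^2.

    The polynomial 15 - 10 y + 3 y^2 comes from Lagrange interpolation at -1/2 with nodes 0, 1, 2,
    where the weights are 15/8, -10/8, 3/8. *)

Section VeryWellPoised.
Variables (F : realFieldType) (a e1 e2 : F).
Let q (x : F) := x ^+ 2 + e1 * x + e2.
Let r (x : F) := (a + x) ^+ 2 - e1 * (a + x) + e2.
Let f n k := (a + 2 * k%:R) * \prod_(j < k)
  ((a + j%:R) * (j%:R - n%:R) * q j%:R
    / ((j%:R + 1) * (a + n%:R + 1 + j%:R) * r (j%:R + 1))).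

(** The terminating very-well-poised 5F4 sum with parameters a, 1 + a/2, b, c, -n at argument 1,
    where e1 = b + c and e2 = b c. Only the symmetric functions occur, because b and c are conjugate
    complex numbers in the application. *)
Lemma vwp_5F4 n : 0 < a -> (forall j : nat, r (j%:R + 1) != 0) ->
  \sum_(k < n.+1) f n k =
  (\prod_(j < n.+1) (a + j%:R)) * (\prod_(j < n) (1 + a - e1 + j%:R))
    / \prod_(j < n) r (j%:R + 1).
Proof.
move=> a_gt0 r_neq0.
have aD_neq0 (i : nat) : a + i%:R != 0 by rewrite gt_eqF // ltr_wpDr.
elim: n => [|n IHn].
  by rewrite !big_ord1 !big_ord0 /f big_ord0 mulr0 !mulr1 invr1 !mulr1.
(* A common factor of [f n] and [f n.+1]: each is [M] times a rational function of k ([fM], [fSM]),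
   so the recurrence in n becomes an identity of rational functions. *)
pose M k := \prod_(j < k)
  ((a + j%:R) * (j%:R - n%:R - 1) * q j%:R
    / ((j%:R + 1) * (a + n%:R + 1 + j%:R) * r (j%:R + 1))).
have MS k : M k.+1 = M k * ((a + k%:R) * (k%:R - n%:R - 1) * q k%:R
    / ((k%:R + 1) * (a + n%:R + 1 + k%:R) * r (k%:R + 1))).
  by rewrite /M big_ord_recr.
have anD k : a + n%:R + 1 + k%:R != 0.
  by rewrite -!addrA nat1r -natrD aD_neq0.
have nS_neq0 (k : nat) : k%:R + 1 != 0 :> F by rewrite natr1 pnatr_eq0.
have fM k : f n k = (a + 2 * k%:R) * ((n%:R + 1 - k%:R) / (n%:R + 1)) * M k.
  rewrite /f -mulrA; congr (_ * _).
  elim: k => [|k IHk]; first by rewrite /M !big_ord0 subr0 divff ?mulr1.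
  rewrite MS big_ord_recr /= IHk -(natr1 k).
  field; do !(apply/andP; split) => //; exact: (r_neq0 k).
have fSM k : f n.+1 k = (a + 2 * k%:R) * ((a + n%:R + 1) / (a + n%:R + 1 + k%:R)) * M k.
  rewrite /f -mulrA; congr (_ * _).
  elim: k => [|k IHk].
    by rewrite /M !big_ord0 addr0 divff ?mulr1 //; move: (anD 0%N); rewrite addr0.
  rewrite MS big_ord_recr /= IHk -(natr1 k) -(natr1 n).
  have := anD k; have := anD k.+1; have := nS_neq0 k; have := r_neq0 k.
  rewrite -(natr1 k) => h1 h2 h3 h4.
  field; do !(apply/andP; split) => //; by apply: contraNneq h3 => <-; apply/eqP; ring.
(* g is the WZ certificate of the recurrence in n. *)
pose g k := - ((a + n%:R + 1) * k%:R * r k%:R / (n%:R + 1)) * M k.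
have wz k : r (n%:R + 1) * f n.+1 k - (a + n%:R + 1) * (1 + a - e1 + n%:R) * f n k
    = g k.+1 - g k.
  rewrite fM fSM /g MS -(natr1 k).
  have := anD k; have := nS_neq0 k; have := r_neq0 k; have := nS_neq0 n.
  rewrite /r /q => h1 h2 h3 h4.
  by field; do !(apply/andP; split).
have tel : \sum_(k < n.+2) (r (n%:R + 1) * f n.+1 k
    - (a + n%:R + 1) * (1 + a - e1 + n%:R) * f n k) = 0.
  under eq_bigr do rewrite wz.
  rewrite -(big_mkord xpredT (fun k => g k.+1 - g k)) telescope_sumr //.
  have M0 : M n.+2 = 0 by rewrite MS -(natr1 n) ; ring.
  by rewrite /g M0; ring.
rewrite big_split /= -mulr_sumr sumrN -mulr_sumr in tel.
move: tel; rewrite [X in _ - _ * X]big_ord_recr /= (_ : f n n.+1 = 0); last first.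
  by rewrite fM -(natr1 n); ring.
rewrite addr0 IHn => /eqP; rewrite subr_eq0 => /eqP tel.
apply: (mulfI (r_neq0 n)); rewrite tel.
rewrite (big_ord_recr n.+1) (big_ord_recr n (fun j => 1 + a - e1 + _)) (big_ord_recr n (fun j => r _)) /=.
have : \prod_(j < n) r (j%:R + 1) != 0 by apply/prodf_neq0.
rewrite -natr1; move: (r_neq0 n).
set R1 := r _; set R2 := \prod_(j < n) r _ => h1 h2.
field; by rewrite h1 h2.
Qed.
End VeryWellPoised.

(** * The local ring Z_(p), its units and its congruences *)

(** Packaged as a predicate so that it carries a subring structure and the closure lemmas for
    subrings apply. *)
Definition zp (p : nat) : {pred rat} := fun r => pintegral p r.

Lemma zp_frac p (a b : int) : coprime p `|b|%N -> a%:~R / b%:~R \in zp p.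
Proof.
move=> cop; have [->|b_neq0] := eqVneq b 0.
  by rewrite invr0 mulr0 unfold_in /pintegral coprimen1.
rewrite unfold_in /pintegral; set x := a%:~R / b%:~R.
suff dvd : (denq x %| b)%Z by apply: coprime_dvdr cop; exact: dvd.
have E : numq x * b = a * denq x.
  apply/eqP; rewrite -(eqr_int rat) !intrM numqE mulrAC.
  by rewrite /x divfK ?intr_eq0.
rewrite -(@Gauss_dvdzr _ (numq x)).
  by rewrite E dvdz_mull.
by rewrite coprimezE coprime_sym coprime_num_den.
Qed.

Lemma zp_subring p : subring_closed (zp p).
Proof.
split=> [|x y|x y].
- by rewrite unfold_in /pintegral coprimen1.
- move=> xp yp; have xp' : coprime p `|denq x|%N by [].
  have yp' : coprime p `|denq y|%N by [].
  have -> : x - y = (numq x * denq y - numq y * denq x)%:~R / (denq x * denq y)%:~R.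
    rewrite -{1}(divq_num_den x) -{1}(divq_num_den y) !(intrM, intrB).
    by field; rewrite !intr_eq0 !denq_neq0.
  by apply: zp_frac; rewrite abszM coprimeMr xp' yp'.
- move=> xp yp; have xp' : coprime p `|denq x|%N by [].
  have yp' : coprime p `|denq y|%N by [].
  have -> : x * y = (numq x * numq y)%:~R / (denq x * denq y)%:~R.
    rewrite -{1}(divq_num_den x) -{1}(divq_num_den y) !(intrM, intrB).
    by field; rewrite !intr_eq0 !denq_neq0.
  by apply: zp_frac; rewrite abszM coprimeMr xp' yp'.
Qed.
HB.instance Definition _ p := GRing.isSubringClosed.Build rat (zp p) (zp_subring p).

Lemma zp_nat p n : n%:R \in zp p. Proof. exact: rpred_nat. Qed.
Lemma zp_int p (n : int) : n%:~R \in zp p. Proof. exact: rpred_int. Qed.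

Lemma zpD p x y : x \in zp p -> y \in zp p -> x + y \in zp p. Proof. exact: rpredD. Qed.
Lemma zpM p x y : x \in zp p -> y \in zp p -> x * y \in zp p. Proof. exact: rpredM. Qed.
Lemma zpN p x : x \in zp p -> - x \in zp p. Proof. by rewrite rpredN. Qed.
Lemma zpX p x n : x \in zp p -> x ^+ n \in zp p. Proof. exact: rpredX. Qed.

Definition zpu (p : nat) (x : rat) := [&& x != 0, x \in zp p & x^-1 \in zp p].

Section Units.
Variables (p : nat) (p_pr : prime p).

Lemma zpu_zp x : zpu p x -> x \in zp p. Proof. by case/and3P. Qed.
Lemma zpu_inv_zp x : zpu p x -> x^-1 \in zp p. Proof. by case/and3P. Qed.
Lemma zpu_neq0 x : zpu p x -> x != 0. Proof. by case/and3P. Qed.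
Lemma zpuV x : zpu p x -> zpu p x^-1.
Proof. by case/and3P=> *; rewrite /zpu invr_eq0 invrK; apply/and3P. Qed.
Lemma zpuM x y : zpu p x -> zpu p y -> zpu p (x * y).
Proof.
move=> /and3P[x0 x1 x2] /and3P[y0 y1 y2].
by rewrite /zpu mulf_neq0 // invfM !rpredM.
Qed.
Lemma zpuN x : zpu p x -> zpu p (- x).
Proof. by move=> /and3P[? ? ?]; rewrite /zpu oppr_eq0 invrN !rpredN; apply/and3P. Qed.
Lemma zpu1 : zpu p 1. Proof. by rewrite /zpu oner_eq0 invr1 rpred1. Qed.
Lemma zpu_prod (I : Type) (r : seq I) (P : pred I) (F : I -> rat) :
  (forall i, P i -> zpu p (F i)) -> zpu p (\prod_(i <- r | P i) F i).
Proof. by move=> H; apply: (big_ind (zpu p)); [exact: zpu1 | exact: zpuM |]. Qed.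
Lemma zpu_factor x y : x \in zp p -> y \in zp p -> zpu p (x * y) -> zpu p y.
Proof.
move=> xz yz xyu; have := zpu_neq0 xyu; rewrite mulf_eq0 negb_or => /andP[x0 y0].
rewrite /zpu y0 yz /= (_ : y^-1 = (x * y)^-1 * x); last by field; rewrite x0 y0.
by apply: rpredM => //; apply: zpu_inv_zp.
Qed.
Lemma zpuX x n : zpu p x -> zpu p (x ^+ n).
Proof. by move=> xu; elim: n => [|n IH]; rewrite ?zpu1 // exprS zpuM. Qed.

Lemma zpu_int (n : int) : ~~ (p %| `|n|)%N -> zpu p n%:~R.
Proof.
move=> pn; rewrite /zpu zp_int intr_eq0.
have -> : (n != 0) by apply: contraNneq pn => ->.
by rewrite -[_^-1]mul1r; apply: (@zp_frac p 1 n); rewrite prime_coprime.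
Qed.
Lemma zpu_nat (n : nat) : ~~ (p %| n)%N -> zpu p n%:R.
Proof. by move=> pn; apply: (@zpu_int n). Qed.
Lemma zpu_small (n : nat) : (0 < n < p)%N -> zpu p n%:R.
Proof. by case/andP=> n0 np; apply: zpu_nat; rewrite gtnNdvd. Qed.

Lemma p_neq0 : p%:R != 0 :> rat. Proof. by rewrite pnatr_eq0 -lt0n prime_gt0. Qed.
Lemma pX_neq0 m : p%:R ^+ m != 0 :> rat. Proof. by rewrite expf_neq0 ?p_neq0. Qed.

Lemma zpu_or_dvd x : x \in zp p -> zpu p x \/ x / p%:R \in zp p.
Proof.
move=> xp; have xp' : coprime p `|denq x|%N by [].
have [/dvdnP[k Ek]|pn] := boolP (p %| `|numq x|)%N; [right | left].
  have -> : x / p%:R = (sgz (numq x) * k)%:~R / (denq x)%:~R.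
    rewrite -{1}(divq_num_den x) {1}[numq x]intEsg Ek !intrM.
    by field; rewrite p_neq0 intr_eq0 denq_neq0.
  exact: zp_frac.
rewrite -(divq_num_den x) zpuM ?zpu_int //; apply: zpuV; apply: zpu_int.
by rewrite -prime_coprime.
Qed.

Lemma zpu_not_dvd x : zpu p x -> x / p%:R \notin zp p.
Proof.
move=> /and3P[x0 x1 x2]; apply/negP => xp.
have : p%:R^-1 \in zp p.
  have -> : p%:R^-1 = x / p%:R * x^-1 by field; rewrite x0 p_neq0.
  by rewrite rpredM.
rewrite unfold_in /pintegral -[p%:R]/(p%:Z%:~R) denqVz; last first.
  by rewrite -lt0n prime_gt0.
by rewrite prime_coprime //= dvdnn.
Qed.

Lemma zpu_coprime (n : int) : zpu p n%:~R -> ~~ (p %| `|n|)%N.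
Proof.
move/zpu_not_dvd; apply: contra => /dvdnP[k Ek].
have -> : n%:~R / p%:R = (sgz n * k)%:~R :> rat; last exact: zp_int.
by rewrite {1}[n]intEsg Ek !(PoszM, intrM); field; rewrite p_neq0.
Qed.
End Units.

(* Congruence modulo p ^ m Z_(p) without the requirement that both sides lie in Z_(p). *)
Definition cong (p m : nat) (x y : rat) := (x - y) / p%:R ^+ m \in zp p.

Lemma cong_congr p m (x y x' y' : rat) : cong p m x y -> x' = x -> y' = y -> cong p m x' y'.
Proof. by move=> h -> ->. Qed.

Section Cong.
Variables (p : nat) (p_pr : prime p).
Let pXn0 m := pX_neq0 p_pr m.
Implicit Types (x y z t : rat) (m k : nat).

Lemma congP m x y : cong p m x y <-> exists2 c, c \in zp p & x - y = p%:R ^+ m * c.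
Proof.
split=> [h|[c cp E]]; first by exists ((x - y) / p%:R ^+ m); rewrite // mulrC divfK.
by rewrite /cong E mulrC mulKf.
Qed.
Lemma cong_refl m x : cong p m x x. Proof. by rewrite /cong subrr mul0r rpred0. Qed.
Lemma cong_eq m x y : x = y -> cong p m x y. Proof. by move->; exact: cong_refl. Qed.
Lemma cong_sym m x y : cong p m x y -> cong p m y x.
Proof. by rewrite /cong -opprB mulNr rpredN. Qed.
Lemma cong_trans m y x z : cong p m x y -> cong p m y z -> cong p m x z.
Proof.
move=> h1 h2; rewrite /cong; have -> : x - z = (x - y) + (y - z) by ring.
by rewrite mulrDl; apply: rpredD.
Qed.
Lemma congD m x y z t : cong p m x y -> cong p m z t -> cong p m (x + z) (y + t).
Proof.
move=> h1 h2; rewrite /cong; have -> : x + z - (y + t) = (x - y) + (z - t) by ring.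
by rewrite mulrDl; apply: rpredD.
Qed.
Lemma congN m x y : cong p m x y -> cong p m (- x) (- y).
Proof. by rewrite /cong -opprD mulNr rpredN. Qed.
Lemma congB m x y z t : cong p m x y -> cong p m z t -> cong p m (x - z) (y - t).
Proof. by move=> h1 h2; apply: congD => //; apply: congN. Qed.
Lemma congM m x y z t : z \in zp p -> y \in zp p ->
  cong p m x y -> cong p m z t -> cong p m (x * z) (y * t).
Proof.
rewrite /cong => zz yz h1 h2.
have -> : (x * z - y * t) / p%:R ^+ m =
    (x - y) / p%:R ^+ m * z + y * ((z - t) / p%:R ^+ m) by field; rewrite pXn0.
by apply: rpredD; apply: rpredM.
Qed.
Lemma congMl m x y z : z \in zp p -> cong p m x y -> cong p m (z * x) (z * y).
Proof. by move=> zz; rewrite /cong => h; rewrite -mulrBr -mulrA rpredM. Qed.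
Lemma congMr m x y z : z \in zp p -> cong p m x y -> cong p m (x * z) (y * z).
Proof. by rewrite ![_ * z]mulrC; apply: congMl. Qed.
Lemma cong_zp m x y : cong p m x y -> y \in zp p -> x \in zp p.
Proof.
by case/congP=> c cp /eqP; rewrite subr_eq => /eqP-> yp; rewrite rpredD // rpredM // rpredX ?zp_nat.
Qed.
Lemma cong_le k m x y : (k <= m)%N -> cong p m x y -> cong p k x y.
Proof.
move=> km /congP[c cp E]; apply/congP; exists (p%:R ^+ (m - k) * c).
  by rewrite rpredM ?rpredX ?zp_nat.
by rewrite E mulrA -exprD subnKC.
Qed.
Lemma cong_pX k m x y : cong p m x y -> cong p (k + m) (p%:R ^+ k * x) (p%:R ^+ k * y).
Proof.
by case/congP=> c cp E; apply/congP; exists c => //; rewrite -mulrBr E exprD mulrA.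
Qed.
Lemma cong_p m x y : cong p m x y -> cong p m.+1 (p%:R * x) (p%:R * y).
Proof. by move/(cong_pX 1); rewrite expr1. Qed.
Lemma cong_unit m x y : cong p m.+1 x y -> zpu p y -> zpu p x.
Proof.
move=> h yu; have xp : x \in zp p by apply: cong_zp h _; apply: zpu_zp.
have [//|xd] := zpu_or_dvd p_pr xp.
case/negP: (zpu_not_dvd p_pr yu).
have -> : y / p%:R = x / p%:R - (x - y) / p%:R ^+ 1 by rewrite expr1; field; rewrite (p_neq0 p_pr).
by rewrite rpredB //; apply: (cong_le (m := m.+1)).
Qed.
Lemma congV m x y : zpu p x -> zpu p y -> cong p m x y -> cong p m x^-1 y^-1.
Proof.
move=> xu yu; rewrite /cong => h.
have -> : (x^-1 - y^-1) / p%:R ^+ m = - (x^-1 * y^-1 * ((x - y) / p%:R ^+ m)).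
  by field; rewrite pXn0 (zpu_neq0 xu) (zpu_neq0 yu).
by rewrite rpredN; apply: rpredM => //; apply: rpredM; apply: zpu_inv_zp.
Qed.
Lemma congMIl m u x y : zpu p u -> cong p m (u * x) (u * y) -> cong p m x y.
Proof.
move=> uu /(congMl (zpu_inv_zp uu)); by rewrite !mulKf ?(zpu_neq0 uu).
Qed.
Lemma cong_prod (I : Type) (r : seq I) (P : pred I) (F G : I -> rat) m :
  (forall i, P i -> F i \in zp p) -> (forall i, P i -> G i \in zp p) ->
  (forall i, P i -> cong p m (F i) (G i)) ->
  cong p m (\prod_(i <- r | P i) F i) (\prod_(i <- r | P i) G i).
Proof.
move=> Fz Gz h; elim: r => [|i r IH]; first by rewrite !big_nil cong_refl.
rewrite !big_cons; case: ifP => // Pi.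
by apply: congM; [apply: rpred_prod | apply: Gz | apply: h | ].
Qed.
Lemma cong_sum (I : Type) (r : seq I) (P : pred I) (F G : I -> rat) m :
  (forall i, P i -> cong p m (F i) (G i)) ->
  cong p m (\sum_(i <- r | P i) F i) (\sum_(i <- r | P i) G i).
Proof.
move=> h; elim: r => [|i r IH]; first by rewrite !big_nil cong_refl.
by rewrite !big_cons; case: ifP => // Pi; apply: congD => //; apply: h.
Qed.
Lemma congX m x y k : x \in zp p -> y \in zp p -> cong p m x y -> cong p m (x ^+ k) (y ^+ k).
Proof.
move=> xz yz h; elim: k => [|k IH]; first by rewrite !expr0 cong_refl.
by rewrite !exprS; apply: congM; rewrite ?rpredX.
Qed.
Lemma cong_int m (a b : int) : cong p m a%:~R b%:~R <-> (p%:Z ^+ m %| a - b)%Z.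
Proof.
split=> [/congP[c cp E]|/dvdzP[c E]]; last first.
  by apply/congP; exists c%:~R; rewrite ?zp_int // -intrB E intrM rmorphXn mulrC.
have cp' : coprime p `|denq c|%N by [].
rewrite -(@Gauss_dvdzl _ _ (denq c)); last first.
  by rewrite coprimezE abszX coprimeXl.
apply/dvdzP; exists (numq c); apply/eqP; rewrite -(eqr_int rat) !intrM intrB E numqE.
by rewrite rmorphXn /=; apply/eqP; ring.
Qed.
(* Cancels the conjugate factor of a difference of squares. *)
Lemma cong_sqr m x y : (2 < p)%N -> zpu p y ->
  cong p m (x ^+ 2) (y ^+ 2) -> cong p 1 x y -> cong p m x y.
Proof.
move=> p2 yu h h1.
have u : zpu p (x + y).
  apply: (@cong_unit 0 _ (2 * y)); last by rewrite zpuM // zpu_small.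
  by rewrite (_ : 2 * y = y + y); [apply: congD => //; apply: cong_refl | ring].
move: h; rewrite /cong => h.
have -> : (x - y) / p%:R ^+ m = (x ^+ 2 - y ^+ 2) / p%:R ^+ m * (x + y)^-1.
  by field; rewrite (zpu_neq0 u) pXn0.
by apply: rpredM => //; apply: zpu_inv_zp.
Qed.
Lemma cong_pcongr m x y : cong p m x y -> y \in zp p -> pcongr p m x y.
Proof. by move=> h yz; split=> //; [exact: cong_zp h yz | apply/congP]. Qed.
End Cong.

(** * The perturbed series P(z): vanishing at a = -n, comparison with P(0), closed form *)

Definition vwp_ratio (a z : rat) (j : nat) : rat :=
  (a + j%:R) * ((a + j%:R) ^+ 3 + z)
    / ((j%:R + 1) * ((j%:R + 1) ^+ 3 - z)).
Definition vwp_sum (m : nat) (a z : rat) : rat :=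
  \sum_(k < m) (a + 2 * k%:R) * \prod_(j < k) vwp_ratio a z j.

(** With w(i) = i (i^3 - z) the ratio at a = -n is w(n - j) / w(j + 1). The k-th product is
    therefore a generalized binomial coefficient, symmetric under k -> n - k, while the factor -n +
    2k changes sign. Terms with k > n contain the zero factor a + n. *)
Lemma vwp_sum0 (n m : nat) z : (n < m)%N ->
  (forall j, (j < n)%N -> (j%:R + 1) ^+ 3 != z) ->
  vwp_sum m (- n%:R) z = 0.
Proof.
move=> nm zP.
have -> : vwp_sum m (- n%:R) z = vwp_sum n.+1 (- n%:R) z.
  rewrite /vwp_sum -!(big_mkord xpredT (fun k => (_ + 2 * k%:R) * \prod_(j < k) vwp_ratio _ z j)).
  rewrite (big_cat_nat (n := n.+1)) //= [X in _ + X]big_nat_cond [X in _ + X]big1 ?addr0 //.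
  move=> k /andP[/andP[nk _] _]; rewrite (bigD1 (Ordinal nk)) //=.
  by rewrite /vwp_ratio addNr !mul0r mulr0.
pose w (i : nat) : rat := i%:R * (i%:R ^+ 3 - z).
pose W k := \prod_(j < k) w j.+1.
have w_neq0 j : (j < n)%N -> w j.+1 != 0.
  by move=> jn; rewrite mulf_neq0 ?pnatr_eq0 // subr_eq0 -natr1 zP.
have W_neq0 k : (k <= n)%N -> W k != 0.
  by move=> kn; apply/prodf_neq0 => j _; apply: w_neq0; apply: leq_trans kn.
have WS k : W k.+1 = W k * w k.+1 by rewrite /W big_ord_recr.
have ratioE k : (k <= n)%N -> \prod_(j < k) vwp_ratio (- n%:R) z j = W n / (W k * W (n - k)%N).
  elim: k => [_|k IHk kn]; first by rewrite big_ord0 subn0 /W big_ord0 mul1r divff // W_neq0.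
  rewrite big_ord_recr /= IHk ?(ltnW kn) //.
  have E : (n - k = (n - k.+1).+1)%N by rewrite -subSn.
  rewrite WS E WS -E.
  have := w_neq0 k kn; have := w_neq0 (n - k.+1)%N; rewrite -E => /(_ ltac:(lia)).
  have := W_neq0 k (ltnW kn); have := W_neq0 (n - k.+1)%N ltac:(lia).
  move=> h1 h2 h3 h4.
  have -> : vwp_ratio (- n%:R) z k = w (n - k)%N / w k.+1.
    rewrite /vwp_ratio /w -(natr1 k) natrB ?(ltnW kn) //; congr (_ / _); ring.
  by field; rewrite h1 h2 h3 h4.
pose F k := (- n%:R + 2 * k%:R) * (W n / (W k * W (n - k)%N)).
have -> : vwp_sum n.+1 (- n%:R) z = \sum_(k < n.+1) F k.
  by apply: eq_bigr => k _; rewrite ratioE // -ltnS.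
have : \sum_(k < n.+1) F k = - \sum_(k < n.+1) F k.
  rewrite {1}(reindex_inj rev_ord_inj) /= -sumrN; apply: eq_bigr => k _.
  have kn : (k <= n)%N by rewrite -ltnS.
  by rewrite /F subSS subKn // natrB // [W (n - k)%N * _]mulrC; ring.
by move=> h; lra.
Qed.

Section Perturbation.
Variables (p : nat) (p_pr : prime p) (n : nat) (a : rat).
Hypotheses (np : (n < p)%N) (azp : a \in zp p) (an : (a + n%:R) / p%:R \in zp p).
Let z := - (a + n%:R) ^+ 3.

(* The values of a function f at (a, z), (a, 0), (-n, z), (-n, 0), for f with
   mixed second difference divisible by p z. *)
Let mixed (f1 f2 f3 f4 : rat) :=
  [/\ [/\ f2 \in zp p & f4 \in zp p], [/\ cong p 3 f1 f2, cong p 3 f3 f4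
     & cong p 1 f2 f4] & cong p 4 (f1 - f2) (f3 - f4)].

(** Leibniz rule: besides the mixed differences of the two factors there arise only a z-difference
    of one times an a-difference of the other, of order p^3 p, and products of two z-differences, of
    order p^6. *)
Let mixedM f1 f2 f3 f4 g1 g2 g3 g4 : mixed f1 f2 f3 f4 -> mixed g1 g2 g3 g4 ->
  mixed (f1 * g1) (f2 * g2) (f3 * g3) (f4 * g4).
Proof.
case=> [[f2z f4z] [/congP[] // A Az /eqP + /congP[] // B Bz /eqP + /congP[] // c cz /eqP] +].
rewrite !subr_eq => /eqP-> /eqP-> /eqP; rewrite expr1 => f2E /congP[] // e ez eE.
case=> [[g2z g4z] [/congP[] // C Cz /eqP + /congP[] // D Dz /eqP + /congP[] // d dz /eqP] +].
rewrite !subr_eq => /eqP-> /eqP-> /eqP; rewrite expr1 => g2E /congP[] // h hz hE.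
have pz : p%:R \in zp p by apply: zp_nat.
have AB : A = B + p%:R * e.
  by apply: (mulfI (pX_neq0 p_pr 3)); move: eE; rewrite !addrK !exprS; lra.
have CD : C = D + p%:R * h.
  by apply: (mulfI (pX_neq0 p_pr 3)); move: hE; rewrite !addrK !exprS; lra.
split; first by rewrite !rpredM.
  split; apply/congP => //.
  - exists (A * g2 + f2 * C + p%:R ^+ 3 * A * C); last by ring.
    by rewrite !(rpredD, rpredM, rpredX).
  - exists (B * g4 + f4 * D + p%:R ^+ 3 * B * D); last by ring.
    by rewrite !(rpredD, rpredM, rpredX).
  - exists (c * g2 + f4 * d); last by rewrite f2E g2E; ring.
    by rewrite !(rpredD, rpredM, rpredX).
apply/congP => //.
exists (e * g2 + B * d + c * C + f4 * h + p%:R ^+ 2 * (A * C - B * D)); last first.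
  by rewrite f2E g2E AB CD; ring.
by rewrite !(rpredD, rpredN, rpredM, rpredX).
Qed.

Let zE : exists2 c, c \in zp p & z = p%:R ^+ 3 * c.
Proof.
exists (- ((a + n%:R) / p%:R) ^+ 3); first by rewrite rpredN rpredX.
by rewrite /z; field; rewrite p_neq0.
Qed.

(** Each of the three factors has mixed difference zero: a + j depends on a alone, (a + j)^3 + z is
    a function of a plus a function of z, and the denominator depends on z alone. *)
Let mixed_ratio (j : nat) : (j.+1 < p)%N ->
  mixed (vwp_ratio a z j) (vwp_ratio a 0 j) (vwp_ratio (- n%:R) z j) (vwp_ratio (- n%:R) 0 j).
Proof.
move=> jp; have [c cz Ez] := zE.
have ju : zpu p (j%:R + 1) by rewrite natr1 zpu_small.
have zz : cong p 3 z 0 by apply/congP => //; exists c; rewrite // subr0.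
have j3 : zpu p ((j%:R + 1) ^+ 3 - 0) by rewrite subr0 zpuX.
have dz : cong p 3 ((j%:R + 1) ^+ 3 - z) ((j%:R + 1) ^+ 3 - 0).
  by apply: congB => //; apply: cong_refl.
have dzu : zpu p ((j%:R + 1) ^+ 3 - z) := cong_unit p_pr dz j3.
have a1 : cong p 1 a (- n%:R) by rewrite /cong opprK expr1.
apply: mixedM; [apply: mixedM|].
- have ajz : a + j%:R \in zp p by rewrite rpredD ?zp_nat.
  have njz : - n%:R + j%:R \in zp p by rewrite rpredD ?rpredN ?zp_nat.
  split; [by [] | split; try exact: cong_refl | by rewrite !subrr; apply: cong_refl].
  by apply: congD => //; apply: cong_refl.
- have ajz : a + j%:R \in zp p by rewrite rpredD ?zp_nat.
  have njz : - n%:R + j%:R \in zp p by rewrite rpredD ?rpredN ?zp_nat.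
  split; first by rewrite !addr0 !rpredX.
    split; try by apply: congD => //; apply: cong_refl.
    apply: congD; last exact: cong_refl.
    by apply: congX => //; apply: congD => //; apply: cong_refl.
  by apply: cong_eq; ring.
- have E x : ((j%:R + 1) * x)^-1 = (j%:R + 1)^-1 * x^-1 :> rat by rewrite invfM.
  split; [by rewrite !E !rpredM ?zpu_inv_zp | split; try exact: cong_refl | exact: cong_refl].
    by rewrite !E; apply: congMl => //; [exact: zpu_inv_zp | apply: congV].
  by rewrite !E; apply: congMl => //; [exact: zpu_inv_zp | apply: congV].
Qed.

(** Both sums at a = -n vanish, so the difference in question equals the mixed second difference of
    the sum, which is controlled term by term. *)
Lemma vwp_sum_perturb : cong p 4 (vwp_sum p a z) (vwp_sum p a 0).
Proof.
have [c cz Ez] := zE.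
have zP (x : rat) (j : nat) : (j < n)%N -> x = z \/ x = 0 -> (j%:R + 1) ^+ 3 != x.
  move=> jn xz; have ju : zpu p ((j%:R + 1) ^+ 3).
    by rewrite natr1 zpuX // zpu_small //= (leq_ltn_trans jn).
  apply/eqP => jE; have : (j%:R + 1) ^+ 3 / p%:R \in zp p; last by apply/negP/zpu_not_dvd.
  rewrite jE; case: xz => ->; last by rewrite mul0r rpred0.
  rewrite Ez (_ : _ / _ = p%:R ^+ 2 * c) ?rpredM ?rpredX ?zp_nat //.
  by field; rewrite p_neq0.
have s1 : vwp_sum p (- n%:R) z = 0 by apply: vwp_sum0 => // j jn; apply: zP; auto.
have s2 : vwp_sum p (- n%:R) 0 = 0 by apply: vwp_sum0 => // j jn; apply: zP; auto.
suff : cong p 4 (vwp_sum p a z - vwp_sum p a 0) (vwp_sum p (- n%:R) z - vwp_sum p (- n%:R) 0).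
  by rewrite s1 s2 subrr {1}/cong subr0.
rewrite -!sumrB; apply: cong_sum => k _.
have a1 : cong p 1 a (- n%:R) by rewrite /cong opprK expr1.
suff [] : mixed
    ((a + 2 * k%:R) * \prod_(j < k) vwp_ratio a z j)
    ((a + 2 * k%:R) * \prod_(j < k) vwp_ratio a 0 j)
    ((- n%:R + 2 * k%:R) * \prod_(j < k) vwp_ratio (- n%:R) z j)
    ((- n%:R + 2 * k%:R) * \prod_(j < k) vwp_ratio (- n%:R) 0 j) by [].
apply: mixedM.
  split.
  - by rewrite !rpredD ?rpredN ?rpredM ?zp_nat.
  - split; try exact: cong_refl.
    by apply: congD => //; apply: cong_refl.
  - by rewrite !subrr; apply: cong_refl.
have : (k <= p.-1)%N by have := ltn_ord k; lia.
elim: (val k) => [_|i IH ip].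
  by rewrite !big_ord0; split; [rewrite rpred1 | split; apply: cong_refl | apply: cong_refl].
by rewrite !big_ord_recr /=; apply: mixedM; [apply: IH; lia | apply: mixed_ratio; lia].
Qed.
End Perturbation.

(** At z = d^3 the cubes split over the cube roots of unity: (a + j)^3 + d^3 contains a + j + d = j
    - n, and (j + 1)^3 - d^3 contains j + 1 - d = a + n + 1 + j. What remains is the 5F4 with b, c =
    a + omega d and its conjugate, that is e1 = 2a - d and e2 = a^2 - a d + d^2. The quadratic
    denominators are positive definite, hence nonzero. *)
Lemma vwp_sum_closed (m n : nat) (a : rat) : 0 < a -> (n < m)%N ->
  let d := - (a + n%:R) in
  vwp_sum m a (d ^+ 3) =
  (\prod_(j < n.+1) (a + j%:R)) * (\prod_(j < n) (j%:R + 1 - 2 * a - n%:R))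
    / \prod_(j < n) ((j%:R + 1) ^+ 2 + d * (j%:R + 1) + d ^+ 2).
Proof.
move=> a_gt0 nm d.
have r_neq0 (j : nat) : (j%:R + 1) ^+ 2 + d * (j%:R + 1) + d ^+ 2 != 0 :> rat.
  suff : 0 < (j%:R + 1) ^+ 2 + d * (j%:R + 1) + d ^+ 2 by rewrite lt_def => /andP[].
  have : 0 < j%:R + 1 :> rat by rewrite natr1.
  move: (_ + 1) d => x e x0.
  rewrite (_ : _ + _ = (x / 2 + e) ^+ 2 + 3 / 4 * x ^+ 2); last by field.
  apply: ltr_wpDl; first exact: sqr_ge0.
  by apply: mulr_gt0; [| exact: exprn_gt0].
have -> : vwp_sum m a (d ^+ 3) = vwp_sum n.+1 a (d ^+ 3).
  rewrite /vwp_sum -!(big_mkord xpredT (fun k => (_ + 2 * k%:R) * \prod_(j < k) vwp_ratio _ _ j)).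
  rewrite (big_cat_nat (n := n.+1)) //= [X in _ + X]big_nat_cond [X in _ + X]big1 ?addr0 //.
  move=> k /andP[/andP[nk _] _]; rewrite (bigD1 (Ordinal nk)) //=.
  by rewrite /vwp_ratio /d (_ : _ ^+ 3 + _ = 0); [ring | rewrite exprNn; ring].
pose e1 := 2 * a - d; pose e2 := a ^+ 2 - a * d + d ^+ 2.
have rE (j : nat) : (a + (j%:R + 1)) ^+ 2 - e1 * (a + (j%:R + 1)) + e2
   = (j%:R + 1) ^+ 2 + d * (j%:R + 1) + d ^+ 2 by rewrite /e1 /e2; ring.
have rN j : (a + (j%:R + 1)) ^+ 2 - e1 * (a + (j%:R + 1)) + e2 != 0 by rewrite rE r_neq0.
transitivity (\sum_(k < n.+1) (a + 2 * k%:R) * \prod_(j < k)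
  ((a + j%:R) * (j%:R - n%:R) * (j%:R ^+ 2 + e1 * j%:R + e2) /
   ((j%:R + 1) * (a + n%:R + 1 + j%:R) * ((a + (j%:R + 1)) ^+ 2 - e1 * (a + (j%:R + 1)) + e2)))).
  apply: eq_bigr => k _; congr (_ * _); apply: eq_bigr => j _.
  rewrite /vwp_ratio rE; congr (_ / _); rewrite /e1 /e2 /d; ring.
rewrite (vwp_5F4 n a_gt0 rN).
congr (_ * _ / _); last by apply: eq_bigr => j _; rewrite rE.
by apply: eq_bigr => j _; rewrite /e1 /d; ring.
Qed.

(** * Congruences for factorials *)

Definition poch (x : rat) (n : nat) : rat := \prod_(j < n) (x + j%:R).

Lemma poch0 x : poch x 0 = 1. Proof. by rewrite /poch big_ord0. Qed.
Lemma pochS x n : poch x n.+1 = poch x n * (x + n%:R).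
Proof. by rewrite /poch big_ord_recr. Qed.
Lemma poch_fact n : poch 1 n = n`!%:R.
Proof.
elim: n => [|n IH]; first by rewrite poch0.
by rewrite pochS IH factS natrM nat1r mulrC.
Qed.
Lemma pochD x m n : poch x (m + n) = poch x m * poch (x + m%:R) n.
Proof.
elim: n => [|n IH]; first by rewrite addn0 poch0 mulr1.
by rewrite addnS !pochS IH natrD -mulrA addrA.
Qed.
Lemma poch_rev x n : poch x n = (-1) ^+ n * poch (1 - x - n%:R) n.
Proof.
rewrite /poch [in RHS](reindex_inj rev_ord_inj) /= -[n in (-1) ^+ n]card_ord.
rewrite -prodrN; apply: eq_bigr => j _; rewrite natrB // -natr1; ring.
Qed.
Lemma poch_double x n : poch (2 * x) (2 * n) = 4 ^+ n * poch x n * poch (x + 1 / 2) n.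
Proof.
elim: n => [|n IH]; first by rewrite muln0 !poch0 !mulr1.
by rewrite mulnS !pochS exprS IH -!natr1 natrM; field.
Qed.

Section PochCong.
Variables (p : nat) (p_pr : prime p).
Lemma poch_zp x n : x \in zp p -> poch x n \in zp p.
Proof. by move=> xz; apply: rpred_prod => j _; rewrite rpredD ?zp_nat. Qed.
Lemma poch_cong m x y n : x \in zp p -> y \in zp p -> cong p m x y ->
  cong p m (poch x n) (poch y n).
Proof.
move=> xz yz xy; apply: cong_prod => // j _; rewrite ?rpredD ?zp_nat //.
by apply: congD => //; apply: cong_refl.
Qed.
Lemma fact_zpu n : (n < p)%N -> zpu p n`!%:R.
Proof.
move=> np; rewrite -poch_fact; apply: zpu_prod => // j _.
by rewrite nat1r zpu_small //=; apply: leq_ltn_trans np.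
Qed.
Lemma cong_natp m (i j : nat) : (i = j %[mod p ^ m])%N -> cong p m i%:R j%:R.
Proof.
move=> ij; apply/(cong_int p_pr m i j).
have -> : p%:Z ^+ m = (p ^ m)%N by elim: m {ij} => // m IH; rewrite exprS IH expnS.
by rewrite -eqz_mod_dvd !modz_nat ij.
Qed.
Lemma cong_p0 : cong p 1 p%:R 0.
Proof. by rewrite /cong subr0 expr1 divff ?rpred1 // p_neq0. Qed.

Lemma wilson_cong : cong p 1 (p.-1)`!%:R (- 1).
Proof.
rewrite /cong opprK natr1 expr1.
have := p_pr; rewrite (Wilson (prime_gt1 p_pr)) => /dvdnP[k ->].
by rewrite natrM mulfK ?zp_nat // p_neq0.
Qed.
Lemma fermat_cong x : zpu p x%:R -> cong p 1 (x%:R ^+ p.-1) 1.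
Proof.
move=> xu; rewrite -natrX -[1]/(1%:R); apply: cong_natp; rewrite expn1.
have cx : coprime x p.
  by rewrite coprime_sym prime_coprime //; apply: (zpu_coprime p_pr (n := x)).
by have := Euler_exp_totient cx; rewrite totient_prime.
Qed.

Variables (N : nat) (pN : p = N.*2.+1).

(** Modulo p the upper half of (p - 1)! is (-1)^N times the lower half N!, so Wilson's theorem gives
    the square. *)
Lemma half_fact_sqr : cong p 1 (N`!%:R ^+ 2) ((-1) ^+ N.+1).
Proof.
have E : (p.-1)`!%:R = N`!%:R * poch (1 + N%:R) N by rewrite -!poch_fact -pochD pN addnn.
have h : cong p 1 (poch (1 + N%:R) N) ((-1) ^+ N * N`!%:R).
  rewrite poch_rev -poch_fact; apply: congMl; first by rewrite rpredX ?rpredN ?rpred1.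
  apply: poch_cong; rewrite ?(rpredD, rpredN, rpred1, zp_nat) //.
  apply: (cong_trans _ (y := 1 - p%:R)).
    by apply: cong_eq; rewrite pN -natr1 -addnn natrD; ring.
  by rewrite /cong; rewrite (_ : _ / _ = -1) ?rpredN ?rpred1 // expr1; field; rewrite p_neq0.
have := wilson_cong; rewrite E => w.
have {}h : cong p 1 ((-1) ^+ N * N`!%:R ^+ 2) (-1).
  apply: cong_trans w; apply: cong_sym.
  by rewrite expr2 mulrCA; apply: congMl; rewrite ?zp_nat.
have sz : (-1) ^+ N \in zp p by rewrite rpredX ?rpredN ?rpred1.
have := congMl sz h; rewrite mulrA -exprD addnn -mul2n exprM sqrrN !expr1n mul1r.
by rewrite (exprSr _ N).
Qed.

(** Even factors of n! contribute 2^h h! with h = n./2, odd factors 2^(n - h) (1/2)_(n - h). *)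
Lemma fact_parity n : (n`!)%:R = 2 ^+ n./2 * n./2`!%:R * poch (1 / 2) (n - n./2) * 2 ^+ (n - n./2) :> rat.
Proof.
have even_case h : (h.*2)`!%:R = 2 ^+ h * h`!%:R * poch (1 / 2) h * 2 ^+ h :> rat.
  elim: h => [|h IH]; first by rewrite poch0 !mulr1.
  by rewrite doubleS !factS !natrM IH pochS !exprS -!natr1 -addnn natrD; field.
have [e | o] := boolP (odd n); last first.
  have E : n = n./2.*2 by lia.
  by rewrite {1}E even_case (_ : (n - n./2 = n./2)%N); last lia.
have E : n = n./2.*2.+1 by lia.
rewrite {1}E factS natrM even_case (_ : (n - n./2 = n./2.+1)%N); last lia.
by rewrite pochS exprS -natr1 -addnn natrD; field.
Qed.

(* As in Gauss's lemma, the even numbers 2j above N are replaced by the odd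
   numbers p - 2j below N. *)
Lemma pow2_half : cong p 1 (2 ^+ N) ((-1) ^+ (N - N./2)).
Proof.
set h := N./2; set m := (N - h)%N.
have hm : (h + m)%N = N by rewrite /m /h; lia.
have NF : N`!%:R = h`!%:R * poch (1 + h%:R) m by rewrite -!poch_fact -pochD hm.
have two_zpu : zpu p 2 by apply: zpu_small => //; have := prime_gt1 p_pr; lia.
have half_zp : 1 / 2 \in zp p by rewrite mul1r zpu_inv_zp.
have hc : cong p 1 (poch (1 + h%:R) m) ((-1) ^+ m * poch (1 / 2) m).
  rewrite poch_rev; apply: congMl; first by rewrite rpredX ?rpredN ?rpred1.
  apply: poch_cong; rewrite ?(rpredD, rpredN, rpred1, zp_nat) //.
  rewrite /cong (_ : _ - _ = - (p%:R / 2)); last first.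
    by rewrite pN -(natr1 N.*2) -addnn -hm !natrD; field.
  have -> : - (p%:R / 2) / p%:R ^+ 1 = - (1 / 2) :> rat by rewrite expr1; field; rewrite p_neq0.
  by rewrite rpredN.
have := fact_parity N; rewrite -/h -/m NF => NE.
have hu : zpu p h`!%:R by apply: fact_zpu => //; rewrite pN; lia.
have Nu : zpu p N`!%:R by apply: fact_zpu => //; rewrite pN; lia.
have bu : zpu p (poch (1 / 2) m).
  apply: (zpu_factor (x := 2 ^+ h * h`!%:R * 2 ^+ m)); rewrite ?poch_zp //.
    by rewrite !rpredM ?rpredX ?zp_nat.
  by rewrite mulrAC -NE -NF.
apply: (congMIl (u := h`!%:R * poch (1 / 2) m)); first by rewrite zpuM.
have -> : h`!%:R * poch (1 / 2) m * 2 ^+ N = h`!%:R * poch (1 + h%:R) m.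
  by rewrite NE -hm exprD; ring.
by rewrite -mulrA; apply: congMl; [rewrite zp_nat | rewrite mulrC].
Qed.
End PochCong.

(** * The product for the sum; primes with a double zero *)

Section Closed.
Variables (p : nat) (p_pr : prime p) (p_gt3 : (3 < p)%N).

Definition binom_sum : rat :=
  \sum_(0 <= k < p) (16 * k%:R + 3) * gbinom (- (3 / 8)) k ^+ 4.

Lemma binom_sumE : binom_sum = 8 * vwp_sum p (3 / 8) 0.
Proof.
rewrite /binom_sum big_mkord /vwp_sum mulr_sumr; apply: eq_bigr => k _.
rewrite mulrA; congr (_ * _); first by field.
rewrite /gbinom; elim: (val k) => [|i IH].
  by rewrite !big_ord0 fact0 divr1 expr1n.
rewrite !big_ord_recr /= -IH /vwp_ratio factS natrM -(natr1 i) subr0 addr0.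
by field; rewrite !pnatr_eq0 -lt0n fact_gt0 natr1 pnatr_eq0.
Qed.

Lemma p_odd : odd p.
Proof. by case: (even_prime p_pr) p_gt3 => [->|]. Qed.

Lemma zpu2 : zpu p 2. Proof. by apply: zpu_small => //; lia. Qed.
Lemma zpu4 : zpu p 4.
Proof. by rewrite (_ : 4 = 2 * 2) ?zpuM ?zpu2 //; ring. Qed.
Lemma zpu8 : zpu p 8.
Proof. by rewrite (_ : 8 = 2 * 4) ?zpuM ?zpu2 ?zpu4 //; ring. Qed.
Lemma a_zp : 3 / 8 \in zp p.
Proof. by rewrite rpredM ?zp_nat ?(zpu_inv_zp zpu8). Qed.

(** The factors are the norms of j + 1 - omega d from Q(omega), omega a primitive cube root of
    unity; for d divisible by p the product is n!^2 modulo p. *)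
Definition norm_prod (d : rat) n := \prod_(j < n) ((j%:R + 1) ^+ 2 + d * (j%:R + 1) + d ^+ 2).

Section Residue.
Variables (n : nat) (c : rat).
Hypotheses (np : (n < p)%N) (cz : c \in zp p) (nE : 3 / 8 + n%:R = p%:R * c).

Lemma binom_sum_closed : cong p 4 binom_sum
  (8 * (poch (3 / 8) n.+1 * ((-1) ^+ n * poch (3 / 4) n) / norm_prod (- (p%:R * c)) n)).
Proof.
rewrite binom_sumE; apply: congMl; first by rewrite zp_nat.
have an : (3 / 8 + n%:R) / p%:R \in zp p by rewrite nE mulrC mulKf // p_neq0.
apply: cong_trans (cong_sym (vwp_sum_perturb p_pr np a_zp an)) _.
have -> : - (3 / 8 + n%:R) ^+ 3 = (- (3 / 8 + n%:R)) ^+ 3 :> rat by ring.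
have a0 : 0 < 3 / 8 :> rat by lra.
have -> := vwp_sum_closed a0 np; rewrite nE; apply: cong_eq; congr (_ * _ / _).
rewrite poch_rev mulrA -exprMn mulrNN mulr1 expr1n mul1r.
by apply: eq_bigr => j _; field.
Qed.

Lemma poch_residue : cong p 1 (poch (3 / 8) n) ((-1) ^+ n * n`!%:R).
Proof.
rewrite poch_rev -poch_fact; apply: congMl; first by rewrite rpredX ?rpredN ?rpred1.
have E : 1 - 3 / 8 - n%:R = 1 - p%:R * c by rewrite -nE; ring.
rewrite E.
apply: (poch_cong p_pr).
- by rewrite rpredB ?rpredM ?zp_nat ?rpred1.
- by rewrite rpred1.
by rewrite /cong addrAC subrr sub0r expr1 mulNr rpredN mulrC mulKf ?p_neq0.
Qed.

Lemma pc0 : cong p 1 (- (p%:R * c)) 0.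
Proof. by rewrite /cong subr0 expr1 mulNr rpredN mulrC mulKf // p_neq0. Qed.

Lemma pcz : - (p%:R * c) \in zp p.
Proof. by rewrite rpredN rpredM ?zp_nat. Qed.

Lemma norm_prod_cong : cong p 1 (norm_prod (- (p%:R * c)) n) (n`!%:R ^+ 2).
Proof.
have pz := pcz.
rewrite -poch_fact /poch -prodrXl; apply: (cong_prod p_pr) => // j _.
- by rewrite !(rpredD, rpredM, rpredX, rpred1, zp_nat).
- by rewrite !(rpredD, rpredM, rpredX, rpred1, zp_nat).
rewrite -[X in cong _ _ _ X]addr0; apply: congD => //; last first.
  rewrite -[X in cong _ _ _ X](mul0r 0) expr2; apply: (congM p_pr) => //; rewrite ?rpred0 //; exact: pc0.
rewrite addrC [1 + _]addrC; rewrite -[X in cong _ _ _ X]add0r; apply: congD => //; last exact: cong_refl.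
rewrite -[X in cong _ _ _ X](mul0r (j%:R + 1)); apply: congMr => //; last exact: pc0.
by rewrite rpredD ?zp_nat ?rpred1.
Qed.

Lemma norm_prod_zpu : zpu p (norm_prod (- (p%:R * c)) n).
Proof. by apply: (cong_unit p_pr norm_prod_cong); rewrite zpuX ?fact_zpu. Qed.
End Residue.

Lemma fact_reflect k : (k < p)%N -> cong p 1 (k`!%:R * (p.-1 - k)`!%:R) ((-1) ^+ k.+1).
Proof.
move=> kp; have kE : (k + (p.-1 - k))%N = p.-1 by lia.
have FE : (p.-1)`!%:R = k`!%:R * poch (1 + k%:R) (p.-1 - k) by rewrite -!poch_fact -pochD kE.
have sgE : (-1) ^+ (p.-1 - k) = (-1) ^+ k :> rat.
  by rewrite -signr_odd -[RHS]signr_odd; congr (_ ^+ nat_of_bool _); have := p_odd; lia.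
have h : cong p 1 (poch (1 + k%:R) (p.-1 - k)) ((-1) ^+ k * (p.-1 - k)`!%:R).
  rewrite poch_rev sgE -poch_fact; apply: congMl; first by rewrite rpredX ?rpredN ?rpred1.
  apply: (poch_cong p_pr); rewrite ?(rpredD, rpredN, rpred1, zp_nat) //.
  have -> : 1 - (1 + k%:R) - (p.-1 - k)%:R = 1 - p%:R :> rat.
    by rewrite -[in RHS](prednK (prime_gt0 p_pr)) -[in RHS]kE -natr1 natrD; ring.
  rewrite /cong (_ : (1 - p%:R - 1) / p%:R ^+ 1 = -1) ?rpredN ?rpred1 // expr1; field; exact: p_neq0.
have sz : (-1) ^+ k \in zp p by rewrite rpredX ?rpredN ?rpred1.
have := wilson_cong p_pr; rewrite FE => w.
have {}h : cong p 1 (k`!%:R * ((-1) ^+ k * (p.-1 - k)`!%:R)) (-1).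
  by apply: cong_trans w; apply: cong_sym; apply: congMl; rewrite ?zp_nat.
have := congMl sz h; rewrite exprSr.
by rewrite mulrCA [(-1) ^+ k * (_ * _)]mulrA -exprMn mulrNN mulr1 expr1n mul1r.
Qed.

Section DoubleZero.
Variables (n j0 : nat) (c : rat).
Hypotheses (np : (n < p)%N) (cz : c \in zp p) (nE : 3 / 8 + n%:R = p%:R * c).
Hypotheses (j0E : (j0 + p = n.*2)%N).

(** Here 2n >= p, and (3/4)_n is cut at its factor of index j0 = 2n - p, which equals p (2c - 1).
    With p c from (3/8)_(n+1) this makes p^2 explicit, so the remaining Pochhammer symbols are
    needed only modulo p, where they are factorials up to sign. *)
Lemma binom_sum_double_zero : cong p 3 binom_sum
  (p%:R ^+ 2 * (8 * c * (2 * c - 1) * (-1) ^+ j0 * j0`!%:R * (p.-1 - n)`!%:R / n`!%:R)).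
Proof.
have j0E' : (j0%:R = 2 * n%:R - p%:R :> rat).
  by rewrite -(natrM _ 2 n) mul2n -j0E natrD addrK.
have j0R : 3 / 4 + j0%:R = p%:R * (2 * c - 1).
  by rewrite j0E' mulrBr mulrCA -nE; field.
have nD : n = (j0 + (p.-1 - n).+1)%N by lia.
apply: cong_trans (cong_le p_pr _ (binom_sum_closed np cz nE)) _ => //.
have -> : poch (3 / 4) n = poch (3 / 4) j0 * (p%:R * (2 * c - 1) * poch (1 + p%:R * (2 * c - 1)) (p.-1 - n)).
  rewrite {1}nD pochD j0R; congr (_ * _).
  rewrite /poch big_ord_recl addr0; congr (_ * _); apply: eq_bigr => j _.
  by rewrite /= /bump /= natrD; ring.
rewrite pochS nE.
set R := poch (1 + _) _; set NP := norm_prod _ _.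
have -> : 8 * (poch (3 / 8) n * (p%:R * c) * ((-1) ^+ n *
   (poch (3 / 4) j0 * (p%:R * (2 * c - 1) * R))) / NP) =
   p%:R ^+ 2 * (8 * c * (2 * c - 1) * (((-1) ^+ n * poch (3 / 8) n) * poch (3 / 4) j0 * R / NP)).
  by field; rewrite (zpu_neq0 (norm_prod_zpu np cz)).
apply: (cong_pX p_pr 2 (m := 1)).
have -> : 8 * c * (2 * c - 1) * (-1) ^+ j0 * j0`!%:R * (p.-1 - n)`!%:R / n`!%:R =
  8 * c * (2 * c - 1) * (n`!%:R * ((-1) ^+ j0 * j0`!%:R) * (p.-1 - n)`!%:R / n`!%:R ^+ 2).
  by field; rewrite pnatr_eq0 -lt0n fact_gt0.
have c'z : 2 * c - 1 \in zp p by rewrite rpredB ?rpredM ?zp_nat ?rpred1.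
have pc'z : p%:R * (2 * c - 1) \in zp p by rewrite rpredM ?zp_nat.
have sz m : (-1) ^+ m \in zp p by rewrite rpredX ?rpredN ?rpred1.
have nu : zpu p (n`!%:R ^+ 2) by rewrite zpuX // fact_zpu.
have pc'0 : cong p 1 (p%:R * (2 * c - 1)) 0.
  by rewrite /cong subr0 expr1 mulrC mulKf // p_neq0.
apply: congMl; first by rewrite !rpredM ?zp_nat.
have a34 : 3 / 4 \in zp p by rewrite rpredM ?zp_nat // zpu_inv_zp // zpu4.
have Rz : R \in zp p by rewrite poch_zp // rpredD ?rpred1.
apply: (congM p_pr) => //.
- by rewrite zpu_inv_zp // norm_prod_zpu.
- by rewrite !rpredM ?zp_nat.
- apply: (congM p_pr) => //; first by rewrite !rpredM ?zp_nat.
    apply: (congM p_pr); rewrite ?rpredM ?zp_nat ?poch_zp //.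
      have /(congMl (sz n)) := poch_residue cz nE.
      by rewrite mulrA -exprMn mulrNN mulr1 expr1n mul1r.
    rewrite poch_rev -poch_fact; apply: congMl => //.
    have -> : 1 - 3 / 4 - j0%:R = 1 - p%:R * (2 * c - 1) by rewrite -j0R; ring.
    apply: (poch_cong p_pr); rewrite ?rpredB ?rpred1 // -[X in cong _ _ _ X]subr0.
    by apply: congB => //; apply: cong_refl.
  rewrite -poch_fact; apply: (poch_cong p_pr); rewrite ?rpredD ?rpred1 // -[X in cong _ _ _ X]addr0.
  by apply: congD => //; apply: cong_refl.
- by apply: (congV p_pr) => //; [apply: norm_prod_zpu | apply: norm_prod_cong].
Qed.

Variables (N M : nat).
Hypotheses (pN : p = N.*2.+1) (nN : n = (N + M)%N).

Lemma j0M : (M.*2 = j0.+1)%N. Proof. by lia. Qed.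

(* Duplication: (2M)! = 4 ^ M M! (1/2)_M, and 1/2 = N + 1 modulo p. *)
Lemma double_fact_cong : cong p 1 (M.*2`!%:R ^+ 2) ((-1) ^+ N.+1 * 4 ^+ M.*2 * M`!%:R ^+ 2 * n`!%:R ^+ 2).
Proof.
have E1 : M.*2`!%:R = 4 ^+ M * poch (1 / 2) M * M`!%:R :> rat.
  rewrite -!poch_fact -mul2n -[in LHS](_ : 2 * (1 / 2) = 1 :> rat); last by field.
  by rewrite poch_double; congr (_ * poch _ _); field.
have E2 : N`!%:R * poch (1 + N%:R) M = n`!%:R :> rat.
  by rewrite -!poch_fact nN pochD.
have hz : 1 / 2 \in zp p by rewrite mul1r zpu_inv_zp // zpu2.
have hc : cong p 1 (poch (1 / 2) M) (poch (1 + N%:R) M).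
  apply: (poch_cong p_pr); rewrite ?rpredD ?rpred1 ?zp_nat //.
  rewrite /cong; have -> : (1 / 2 - (1 + N%:R)) / p%:R ^+ 1 = - (1 / 2) :> rat; last by rewrite rpredN.
  rewrite expr1 pN -(natr1 N.*2) -addnn natrD; field.
  by rewrite -natrD addnn natr1 pnatr_eq0.
have Nu : zpu p N`!%:R by apply: fact_zpu => //; lia.
have N2 := half_fact_sqr p_pr pN.
apply: (congMIl (u := N`!%:R ^+ 2)); first by rewrite zpuX.
apply: (cong_trans (y := 4 ^+ M.*2 * M`!%:R ^+ 2 * n`!%:R ^+ 2)).
  rewrite -E2 E1 -(muln2 M) exprM.
  apply: (cong_trans (y := N`!%:R ^+ 2 * (4 ^+ M * poch (1 + N%:R) M * M`!%:R) ^+ 2)).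
    apply: congMl; rewrite ?rpredX ?zp_nat //.
    have pz : poch (1 + N%:R) M \in zp p by rewrite poch_zp // rpredD ?rpred1 ?zp_nat.
    have pz' : poch (1 / 2) M \in zp p by rewrite poch_zp.
    apply: (congX p_pr); rewrite ?rpredM ?rpredX ?zp_nat //.
    by apply: congMr; rewrite ?zp_nat //; apply: congMl; rewrite ?rpredX ?zp_nat.
  by apply: cong_eq; ring.
have {}N2 := congMr (z := (-1) ^+ N.+1 * 4 ^+ M.*2 * M`!%:R ^+ 2 * n`!%:R ^+ 2) _ (cong_sym N2).
apply: cong_trans (N2 _); last by rewrite !rpredM ?rpredX ?rpredN ?rpred1 ?zp_nat.
have ss : (-1) ^+ N.+1 * (-1) ^+ N.+1 = 1 :> rat by rewrite -exprMn mulrNN mulr1 expr1n.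
by apply: cong_eq; rewrite !mulrA ss mul1r.
Qed.

(** The factorials combine into a central binomial coefficient with M = n - N, 2M = j0 + 1:
    [fact_reflect] removes (p - 1 - n)!, [double_fact_cong] removes n!^2, and j0! = (2M)! / (2M),
    where 4 (2M) = 1 modulo p is the source of the factor 4. The values c = 7/8, w = 4 and c = 5/8,
    w = 2 turn 8c (2c - 1) 4w into the constants 84 and 10 for p = 5 and 7 mod 8. *)
Lemma binom_sum_double_zero_value (w : rat) (sg : bool) :
  cong p 1 ((-1) ^+ N.+1 * 4 ^+ M.*2) w -> odd n = sg -> w \in zp p ->
  cong p 3 binom_sum
    ((-1) ^+ sg * (8 * c * (2 * c - 1) * 4 * w * p%:R ^+ 2 / 'C(M.*2, M)%:R)).
Proof.
move=> wE sgE wz.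
have sz m : (-1) ^+ m \in zp p by rewrite rpredX ?rpredN ?rpred1.
apply: cong_trans binom_sum_double_zero _ => //.
have binE : 'C(M.*2, M)%:R = M.*2`!%:R / M`!%:R ^+ 2 :> rat.
  rewrite -(@bin_fact M.*2 M); last by lia.
  rewrite -addnn addnK !natrM; field.
  by rewrite pnatr_eq0 -lt0n fact_gt0.
have -> : (-1) ^+ sg * (8 * c * (2 * c - 1) * 4 * w * p%:R ^+ 2 / 'C(M.*2, M)%:R) =
  p%:R ^+ 2 * (8 * c * (2 * c - 1) * ((-1) ^+ sg * 4 * w * M`!%:R ^+ 2 / M.*2`!%:R)).
  by rewrite binE; field; rewrite !pnatr_eq0 -!lt0n !fact_gt0.
apply: (cong_pX p_pr 2 (m := 1)).
have -> : 8 * c * (2 * c - 1) * (-1) ^+ j0 * j0`!%:R * (p.-1 - n)`!%:R / n`!%:R =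
  8 * c * (2 * c - 1) * ((-1) ^+ j0 * j0`!%:R * (p.-1 - n)`!%:R / n`!%:R) by rewrite !mulrA.
apply: congMl.
  by rewrite !rpredM ?zp_nat // rpredB ?rpredM ?zp_nat ?rpred1.
have Mp : (M.*2 < p)%N by lia.
have nu : zpu p n`!%:R by apply: fact_zpu.
have Mu : zpu p M.*2`!%:R by apply: fact_zpu.
have MM : zpu p (M.*2)%:R by apply: zpu_small => //; lia.
apply: (congMIl (u := n`!%:R ^+ 2 * M.*2`!%:R * (M.*2)%:R)); first by rewrite !zpuM ?zpuX.
have FE : M.*2`!%:R = (M.*2)%:R * j0`!%:R :> rat by rewrite j0M factS natrM.
apply: (cong_trans (y := (-1) ^+ j0 * (-1) ^+ n.+1 * M.*2`!%:R ^+ 2)).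
  have hz : (-1) ^+ j0 * M.*2`!%:R ^+ 2 \in zp p by rewrite rpredM ?sz ?rpredX ?zp_nat.
  have := congMl hz (fact_reflect np); congr cong; last by rewrite mulrAC.
  have FE2 : M.*2`!%:R ^+ 2 = M.*2`!%:R * ((M.*2)%:R * j0`!%:R) :> rat by rewrite -FE.
  by rewrite FE2; field; rewrite pnatr_eq0 -lt0n fact_gt0.
have jn : (-1) ^+ j0 * (-1) ^+ n.+1 = (-1) ^+ sg :> rat.
  rewrite -exprD -signr_odd -sgE; congr (_ ^+ nat_of_bool _).
  by have := p_odd; lia.
rewrite jn.
have -> : n`!%:R ^+ 2 * M.*2`!%:R * (M.*2)%:R * ((-1) ^+ sg * 4 * w * M`!%:R ^+ 2 / M.*2`!%:R) =
   (-1) ^+ sg * ((w * (n`!%:R ^+ 2 * M`!%:R ^+ 2)) * (4 * (M.*2)%:R)).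
  by field; rewrite pnatr_eq0 -lt0n fact_gt0.
apply: congMl => //.
rewrite -[X in cong _ _ X _]mulr1; apply: (congM p_pr); rewrite ?rpred1 ?rpredM ?rpredX ?zp_nat //.
  apply: cong_trans double_fact_cong _ => //.
  rewrite -mulrA [M`!%:R ^+ 2 * _]mulrC; apply: congMr => //.
  by rewrite rpredM ?rpredX ?zp_nat.
have := nE; rewrite nN => nE'.
have ME : 4 * (M.*2)%:R = 1 + p%:R * (8 * c - 4) :> rat.
  move: nE'; rewrite -muln2 natrM natrD; have : p%:R = 2 * N%:R + 1 :> rat.
    by rewrite pN -natr1 -mul2n natrM.
  by move=> -> ; lra.
rewrite ME /cong opprD addNKr expr1 mulNr rpredN mulrC mulKf ?p_neq0 //.
by rewrite rpredB ?rpredM ?zp_nat.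
Qed.
End DoubleZero.
End Closed.

Section FiveSeven.
Variables (p : nat) (p_pr : prime p) (p_gt3 : (3 < p)%N).

Lemma bin_zpu m k : (k <= m)%N -> (m < p)%N -> zpu p 'C(m, k)%:R.
Proof.
move=> km mp; apply: (zpu_factor (x := (k`! * (m - k)`!)%:R)); rewrite ?zp_nat //.
by rewrite -natrM mulnC bin_fact // fact_zpu.
Qed.

Lemma signr_parity (m k : nat) : odd m = odd k -> (-1) ^+ m = (-1) ^+ k :> rat.
Proof. by move=> E; rewrite -signr_odd E signr_odd. Qed.

Lemma binom_sum_5 : (p = 5 %[mod 8])%N -> pcongr p 3 (binom_sum p)
  ((-1) ^+ ((p - 5) %/ 8)%N
     * (84 * p%:R ^+ 2 / 'C((3 * p + 1) %/ 4, (3 * p + 1) %/ 8)%:R)).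
Proof.
move=> p5; have [k pk] : exists k, p = (8 * k + 5)%N by exists (p %/ 8)%N; lia.
have -> : ((p - 5) %/ 8 = k)%N by lia.
have -> : ((3 * p + 1) %/ 4 = (3 * k + 2).*2)%N by lia.
have -> : ((3 * p + 1) %/ 8 = 3 * k + 2)%N by lia.
have Cu : zpu p 'C((3 * k + 2).*2, 3 * k + 2)%:R by apply: bin_zpu; lia.
have pR : p%:R = 8 * k%:R + 5 :> rat by rewrite pk natrD natrM.
have c_zp : 7 / 8 \in zp p by rewrite rpredM ?zp_nat ?(zpu_inv_zp (zpu8 p_pr p_gt3)).
have nE : 3 / 8 + (7 * k + 4)%:R = p%:R * (7 / 8) :> rat by rewrite pR natrD natrM; field.
have wE : cong p 1 ((-1) ^+ (4 * k + 2).+1 * 4 ^+ (3 * k + 2).*2) 4.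
  have pN : p = (4 * k + 2).*2.+1 by lia.
  have := pow2_half p_pr pN; rewrite (@signr_parity _ 1%N); last by lia.
  have -> : (-1) ^+ (4 * k + 2).+1 = -1 :> rat by rewrite (@signr_parity _ 1%N) ?expr1; last by lia.
  rewrite expr1 => h; have -> : 4 ^+ (3 * k + 2).*2 = (2 ^+ (4 * k + 2)) ^+ 3 * 4 :> rat.
    rewrite (_ : 4 = 2 ^+ 2 :> rat); last by ring.
    by rewrite -!exprM -exprD; congr (_ ^+ _); lia.
  rewrite (_ : cong _ _ _ _ = cong p 1 (-1 * ((2 ^+ (4 * k + 2)) ^+ 3 * 4)) (-1 * ((-1) ^+ 3 * 4))); last first.
    by congr cong; ring.
  apply: congMl; first by rewrite rpredN rpred1.
  apply: congMr; first by rewrite zp_nat.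
  by apply: (congX p_pr); [apply: zpX; exact: zp_nat | apply: zpN; exact: rpred1 | exact: h].
apply: cong_pcongr => //; last first.
  apply: zpM; first by apply/zpX/zpN; exact: rpred1.
  by apply: zpM; [apply: zpM; [|apply: zpX]; exact: zp_nat | exact: zpu_inv_zp].
have np : (7 * k + 4 < p)%N by lia.
have jE : (6 * k + 3 + p)%N = (7 * k + 4).*2 by lia.
have pN : p = (4 * k + 2).*2.+1 by lia.
have nN : (7 * k + 4)%N = (4 * k + 2 + (3 * k + 2))%N by lia.
have := binom_sum_double_zero_value p_pr p_gt3 np c_zp nE jE pN nN wE (erefl _) (zp_nat _ 4).
congr cong; rewrite (@signr_parity _ k); last by lia.
by congr (_ * _); field; rewrite (zpu_neq0 Cu).
Qed.

Lemma binom_sum_7 : (p = 7 %[mod 8])%N -> pcongr p 3 (binom_sum p)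
  ((-1) ^+ ((p - 7) %/ 8)%N
     * (10 * p%:R ^+ 2 / 'C((p + 1) %/ 4, (p + 1) %/ 8)%:R)).
Proof.
move=> p7; have [k pk] : exists k, p = (8 * k + 7)%N by exists (p %/ 8)%N; lia.
have -> : ((p - 7) %/ 8 = k)%N by lia.
have -> : ((p + 1) %/ 4 = k.+1.*2)%N by lia.
have -> : ((p + 1) %/ 8 = k.+1)%N by lia.
have Cu : zpu p 'C(k.+1.*2, k.+1)%:R by apply: bin_zpu; lia.
have pR : p%:R = 8 * k%:R + 7 :> rat by rewrite pk natrD natrM.
have c_zp : 5 / 8 \in zp p by rewrite rpredM ?zp_nat ?(zpu_inv_zp (zpu8 p_pr p_gt3)).
have nE : 3 / 8 + (5 * k + 4)%:R = p%:R * (5 / 8) :> rat by rewrite pR natrD natrM; field.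
have wE : cong p 1 ((-1) ^+ (4 * k + 3).+1 * 4 ^+ k.+1.*2) 2.
  have pN : p = (4 * k + 3).*2.+1 by lia.
  have := pow2_half p_pr pN; rewrite (@signr_parity _ 0%N); last by lia.
  have -> : (-1) ^+ (4 * k + 3).+1 = 1 :> rat by rewrite (@signr_parity _ 0%N) ?expr0; last by lia.
  rewrite expr0 mul1r => h; have -> : 4 ^+ k.+1.*2 = 2 ^+ (4 * k + 3) * 2 :> rat.
    rewrite (_ : 4 = 2 ^+ 2 :> rat); last by ring.
    by rewrite -exprM -exprSr; congr (_ ^+ _); lia.
  by have := congMr (zp_nat p 2) h; rewrite mul1r.
apply: cong_pcongr => //; last first.
  apply: zpM; first by apply/zpX/zpN; exact: rpred1.
  by apply: zpM; [apply: zpM; [|apply: zpX]; exact: zp_nat | exact: zpu_inv_zp].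
have np : (5 * k + 4 < p)%N by lia.
have jE : (2 * k + 1 + p)%N = (5 * k + 4).*2 by lia.
have pN : p = (4 * k + 3).*2.+1 by lia.
have nN : (5 * k + 4)%N = (4 * k + 3 + k.+1)%N by lia.
have := binom_sum_double_zero_value p_pr p_gt3 np c_zp nE jE pN nN wE (erefl _) (zp_nat _ 2).
congr cong; rewrite (@signr_parity _ k); last by lia.
by congr (_ * _); field; rewrite (zpu_neq0 Cu).
Qed.
End FiveSeven.

(** * Expansions modulo p^3 *)

Section SimpleZero.
Variables (p : nat) (p_pr : prime p) (p_gt3 : (3 < p)%N).
Variables (n : nat) (c : rat).
Hypotheses (np : (n < p)%N) (cz : c \in zp p) (nE : 3 / 8 + n%:R = p%:R * c).

Lemma poch_a_zpu : zpu p (poch (3 / 8) n).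
Proof.
apply: (cong_unit p_pr (poch_residue p_pr cz nE)).
by rewrite zpuM ?fact_zpu // zpuX // zpuN // zpu1.
Qed.

(** Modulo p^3 the norm product can be traded for (3/8)_n^3 / (3/4 + n)_n. This completes (3/4)_n to
    (3/4)_(2n), which the duplication formula splits into (3/8)_n and (7/8)_n. *)
Lemma binom_sum_simple_zero : cong p 4 (binom_sum p)
  (p%:R * (8 * c * ((-4) ^+ n * poch (7 / 8) n / poch (3 / 8) n))).
Proof.
have aU := poch_a_zpu; have nU := norm_prod_zpu p_pr np cz.
have pcz' := pcz cz.
apply: (cong_trans (binom_sum_closed p_pr p_gt3 np cz nE)).
rewrite pochS nE.
have -> : 8 * (poch (3 / 8) n * (p%:R * c) * ((-1) ^+ n * poch (3 / 4) n) / norm_prod (- (p%:R * c)) n) =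
  p%:R * (8 * c * (poch (3 / 8) n * ((-1) ^+ n * poch (3 / 4) n) / norm_prod (- (p%:R * c)) n)).
  by field; rewrite (zpu_neq0 nU).
apply: (cong_p p_pr); apply: congMl; first by rewrite rpredM ?zp_nat.
(* Factor by factor with x = n - j and e = p c: (e - x)^3 = (2e - x) (x^2 - e x + e^2) - e^3, and
   e^3 vanishes modulo p^3. *)
have key : cong p 3 (poch (3 / 8) n ^+ 3) (poch (3 / 4 + n%:R) n * norm_prod (- (p%:R * c)) n).
  rewrite /norm_prod (reindex_inj rev_ord_inj) /= -big_split /= -prodrXl.
  have Ea (j : 'I_n) : 3 / 8 + j%:R = p%:R * c - ((n - j.+1)%:R + 1).
    by rewrite -nE natrB // -natr1; ring.
  have Eb (j : 'I_n) : 3 / 4 + n%:R + j%:R = 2 * (p%:R * c) - ((n - j.+1)%:R + 1).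
    by rewrite -nE natrB // -natr1; field.
  have pcz1 : p%:R * c \in zp p by rewrite rpredM ?zp_nat.
  apply: (cong_prod p_pr) => j _.
  - by rewrite Ea rpredX // rpredB // rpredD ?zp_nat ?rpred1.
  - by rewrite Eb rpredM ?(rpredB, rpredD, rpredM, rpredX, zp_nat, rpred1).
  rewrite Ea Eb; apply/congP => //; exists (- c ^+ 3); first by rewrite rpredN rpredX.
  by move: ((n - j.+1)%:R + 1) => x; ring.
have -> : (-4) ^+ n * poch (7 / 8) n / poch (3 / 8) n =
    (-1) ^+ n * (poch (3 / 4) (2 * n)) / poch (3 / 8) n ^+ 2.
  rewrite (_ : 3 / 4 = 2 * (3 / 8)); last by field.
  rewrite poch_double (_ : 3 / 8 + 1 / 2 = 7 / 8); last by field.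
  rewrite -mulN1r exprMn; field; exact: (zpu_neq0 aU).
rewrite mul2n -addnn pochD; apply: (congMIl (u := poch (3 / 8) n ^+ 2 * norm_prod (- (p%:R * c)) n)).
  by rewrite zpuM ?zpuX.
have sz : (-1) ^+ n * poch (3 / 4) n \in zp p.
  rewrite rpredM ?rpredX ?rpredN ?rpred1 // poch_zp //.
  by rewrite rpredM ?zp_nat ?(zpu_inv_zp (zpu4 p_pr p_gt3)).
have := congMl sz key; congr cong.
  by field; exact: (zpu_neq0 nU).
by field; exact: (zpu_neq0 aU).
Qed.
End SimpleZero.

(* Second order expansion in p: x = a + p b + p ^ 2 c modulo p ^ 3. *)
Definition jet p (x a b c : rat) :=
  [/\ a \in zp p, b \in zp p, c \in zp p & cong p 3 x (a + p%:R * b + p%:R ^+ 2 * c)].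

Section Jets.
Variables (p : nat) (p_pr : prime p).

Lemma jet_zp x a b c : jet p x a b c -> x \in zp p.
Proof.
by case=> az bz cz h; apply: (cong_zp p_pr h); rewrite !(rpredD, rpredM, rpredX, zp_nat).
Qed.
Lemma jet_base x a b c : jet p x a b c -> cong p 1 x a.
Proof.
case=> az bz cz h; apply: (cong_trans (cong_le p_pr _ h)) => //.
apply/(congP p_pr); exists (b + p%:R * c); last by ring.
by rewrite !(rpredD, rpredM, rpredX, zp_nat).
Qed.
Lemma jetD x a b c y d e f : jet p x a b c -> jet p y d e f ->
  jet p (x + y) (a + d) (b + e) (c + f).
Proof.
case=> az bz cz h [dz ez fz k]; split; rewrite ?rpredD //.
have := congD h k; congr cong; ring.
Qed.
Lemma jetM x a b c y d e f : jet p x a b c -> jet p y d e f ->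
  jet p (x * y) (a * d) (a * e + b * d) (a * f + b * e + c * d).
Proof.
move=> hx hy; have yz := jet_zp hy.
case: hx hy => az bz cz h [dz ez fz k]; split; rewrite ?(rpredD, rpredM) //.
apply: (cong_trans (congM p_pr yz _ h k)).
  by rewrite !(rpredD, rpredM, rpredX, zp_nat).
apply/(congP p_pr); exists (b * f + c * e + p%:R * c * f); last by ring.
by rewrite !(rpredD, rpredM, rpredX, zp_nat).
Qed.
Lemma jet_const a : a \in zp p -> jet p a a 0 0.
Proof. by move=> az; split; rewrite ?rpred0 // !mulr0 !addr0; apply: cong_refl. Qed.
Lemma jet_lin a b : a \in zp p -> b \in zp p -> jet p (a + p%:R * b) a b 0.
Proof. by move=> az bz; split; rewrite ?rpred0 // mulr0 addr0; apply: cong_refl. Qed.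
Lemma jetV x a b c : zpu p a -> jet p x a b c ->
  jet p x^-1 a^-1 (- b / a ^+ 2) ((b ^+ 2 - a * c) / a ^+ 3).
Proof.
move=> au hx; have xz := jet_zp hx; have x1 := jet_base hx.
have xu : zpu p x := cong_unit p_pr x1 au.
case: hx => az bz cz h; have aVz := zpu_inv_zp au.
have e1 : - b / a ^+ 2 \in zp p by rewrite -exprVn !(rpredM, rpredN, rpredX).
have e2 : (b ^+ 2 - a * c) / a ^+ 3 \in zp p.
  by rewrite -exprVn rpredM ?rpredX // rpredB ?rpredM ?rpredX.
split => //; apply: (congMIl xu); rewrite divff ?(zpu_neq0 xu) //.
set y := (X in cong p 3 1 (x * X)).
have yz : y \in zp p.
  by apply: rpredD; [apply: rpredD => // |]; apply: rpredM; rewrite ?rpredX ?zp_nat.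
apply: (cong_trans _ (cong_sym (congMr yz h))).
apply/(congP p_pr); exists (- (b * ((b ^+ 2 - a * c) / a ^+ 3) + c * (- b / a ^+ 2)
   + p%:R * c * ((b ^+ 2 - a * c) / a ^+ 3))).
  rewrite rpredN; apply: rpredD; first by apply: rpredD; apply: rpredM.
  by apply: rpredM => //; rewrite rpredM ?zp_nat.
by rewrite /y; field; exact: (zpu_neq0 au).
Qed.
Lemma jet_cong x y a b c a' b' c' : jet p x a b c -> jet p y a' b' c' ->
  a = a' -> b = b' -> c = c' -> cong p 3 x y.
Proof. by move=> [_ _ _ h] [_ _ _ k] ???; subst; apply: cong_trans h (cong_sym k). Qed.
Lemma jet_eq x a b c a' b' c' : jet p x a b c -> a = a' -> b = b' -> c = c' -> jet p x a' b' c'.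
Proof. by move=> h <- <- <-. Qed.
Lemma jet_trans x y a b c : cong p 3 y x -> jet p x a b c -> jet p y a b c.
Proof. by move=> xy [az bz cz h]; split => //; apply: cong_trans h. Qed.

Definition harm (N : nat) : rat := \sum_(j < N) (j%:R + 1)^-1.
Definition harm2 (N : nat) : rat := \sum_(j < N) ((j%:R + 1)^-1) ^+ 2.
(** The product of 1 + p t / j over 1 <= j <= N: the unit by which a Pochhammer symbol starting near
    1 deviates p-adically from a factorial. *)
Definition eps (N : nat) (t : rat) : rat := poch (1 + p%:R * t) N / N`!%:R.

Lemma inv_zp (j : nat) : (j.+1 < p)%N -> (j%:R + 1)^-1 \in zp p.
Proof. by move=> jp; rewrite natr1 zpu_inv_zp // zpu_small. Qed.
Lemma harm_zp N : (N < p)%N -> harm N \in zp p.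
Proof.
by move=> Np; apply: rpred_sum => j _; apply: inv_zp; apply: leq_ltn_trans Np.
Qed.
Hypothesis p_gt2 : (2 < p)%N.

(** The coefficients are the first two elementary symmetric functions of the 1/j, the second one
    written through power sums. *)
Lemma jet_eps N t : (N < p)%N -> t \in zp p ->
  jet p (eps N t) 1 (t * harm N) (t ^+ 2 * ((harm N ^+ 2 - harm2 N) / 2)).
Proof.
move=> Np tz; have two_inv : 2^-1 \in zp p by rewrite zpu_inv_zp // zpu_small.
elim: N Np => [|N IH] Np.
  rewrite /eps poch0 fact0 divr1 /harm /harm2 !big_ord0.
  by apply: (jet_eq (jet_const (rpred1 _))) => //; ring.
have {}IH := IH (ltnW Np); have iz := inv_zp Np.
have -> : eps N.+1 t = eps N t * (1 + p%:R * (t * (N%:R + 1)^-1)).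
  have f0 : N`!%:R != 0 :> rat by rewrite pnatr_eq0 -lt0n fact_gt0.
  have n0 : N%:R + 1 != 0 :> rat by rewrite natr1 pnatr_eq0.
  by rewrite /eps pochS factS natrM -(natr1 N); field; rewrite ?f0 ?n0.
have tiz : t * (N%:R + 1)^-1 \in zp p by rewrite rpredM.
apply: (jet_eq (jetM IH (jet_lin (rpred1 _) tiz))).
- by rewrite mulr1.
- by rewrite /harm big_ord_recr /=; ring.
- by rewrite /harm /harm2 !big_ord_recr /=; field; rewrite natr1 pnatr_eq0.
Qed.
End Jets.

(** * Harmonic sums over half a residue system, Wolstenholme's theorem *)

Section HalfSystem.
Variables (p : nat) (p_pr : prime p) (p_gt3 : (3 < p)%N).
Variables (N : nat) (pN : p = N.*2.+1).
Let p_gt2 : (2 < p)%N := ltnW p_gt3.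

Let g (i : nat) : rat := ((i%:R + 1)^-1) ^+ 2.

Let sqV_cong x y : zpu p x -> zpu p y -> cong p 1 x (- y) -> cong p 1 (x^-1 ^+ 2) (y^-1 ^+ 2).
Proof.
move=> xu yu xy; have -> : y^-1 ^+ 2 = (- y)^-1 ^+ 2 by rewrite invrN sqrrN.
apply: (congX p_pr); rewrite ?zpu_inv_zp ?zpuN //.
by apply: (congV p_pr) => //; apply: zpuN.
Qed.

Let neg_cong x y : x + y = p%:R -> cong p 1 x (- y).
Proof. by move=> xy; rewrite /cong opprK xy expr1 divff ?rpred1 // p_neq0. Qed.

Lemma harm2_double : cong p 1 (harm2 (N + N)) (2 * harm2 N).
Proof.
have -> : 2 * harm2 N = harm2 N + harm2 N by ring.
rewrite {1}/harm2 big_split_ord /=; apply: congD; first exact: cong_refl.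
rewrite (reindex_inj rev_ord_inj) /=; apply: cong_sum => i _.
have := ltn_ord i => iN.
apply: sqV_cong; [by rewrite natr1 zpu_small //; lia | by rewrite natr1 zpu_small //; lia|].
apply: neg_cong; rewrite !natr1 -natrD; congr _%:R; lia.
Qed.

(** The sum of 1/j^2 over 1 <= j < p is evaluated twice. Pairing j with p - j gives 2 H, where H is
    the sum up to N. Splitting by parity and replacing each odd j by the even p - j gives 4 times
    the full sum as 2 H. Hence 6 H = 0 modulo p, and p > 3. *)
Lemma harm2_half : cong p 1 (harm2 N) 0.
Proof.
have zu (i : nat) : (i.+1 < p)%N -> zpu p (i%:R + 1) by move=> ip; rewrite natr1 zpu_small.
have z2 := zpu2 p_pr p_gt3.
have E m : harm2 (m + m) = \sum_(j < m) g j.*2 + \sum_(j < m) g j.*2.+1.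
  elim: m => [|m IH]; first by rewrite /harm2 !big_ord0 addr0.
  rewrite addSn addnS /harm2 !big_ord_recr /= -/(harm2 _) IH addnn.
  by rewrite /g; ring.
have h1 : cong p 1 (4 * harm2 (N + N)) (2 * harm2 N).
  have -> : 2 * harm2 N = harm2 N + harm2 N by ring.
  rewrite E mulrDr !mulr_sumr; apply: congD; last first.
    apply: cong_eq; apply: eq_bigr => j _.
    rewrite /g -(natr1 j.*2) -addnn natrD (_ : j%:R + j%:R + 1 + 1 = 2 * (j%:R + 1)); last by ring.
    by field; rewrite natr1 pnatr_eq0.
  rewrite (reindex_inj rev_ord_inj) /=; apply: cong_sum => i _.
  have := ltn_ord i => iN.
  have -> : (i%:R + 1)^-1 ^+ 2 = 4 * (2 * (i%:R + 1))^-1 ^+ 2 :> rat.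
    by field; rewrite natr1 pnatr_eq0.
  apply: congMl; first by rewrite zp_nat.
  apply: sqV_cong; first by apply: zu; lia.
    by apply: (zpuM z2); apply: zu; lia.
  apply: neg_cong; rewrite !natr1 -natrM -natrD; congr _%:R; lia.
have h2 := congMl (zp_nat p 4) harm2_double.
have u6 : zpu p 6.
  have -> : 6 = 2 * 3%:R :> rat by ring.
  by apply: zpuM => //; apply: zpu_small => //; lia.
apply: (congMIl u6); rewrite mulr0.
apply: (cong_congr (congB (cong_sym h2) (cong_sym h1))); last by rewrite subrr.
by move: (harm2 N) => u; ring.
Qed.

Lemma harm2_full : cong p 1 (harm2 p.-1) 0.
Proof.
have -> : p.-1 = (N + N)%N by lia.
apply: (cong_trans harm2_double); rewrite -[X in cong _ _ _ X](mulr0 2).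
by apply: congMl; rewrite ?zp_nat //; exact: harm2_half.
Qed.

(** As [harm2 N] vanishes modulo p, the expansion is that of exp(p t h), h = [harm N]. So modulo p^3
    [eps p N] turns sums in t into products, which is [eps_add]. *)
Lemma jet_eps_half t : t \in zp p ->
  jet p (eps p N t) 1 (t * harm N) (t ^+ 2 * harm N ^+ 2 / 2).
Proof.
move=> tz; have Np : (N < p)%N by lia.
have [az bz cz h] := jet_eps p_pr p_gt2 Np tz.
have z2 := zpu_inv_zp (zpu2 p_pr p_gt3).
split => //; first by rewrite !rpredM ?rpredX ?harm_zp.
have /(congP p_pr) [d dz dE] := harm2_half.
apply: (cong_trans h); apply/(congP p_pr); exists (- (t ^+ 2 * d / 2)).
  by rewrite rpredN !rpredM ?rpredX.
by move: dE; rewrite subr0 expr1 => ->; field.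
Qed.

(** The product of 1 - p/j over 1 <= j < p is exactly 1 since p - 1 is even. Its expansion expresses
    the harmonic sum as p times the second symmetric function up to p^2; the latter is divisible by
    p by [harm2_full], and both terms then disappear from the expansion at t = 1. *)
Lemma wolstenholme : cong p 3 (eps p p.-1 1) 1.
Proof.
have pp : (p.-1 < p)%N by lia.
have hz := harm_zp p_pr pp; have z2 := zpu_inv_zp (zpu2 p_pr p_gt3).
have j1 := jet_eps p_pr p_gt2 pp (rpred1 (zp p)).
have jm := jet_eps p_pr p_gt2 pp (rpredNr (rpred1 (zp p)) : -1 \in zp p).
have Em : eps p p.-1 (-1) = 1.
  rewrite /eps poch_rev -poch_fact.
  have -> : (-1) ^+ p.-1 = 1 :> rat.
    by rewrite (@signr_parity _ 0%N) ?expr0 //; have := p_odd p_pr p_gt3; lia.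
  have -> : 1 - (1 + p%:R * -1) - p.-1%:R = 1 :> rat.
    have : p%:R = p.-1%:R + 1 :> rat by rewrite natr1 prednK ?prime_gt0.
    by move=> ->; ring.
  rewrite mul1r divff // poch_fact pnatr_eq0 -lt0n fact_gt0 //.
move: jm; rewrite Em => -[_ bz cz /(congP p_pr) [d dz dE]].
have /(congP p_pr) [e ez eE] := harm2_full; rewrite subr0 expr1 in eE.
set h := harm _ in hz j1 bz cz dE; set h2 := harm2 _ in j1 cz dE eE.
have hE : h = p%:R * ((h ^+ 2 - h2) / 2 + p%:R * d).
  apply: (mulfI (p_neq0 p_pr)); move: dE.
  by rewrite !exprS expr0 => dE; lra.
pose k := (h ^+ 2 - h2) / 2 + p%:R * d.
have kz : k \in zp p.
  rewrite /k eE; apply: rpredD; last by rewrite rpredM ?zp_nat.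
  by rewrite rpredM // rpredB ?rpredX // rpredM ?zp_nat.
have kE : k = p%:R * ((p%:R * k ^+ 2 - e) / 2 + d).
  by rewrite {1}/k eE hE -/k; field.
case: j1 => _ _ _ /(congP p_pr) [f fz fE].
apply/(congP p_pr); exists (f + ((p%:R * k ^+ 2 - e) / 2 + d) + (p%:R * k ^+ 2 - e) / 2).
  have w : (p%:R * k ^+ 2 - e) / 2 \in zp p.
    by rewrite rpredM // rpredB ?rpredM ?rpredX ?zp_nat.
  by rewrite !rpredD.
move: fE => /eqP; rewrite subr_eq => /eqP->.
rewrite hE -/k eE; rewrite [p%:R * (1 * (p%:R * k))](_ : _ = p%:R ^+ 2 * k); last by ring.
by rewrite [in X in p%:R ^+ 2 * X]kE; field.
Qed.

Lemma bin2p_cong : cong p 3 'C(p.*2, p)%:R 2.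
Proof.
have -> : 'C(p.*2, p)%:R = 2 * eps p p.-1 1.
  have p0 := prime_gt0 p_pr.
  have f0 m : m`!%:R != 0 :> rat by rewrite pnatr_eq0 -lt0n fact_gt0.
  have pe : p.*2 = (p + p.-1).+1 by lia.
  have fp : p`!%:R = p%:R * p.-1`!%:R :> rat by rewrite -{1}(prednK p0) factS prednK // natrM.
  have F : p.*2`!%:R = p.*2%:R * (p`!%:R * poch (1 + p%:R * 1) p.-1) :> rat.
    by rewrite mulr1 -(poch_fact p) -pochD poch_fact pe factS natrM.
  apply: (mulIf (mulf_neq0 (f0 p) (f0 p))).
  have := @bin_fact p.*2 p; rewrite -{3}addnn addnK => /(_ ltac:(lia)) BF.
  have -> : 'C(p.*2, p)%:R * (p`!%:R * p`!%:R) = p.*2`!%:R :> rat by rewrite -!natrM BF.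
  by rewrite F /eps fp -addnn natrD; field; exact: f0.
rewrite -[X in cong _ _ _ X]mulr1; apply: congMl; [by rewrite zp_nat | exact: wolstenholme].
Qed.
End HalfSystem.

(** * Factorials and Pochhammer symbols in terms of [eps] *)

Section Eps.
Variables (p : nat) (p_pr : prime p) (p_gt3 : (3 < p)%N).
Let p_gt2 : (2 < p)%N := ltnW p_gt3.

Lemma eps_zpu X t : (X < p)%N -> t \in zp p -> zpu p (eps p X t).
Proof.
move=> Xp tz; have h := jet_base p_pr (jet_eps p_pr p_gt2 Xp tz).
exact: (cong_unit p_pr h (zpu1 p)).
Qed.

Lemma fact_neq0 m : m`!%:R != 0 :> rat.
Proof. by rewrite pnatr_eq0 -lt0n fact_gt0. Qed.

Lemma poch_eps X t : poch (1 + p%:R * t) X = X`!%:R * eps p X t.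
Proof. by rewrite /eps [RHS]mulrC divfK ?fact_neq0. Qed.

(** Used with b = 1, 2: the extrapolation produces binomial coefficients with upper index 3N = p + N
    - 1 and 5N = 2p + N - 2, whence the shifted versions below. *)
Lemma fact_eps b X : (b * p + X)`!%:R = (b * p)`!%:R * (X`!%:R * eps p X b%:R).
Proof. by rewrite -poch_eps -!poch_fact pochD natrM [_ * p%:R]mulrC. Qed.

Lemma bin_rat m k : (k <= m)%N -> 'C(m, k)%:R = m`!%:R / (k`!%:R * (m - k)`!%:R) :> rat.
Proof.
by move=> km; rewrite -natrM -(bin_fact km) natrM mulfK // natrM mulf_neq0 ?fact_neq0.
Qed.

Lemma fact_eps1 X : (p + X).-1`!%:R = p`!%:R * (X`!%:R * eps p X 1) / (X%:R + p%:R).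
Proof.
have h := fact_eps 1 X; rewrite mul1n in h.
have pos : (p + X = (p + X).-1.+1)%N by have := prime_gt0 p_pr; lia.
rewrite -h {2}pos factS -pos natrM -natrD [(X + p)%N]addnC mulrC mulKf //.
by rewrite pnatr_eq0; have := prime_gt0 p_pr; lia.
Qed.

Lemma fact_eps2 X : (2 * p + X).-2`!%:R =
  (2 * p)`!%:R * (X`!%:R * eps p X 2) / ((X%:R + 2 * p%:R) * (X%:R + 2 * p%:R - 1)).
Proof.
have h := fact_eps 2 X.
have pos : ((2 * p + X) = (2 * p + X).-2.+2)%N by have := prime_gt1 p_pr; lia.
have E1 : (X%:R + 2 * p%:R = (2 * p + X).-2.+2%:R :> rat).
  by rewrite -pos -natrM -natrD addnC.
rewrite -h {2}pos !factS !natrM E1; move: (2 * p + X).-2 => m.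
have -> : m.+2%:R - 1 = m.+1%:R :> rat by rewrite -(natr1 m.+1) addrK.
have m1 : m.+1%:R != 0 :> rat by rewrite pnatr_eq0.
have m2 : m.+2%:R != 0 :> rat by rewrite pnatr_eq0.
move: m1 m2; move: m.+1%:R m.+2%:R => x y x0 y0.
by field; rewrite x0 y0.
Qed.

Section Half.
Variables (N K L : nat) (pN : p = N.*2.+1) (NKL : N = (K + L)%N).
Variables (kap lam : rat).
Hypotheses (kE : p%:R * kap = 1 / 8 + K%:R) (lE : p%:R * lam = 3 / 8 + L%:R).
Hypotheses (kz : kap \in zp p) (lz : lam \in zp p).

(** [Tval] is T of the overview, and [Wval] below is the unit of [binom_sum_simple_zero] for n = L
    up to the sign (-1)^L. The parameters [kap], [lam] are 1/8, 3/8 if p = 1 mod 8 and 3/8, 1/8 if p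
    = 3 mod 8. *)
Definition Tval : rat := poch (1 / 2) N / (poch (1 / 8) K * poch (3 / 8) L).
Definition Wval : rat := 4 ^+ L * poch (7 / 8) L / poch (3 / 8) L.

Let NR : N%:R = (p%:R - 1) / 2 :> rat.
Proof. by rewrite pN -natr1 -mul2n natrM; field. Qed.
Let Np : (N < p)%N. Proof. by lia. Qed.
Let Kp : (K < p)%N. Proof. by lia. Qed.
Let Lp : (L < p)%N. Proof. by lia. Qed.
Let kNz : - kap \in zp p. Proof. by rewrite rpredN. Qed.
Let lNz : - lam \in zp p. Proof. by rewrite rpredN. Qed.
Let hz : - (1 / 2) \in zp p. Proof. by rewrite rpredN mul1r zpu_inv_zp ?zpu2. Qed.

Lemma poch_half : poch (1 / 2) N = (-1) ^+ N * (N`!%:R * eps p N (- (1 / 2))).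
Proof.
by rewrite poch_rev -poch_eps; congr (_ * poch _ _); rewrite NR; field.
Qed.
Lemma poch_8 : poch (1 / 8) K = (-1) ^+ K * (K`!%:R * eps p K (- kap)).
Proof.
by rewrite poch_rev -poch_eps mulrN kE; congr (_ * poch _ _); field.
Qed.
Lemma poch_38 : poch (3 / 8) L = (-1) ^+ L * (L`!%:R * eps p L (- lam)).
Proof.
by rewrite poch_rev -poch_eps mulrN lE; congr (_ * poch _ _); field.
Qed.

Lemma Tval_eps :
  Tval = 'C(N, K)%:R * (eps p N (- (1 / 2)) / (eps p K (- kap) * eps p L (- lam))).
Proof.
rewrite bin_rat ?NKL ?leq_addr // addKn -NKL /Tval poch_half poch_8 poch_38.
rewrite {1}NKL exprD.
have s0 m : (-1) ^+ m != 0 :> rat by rewrite expf_neq0 // oppr_eq0 oner_eq0.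
have e1 := zpu_neq0 (eps_zpu Kp kNz); have e2 := zpu_neq0 (eps_zpu Lp lNz).
by field; rewrite !fact_neq0 !s0 e1 e2.
Qed.

(** Exact: 1 - p kap + K = 7/8, so (1 - p kap)_N splits as (1 - p kap)_K (7/8)_L, and its first
    factor is (1/8)_K reversed. *)
Lemma Tval_Wval : Tval * 4 ^+ L * eps p N (- kap) = (-1) ^+ (K + N) * eps p N (- (1 / 2)) * Wval.
Proof.
have E : N`!%:R * eps p N (- kap) = poch (1 + p%:R * - kap) K * poch (7 / 8) L.
  by rewrite -poch_eps {1}NKL pochD mulrN kE; congr (_ * poch _ _); field.
rewrite poch_eps in E.
have p38 : poch (3 / 8) L != 0.
  rewrite poch_38; apply: mulf_neq0; first by rewrite expf_neq0 // oppr_eq0 oner_eq0.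
  by apply: mulf_neq0; [exact: fact_neq0 | exact: zpu_neq0 (eps_zpu Lp lNz)].
rewrite /Tval /Wval poch_half poch_8 exprD.
have -> : eps p N (- kap) = K`!%:R * eps p K (- kap) * poch (7 / 8) L / N`!%:R.
  by rewrite -E mulrC mulKf // fact_neq0.
have ss : (-1) ^+ K * (-1) ^+ K = 1 :> rat by rewrite -exprMn mulrNN mulr1 expr1n.
have s0 : (-1) ^+ K != 0 :> rat by rewrite expf_neq0 // oppr_eq0 oner_eq0.
have e1 := zpu_neq0 (eps_zpu Kp kNz).
apply: (mulfI s0); rewrite [RHS]mulrA [X in _ = X * _]mulrA [X in _ = X * _ * _]mulrA ss.
by field; rewrite !fact_neq0 s0 p38 e1.
Qed.

(** This is (2N)! = 4^N N! (1/2)_N with 2N = p - 1, the quotient (p - 1)! / N! being (1 - p)_N up to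
    sign. *)
Lemma pow4_eps : 4 ^+ N * eps p N (- (1 / 2)) = eps p N (-1).
Proof.
apply: (mulfI (fact_neq0 N)); rewrite -poch_eps mulrCA.
have -> : N`!%:R * eps p N (- (1 / 2)) = (-1) ^+ N * poch (1 / 2) N.
  by rewrite poch_half [RHS]mulrA -exprMn mulrNN mulr1 expr1n [RHS]mul1r.
rewrite [RHS]poch_rev mulrCA; congr (_ * _).
have -> : 1 - (1 + p%:R * -1) - N%:R = 1 + N%:R :> rat by rewrite NR; field.
apply: (mulfI (fact_neq0 N)); rewrite -[N`!%:R in RHS]poch_fact -pochD.
rewrite addnn -mul2n -[in RHS](_ : 2 * (1 / 2) = 1 :> rat); last by field.
rewrite poch_double (_ : 1 / 2 + 1 / 2 = 1 :> rat); last by field.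
rewrite poch_fact; ring.
Qed.

Lemma eps_add t u : t \in zp p -> u \in zp p ->
  cong p 3 (eps p N t * eps p N u) (eps p N (t + u)).
Proof.
move=> tz uz; apply: (jet_cong (jetM p_pr (jet_eps_half p_pr p_gt3 pN tz) (jet_eps_half p_pr p_gt3 pN uz))
  (jet_eps_half p_pr p_gt3 pN (rpredD tz uz))); [ring | ring | by field].
Qed.
Lemma eps_pow t m : t \in zp p -> cong p 3 (eps p N t ^+ m) (eps p N (m%:R * t)).
Proof.
move=> tz; elim: m => [|m IH].
  rewrite expr0 mul0r /eps mulr0 addr0 poch_fact divff ?fact_neq0 //; exact: cong_refl.
have mz : m%:R * t \in zp p by rewrite rpredM ?zp_nat.
rewrite exprS -natr1 mulrDl mul1r addrC.
apply: (cong_trans _ (eps_add tz mz)); apply: congMl => //.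
by rewrite zpu_zp // eps_zpu.
Qed.
End Half.
End Eps.

(** * The relation between T^2 and V^2 *)

Section Duplication.
Variables (p : nat) (p_pr : prime p) (p_gt3 : (3 < p)%N).
Let p_gt2 : (2 < p)%N := ltnW p_gt3.
Variables (N K L : nat) (pN : p = N.*2.+1) (NKL : N = (K + L)%N).
Variables (kap lam : rat).
Hypotheses (kE : p%:R * kap = 1 / 8 + K%:R) (lE : p%:R * lam = 3 / 8 + L%:R).
Hypotheses (kz : kap \in zp p) (lz : lam \in zp p).
Notation T := (Tval N K L).
Notation W := (Wval L).
Let Np : (N < p)%N. Proof. by lia. Qed.
Let Kp : (K < p)%N. Proof. by lia. Qed.
Let Lp : (L < p)%N. Proof. by lia. Qed.
Let kNz : - kap \in zp p. Proof. by rewrite rpredN. Qed.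
Let lNz : - lam \in zp p. Proof. by rewrite rpredN. Qed.
Let z2 : 2^-1 \in zp p. Proof. by rewrite zpu_inv_zp ?zpu2. Qed.
Let hz : - (1 / 2) \in zp p. Proof. by rewrite rpredN mul1r. Qed.
Let u4 m : zpu p (4 ^+ m). Proof. by rewrite zpuX // zpu4. Qed.
Let eu X t : (X < p)%N -> t \in zp p -> zpu p (eps p X t).
Proof. exact: eps_zpu. Qed.

Lemma Tval_zpu : zpu p T.
Proof.
rewrite (Tval_eps p_pr p_gt3 pN NKL kE lE kz lz); apply: zpuM.
  by apply: bin_zpu => //; lia.
by apply: zpuM; [apply: eu | apply: zpuV; apply: zpuM; apply: eu].
Qed.

Lemma sgn_zpu m : zpu p ((-1) ^+ m).
Proof. by rewrite zpuX // zpuN // zpu1. Qed.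

Lemma Wval_zpu : zpu p W.
Proof.
have h := Tval_Wval p_pr p_gt3 pN NKL kE lE kz lz.
have e1 := eu Np hz.
have -> : W = T * 4 ^+ L * eps p N (- kap) / ((-1) ^+ (K + N) * eps p N (- (1 / 2))).
  rewrite h [_ * W]mulrC mulfK // mulf_neq0 ?(zpu_neq0 (sgn_zpu _)) //.
  exact: zpu_neq0 e1.
have e2 := eu Np kNz; have tu := Tval_zpu; have s := sgn_zpu (K + N).
by apply: zpuM; [apply: zpuM => //; apply: zpuM | apply: zpuV; apply: zpuM].
Qed.

Lemma Tval_Wval_mod : cong p 1 (T * 4 ^+ L) ((-1) ^+ (K + N) * W).
Proof.
have h := Tval_Wval p_pr p_gt3 pN NKL kE lE kz lz.
have e1 := jet_base p_pr (jet_eps p_pr p_gt2 Np hz).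
have e2 := jet_base p_pr (jet_eps p_pr p_gt2 Np kNz).
have t4z : T * 4 ^+ L \in zp p by apply: zpu_zp; apply: zpuM; [exact: Tval_zpu | ].
have sWz : (-1) ^+ (K + N) * W \in zp p by apply: zpu_zp; apply: zpuM; [exact: sgn_zpu | exact: Wval_zpu].
have c1 := congMl t4z e2; rewrite mulr1 in c1.
have c2 := congMl sWz e1; rewrite mulr1 in c2.
apply: (cong_trans (cong_sym c1)); apply: (cong_trans _ c2); apply: cong_eq; rewrite h; ring.
Qed.

Let pow4 : 4 ^+ N * eps p N (- (1 / 2)) = eps p N (-1) := pow4_eps pN.
Let ez m t : t \in zp p -> eps p N t ^+ m \in zp p.
Proof. by move=> tz; rewrite rpredX // zpu_zp // eu. Qed.
Let oz : -1 \in zp p. Proof. by rewrite rpredN rpred1. Qed.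

(** The fourth power determines T^2 modulo p^3 up to sign, and the residue modulo p selects the
    sign. *)
Let sq_of_fourth (d : rat) : zpu p d -> cong p 3 (T ^+ 4) (d ^+ 2 * W ^+ 4) ->
  cong p 1 (T ^+ 2) (d * W ^+ 2) -> cong p 3 (T ^+ 2) (d * W ^+ 2).
Proof.
move=> du h4 h1; apply: (cong_sqr p_pr p_gt2) => //.
  by apply: zpuM => //; apply: zpuX; exact: Wval_zpu.
by move: h4; congr cong; ring.
Qed.

(* The logarithms of eps N (-1), eps N (-1/2), eps N (-kap) are proportional
   modulo p ^ 3, and 4 ^ N eps N (-1/2) = eps N (-1) expresses powers of 2. *)
Lemma Tval_sqr_1 : L = (3 * K)%N -> kap = 1 / 8 -> cong p 3 (T ^+ 2) (W ^+ 2).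
Proof.
move=> LK kapE.
have h := Tval_Wval p_pr p_gt3 pN NKL kE lE kz lz.
move: h Tval_zpu Wval_zpu Tval_Wval_mod sq_of_fourth; move: T W => t w h tu wu m sq.
have N4 : N = (4 * K)%N by clear -NKL LK; lia.
rewrite -[X in cong _ _ _ X]mul1r; apply: sq; first exact: zpu1; last first.
  have tz := zpu_zp tu.
  have t4z : t * 4 ^+ L \in zp p by apply: zpu_zp; apply: zpuM; [exact: tu | ].
  have sWz : (-1) ^+ (K + N) * w \in zp p by apply: zpu_zp; apply: zpuM; [exact: sgn_zpu | exact: wu].
  have := congX p_pr 2 t4z sWz m.
  rewrite !exprMn -!exprM [((K + N) * 2)%N]mulnC (exprM (-1)) sqrrN !expr1n ![1 * w ^+ 2]mul1r.
  apply: cong_trans; apply: cong_sym.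
  have P := pow2_half p_pr pN.
  have par : odd (N - N./2) = odd 0 by clear -N4; lia.
  rewrite (signr_parity par) expr0 in P.
  have P3 : cong p 1 (4 ^+ (L * 2)) 1.
    have -> : 4 ^+ (L * 2) = (2 ^+ N) ^+ 3 :> rat.
      have four : 4 = 2 ^+ 2 :> rat by ring.
      have e : (2 * (L * 2) = N * 3)%N by clear -N4 LK; lia.
      by rewrite four -exprM e exprM.
    rewrite -[X in cong _ _ _ X](expr1n _ 3).
    by apply: (congX p_pr); rewrite ?rpredX ?rpred1 ?zp_nat.
  rewrite -[X in cong _ _ _ X]mulr1; apply: congMl => //.
  by rewrite rpredX.
(* Since 4L = 3N, the fourth power contains (4^N)^3, which the extra cube turns into a cube of
   [eps p N (-1)]. The sums of the arguments then agree: -3 - 4/8 on the left and 7 times -1/2 on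
   the right. *)
have f := congr1 (fun x => x ^+ 4 * eps p N (- (1 / 2)) ^+ 3) h.
have U1 : zpu p (eps p N (-1) ^+ 3 * eps p N (- kap) ^+ 4).
  by apply: zpuM; apply: zpuX; apply: eu.
have E1 : (t * 4 ^+ L * eps p N (- kap)) ^+ 4 * eps p N (- (1 / 2)) ^+ 3 =
   (eps p N (-1) ^+ 3 * eps p N (- kap) ^+ 4) * t ^+ 4.
  rewrite -pow4 !exprMn -!exprM (_ : (L * 4 = N * 3)%N); last by clear -N4 LK; lia.
  ring.
have E2 : ((-1) ^+ (K + N) * eps p N (- (1 / 2)) * w) ^+ 4 * eps p N (- (1 / 2)) ^+ 3 =
   eps p N (- (1 / 2)) ^+ 7 * w ^+ 4.
  rewrite !exprMn -exprM (_ : ((K + N) * 4 = 2 * ((K + N) * 2))%N); last by clear; lia.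
  by rewrite exprM sqrrN !expr1n; ring.
have cc : cong p 3 (eps p N (-1) ^+ 3 * eps p N (- kap) ^+ 4) (eps p N (- (1 / 2)) ^+ 7).
  have c1 := eps_pow p_pr p_gt3 pN NKL kz lz 3 oz.
  have c2 := eps_pow p_pr p_gt3 pN NKL kz lz 4 kNz.
  have c3 := eps_pow p_pr p_gt3 pN NKL kz lz 7 hz.
  have z3 : 3%:R * -1 \in zp p by rewrite rpredM ?zp_nat.
  have z4 : 4%:R * - kap \in zp p by rewrite rpredM ?zp_nat.
  have c4 := eps_add p_pr p_gt3 pN z3 z4.
  have ez3 : eps p N (3%:R * -1) \in zp p by rewrite zpu_zp // eu.
  apply: (cong_trans (congM p_pr (ez 4 kNz) ez3 c1 c2)); apply: (cong_trans c4).
  apply: cong_sym; move: c3; congr cong; congr eps; rewrite kapE; by field.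
rewrite E1 E2 in f.
apply: (congMIl U1); rewrite f expr1n [1 * w ^+ 4]mul1r; apply: cong_sym.
by apply: congMr => //; rewrite rpredX // zpu_zp // wu.
Qed.

(** Now 4L = N - 1, so one more factor 4 is needed to reach 4^N, which yields T^4 = 4 W^4; the
    arguments agree as -1 - 12/8 = -5/2. The sign in -2 comes from 2^N = -1 modulo p. *)
Lemma Tval_sqr_3 : K = (3 * L).+1%N -> kap = 3 / 8 -> cong p 3 (T ^+ 2) (-2 * W ^+ 2).
Proof.
move=> LK kapE.
have h := Tval_Wval p_pr p_gt3 pN NKL kE lE kz lz.
move: h Tval_zpu Wval_zpu Tval_Wval_mod sq_of_fourth; move: T W => t w h tu wu m sq.
have N4 : N = (4 * L).+1%N by clear -NKL LK; lia.
apply: sq; first by apply: zpuN; apply: zpu2.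
  have f := congr1 (fun x => 4 * x ^+ 4 * eps p N (- (1 / 2))) h.
  have U1 : zpu p (eps p N (-1) * eps p N (- kap) ^+ 4).
    by apply: zpuM; [apply: eu | apply: zpuX; apply: eu].
  have E1 : 4 * (t * 4 ^+ L * eps p N (- kap)) ^+ 4 * eps p N (- (1 / 2)) =
     (eps p N (-1) * eps p N (- kap) ^+ 4) * t ^+ 4.
    have e : N = (L * 4).+1 by clear -N4; lia.
    have e4 : 4 ^+ N = 4 * 4 ^+ (L * 4) :> rat by rewrite -exprS -e.
    rewrite -pow4 !exprMn -!exprM e4; ring.
  have E2 : 4 * ((-1) ^+ (K + N) * eps p N (- (1 / 2)) * w) ^+ 4 * eps p N (- (1 / 2)) =
     eps p N (- (1 / 2)) ^+ 5 * (4 * w ^+ 4).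
    move: (eps p N (- (1 / 2))) => E; rewrite !exprMn -exprM (_ : ((K + N) * 4 = 2 * ((K + N) * 2))%N); last by clear; lia.
    rewrite exprM sqrrN !expr1n. ring.
  have cc : cong p 3 (eps p N (-1) * eps p N (- kap) ^+ 4) (eps p N (- (1 / 2)) ^+ 5).
    have c2 := eps_pow p_pr p_gt3 pN NKL kz lz 4 kNz.
    have c3 := eps_pow p_pr p_gt3 pN NKL kz lz 5 hz.
    have z4 : 4%:R * - kap \in zp p by rewrite rpredM ?zp_nat.
    have c4 := eps_add p_pr p_gt3 pN oz z4.
    have ez3 : eps p N (-1) \in zp p by rewrite zpu_zp // eu.
    apply: (cong_trans (congMl ez3 c2)); apply: (cong_trans c4).
    apply: cong_sym; move: c3; congr cong; congr eps; rewrite kapE; by field.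
  rewrite E1 E2 in f.
  apply: (congMIl U1); rewrite f; apply: cong_sym.
  have -> : (-2) ^+ 2 = 4 :> rat by ring.
  apply: congMr => //; rewrite rpredM ?zp_nat // rpredX // zpu_zp // wu //.
have t4z : t * 4 ^+ L \in zp p by apply: zpu_zp; apply: zpuM; [exact: tu | ].
have sWz : (-1) ^+ (K + N) * w \in zp p by apply: zpu_zp; apply: zpuM; [exact: sgn_zpu | exact: wu].
have := congX p_pr 2 t4z sWz m.
rewrite !exprMn -!exprM [((K + N) * 2)%N]mulnC (exprM (-1)) sqrrN !expr1n ![1 * w ^+ 2]mul1r => {}m.
have P := pow2_half p_pr pN.
have par : odd (N - N./2) = odd 1 by clear -N4; lia.
  rewrite (signr_parity par) expr1 in P.
have E4 : 2 * 4 ^+ (L * 2) = 2 ^+ N :> rat.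
  have four : 4 = 2 ^+ 2 :> rat by ring.
  have e : (2 * (L * 2)).+1 = N by clear -N4 LK; lia.
  by rewrite four -exprM -exprS e.
have c1 := congMl (zpu_zp (zpuX 2 tu)) P.
have c2 := congMl (zp_nat p 2) m.
have c3 : cong p 1 (t ^+ 2 * -1) (2 * w ^+ 2).
  apply: (cong_trans (cong_sym c1)); apply: (cong_trans _ c2); apply: cong_eq; rewrite -E4; ring.
have := congN c3; congr cong; ring.
Qed.
End Duplication.

(** * The extrapolated binomial sums modulo p^3 *)

Section Extrapolation.
Variables (p : nat) (p_pr : prime p) (p_gt3 : (3 < p)%N).
Let p_gt2 : (2 < p)%N := ltnW p_gt3.
Variables (N K L : nat) (pN : p = N.*2.+1) (NKL : N = (K + L)%N).
Let Np : (N < p)%N. Proof. by lia. Qed.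
Let Kp : (K < p)%N. Proof. by lia. Qed.
Let Lp : (L < p)%N. Proof. by lia. Qed.
Let one_zp : 1 \in zp p. Proof. by rewrite rpred1. Qed.
Let two_zp : 2 \in zp p. Proof. by rewrite zp_nat. Qed.
Let eps_neq0 X t : (X < p)%N -> t \in zp p -> eps p X t != 0.
Proof. by move=> Xp tz; exact: zpu_neq0 (eps_zpu p_pr p_gt3 Xp tz). Qed.
Let pR_gt1 : 1 < p%:R :> rat. Proof. by rewrite ltr1n prime_gt1. Qed.
Let Xp_neq0 (X b : nat) : (0 < b)%N -> X%:R + b%:R * p%:R != 0 :> rat.
Proof. by move=> b0; rewrite -natrM -natrD pnatr_eq0; clear -b0 p_gt3; lia. Qed.
Let Xp1_neq0 X : X%:R + 2 * p%:R - 1 != 0 :> rat.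
Proof.
by rewrite gt_eqF // subr_gt0 ltr_wpDl // (lt_trans pR_gt1) // ltr_pMl ?ltr1n // (lt_trans ltr01).
Qed.

Notation C0 := ('C(N, K)%:R : rat).

Lemma ext_C0 : C0 = N`!%:R / (K`!%:R * L`!%:R).
Proof.
by rewrite bin_rat ?NKL ?leq_addr // addKn -NKL.
Qed.

(** Every coefficient that occurs is compared with C(N, K), so that C(N, K) can be factored out and
    the cofactors expanded in p. [D] measures how k! l! deviates from p! K! L!. *)
Lemma ext_bin1 (k l : nat) (D : rat) : (k + l = 3 * N)%N ->
  k`!%:R * l`!%:R = p`!%:R * (K`!%:R * L`!%:R) * D -> D != 0 ->
  'C(3 * N, k)%:R = C0 * (eps p N 1 / (N%:R + p%:R)) / D.
Proof.
move=> kl E D0; rewrite bin_rat; last by clear -kl; lia.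
have -> : (3 * N - k = l)%N by clear -kl; lia.
have -> : (3 * N = (p + N).-1)%N by clear -pN; lia.
rewrite E fact_eps1 // ext_C0; move: (Xp_neq0 N (ltn0Sn 0)); rewrite mul1r => h.
by field; rewrite h D0 !fact_neq0.
Qed.

Lemma ext_bin2 (k l : nat) (D : rat) : (k + l = 5 * N)%N ->
  k`!%:R * l`!%:R = (2 * p)`!%:R * (K`!%:R * L`!%:R) * D -> D != 0 ->
  'C(5 * N, k)%:R = C0 * (eps p N 2 / ((N%:R + 2 * p%:R) * (N%:R + 2 * p%:R - 1))) / D.
Proof.
move=> kl E D0; rewrite bin_rat; last by clear -kl; lia.
have -> : (5 * N - k = l)%N by clear -kl; lia.
have -> : (5 * N = (2 * p + N).-2)%N by clear -pN; lia.
rewrite E fact_eps2 // ext_C0; have h1 := Xp_neq0 N (ltn0Sn 1); have h2 := Xp1_neq0 N.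
by field; rewrite h1 h2 D0 !fact_neq0.
Qed.

Let XpE (X : nat) : X%:R + p%:R != 0 :> rat.
Proof. by have := Xp_neq0 X (ltn0Sn 0); rewrite mul1r. Qed.
Let B1 := eps p N 1 / (N%:R + p%:R).
Let B2 := eps p N 2 / ((N%:R + 2 * p%:R) * (N%:R + 2 * p%:R - 1)).

Lemma ext_split1 (X Y : nat) : N = (X + Y)%N -> (X < p)%N -> (Y < p)%N ->
  K`!%:R * L`!%:R = X`!%:R * Y`!%:R :> rat ->
  'C(3 * N, X)%:R = C0 * B1 * ((Y%:R + p%:R) / eps p Y 1).
Proof.
move=> NXY Xp Yp XY; have e0 := eps_neq0 Yp one_zp; have h := XpE Y.
rewrite (@ext_bin1 X (p + Y).-1 (eps p Y 1 / (Y%:R + p%:R))).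
- by rewrite /B1; field; rewrite (XpE N) h e0.
- by clear -NXY pN p_gt3; lia.
- by rewrite fact_eps1 // XY; field; exact: h.
- by rewrite mulf_neq0 ?invr_eq0.
Qed.

Lemma ext_split2 (X Y : nat) : N = (X + Y)%N -> (X < p)%N -> (Y < p)%N ->
  K`!%:R * L`!%:R = X`!%:R * Y`!%:R :> rat ->
  'C(5 * N, X)%:R = C0 * B2 * ((Y%:R + 2 * p%:R) * (Y%:R + 2 * p%:R - 1) / eps p Y 2).
Proof.
move=> NXY Xp Yp XY; have e0 := eps_neq0 Yp two_zp.
have h := Xp_neq0 Y (ltn0Sn 1); have h1 := Xp1_neq0 Y.
have hN := Xp_neq0 N (ltn0Sn 1); have hN1 := Xp1_neq0 N.
rewrite (@ext_bin2 X (2 * p + Y).-2 (eps p Y 2 / ((Y%:R + 2 * p%:R) * (Y%:R + 2 * p%:R - 1)))).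
- by rewrite /B2; field; rewrite hN hN1 h h1 e0.
- by clear -NXY pN p_gt3; lia.
- by rewrite fact_eps2 // XY; field; rewrite h h1.
- by apply: mulf_neq0 => //; rewrite invr_eq0; apply: mulf_neq0.
Qed.

(** Both lower indices K + 2N = p + K - 1 and 3N - K = p + L - 1 lie one period up, which leaves
    (2p)! / p!^2. *)
Lemma ext_middle : 'C(5 * N, K + 2 * N)%:R =
  C0 * B2 * ('C(p.*2, p)%:R * (K%:R + p%:R) * (L%:R + p%:R) / (eps p K 1 * eps p L 1)).
Proof.
have e0 := eps_neq0 Kp one_zp; have e1 := eps_neq0 Lp one_zp.
have hN := Xp_neq0 N (ltn0Sn 1); have hN1 := Xp1_neq0 N.
have hK := XpE K; have hL := XpE L.
have CE : 'C(p.*2, p)%:R = (2 * p)`!%:R / (p`!%:R * p`!%:R) :> rat.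
  rewrite bin_rat; last by clear; lia.
  by rewrite -addnn addnK mul2n -addnn.
have D0 : p`!%:R ^+ 2 / (2 * p)`!%:R * (eps p K 1 * eps p L 1) / ((K%:R + p%:R) * (L%:R + p%:R)) != 0.
  apply: mulf_neq0; last by rewrite invr_eq0; apply: mulf_neq0.
  apply: mulf_neq0; last by apply: mulf_neq0.
  by apply: mulf_neq0; rewrite ?invr_eq0 ?expf_neq0 // fact_neq0.
rewrite (ext_bin2 (k := K + 2 * N) (l := (p + L).-1) _ _ D0).
- by rewrite CE /B2; field; rewrite hN hN1 hK hL e0 e1 !fact_neq0.
- by clear -NKL pN p_gt3; lia.
- have -> : (K + 2 * N = (p + K).-1)%N by clear -pN p_gt3; lia.
  by rewrite !fact_eps1 //; field; rewrite hK hL fact_neq0.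
Qed.

Lemma fact_pred X : (0 < X)%N -> X.-1`!%:R = X`!%:R / X%:R :> rat.
Proof. by case: X => // X _; rewrite factS natrM mulrC mulKf // pnatr_eq0. Qed.

Lemma ext_inert1 (k X Y : nat) : (0 < X)%N -> (Y < p)%N ->
  K`!%:R * L`!%:R = X`!%:R * Y`!%:R :> rat ->
  (k = X.-1 /\ N = (X + Y)%N) \/ (k = (p + Y)%N /\ N = (X + Y)%N) ->
  'C(3 * N, k)%:R = C0 * B1 * (X%:R / eps p Y 1).
Proof.
move=> X0 Yp XY kE; have e0 := eps_neq0 Yp one_zp.
have x0 : X%:R != 0 :> rat by rewrite pnatr_eq0 -lt0n.
have pY := fact_eps p 1 Y; rewrite mul1n in pY.
have D0 : eps p Y 1 / X%:R != 0 by rewrite mulf_neq0 ?invr_eq0.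
case: kE => [[-> NXY] | [-> NXY]].
  rewrite (ext_bin1 (l := p + Y) _ _ D0).
  - by rewrite /B1; field; rewrite (XpE N) x0 e0.
  - by clear -NXY pN X0; lia.
  - by rewrite XY pY fact_pred //; field.
rewrite (ext_bin1 (l := X.-1) _ _ D0).
- by rewrite /B1; field; rewrite (XpE N) x0 e0.
- by clear -NXY pN X0; lia.
- by rewrite XY pY fact_pred //; field.
Qed.

Lemma ext_inert2 (k X Y : nat) : (1 < X)%N -> (Y < p)%N ->
  K`!%:R * L`!%:R = X`!%:R * Y`!%:R :> rat ->
  (k = X.-2 /\ N = (X + Y)%N) \/ (k = (2 * p + Y)%N /\ N = (X + Y)%N) ->
  'C(5 * N, k)%:R = C0 * B2 * (X%:R * (X%:R - 1) / eps p Y 2).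
Proof.
move=> X0 Yp XY kE; have e0 := eps_neq0 Yp two_zp.
have hN := Xp_neq0 N (ltn0Sn 1); have hN1 := Xp1_neq0 N.
have x0 : X%:R != 0 :> rat by rewrite pnatr_eq0; clear -X0; lia.
have x1 : X%:R - 1 != 0 :> rat by rewrite subr_eq0 pnatr_eq1; clear -X0; lia.
have pY := fact_eps p 2 Y.
have F2 : X.-2`!%:R = X`!%:R / (X%:R * (X%:R - 1)) :> rat.
  rewrite !fact_pred; [|clear -X0; lia|clear -X0; lia].
  rewrite (_ : X.-1%:R = X%:R - 1 :> rat); first by rewrite -mulrA -invfM.
  by rewrite -[in RHS](ltn_predK X0) -natr1 addrK.
have D0 : eps p Y 2 / (X%:R * (X%:R - 1)) != 0.
  by apply: mulf_neq0 => //; rewrite invr_eq0; apply: mulf_neq0.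
case: kE => [[-> NXY] | [-> NXY]].
  rewrite (ext_bin2 (l := 2 * p + Y) _ _ D0).
  - by rewrite /B2; field; rewrite hN hN1 x0 x1 e0.
  - by clear -NXY pN X0; lia.
  - by rewrite XY pY F2; field; rewrite x0 x1.
rewrite (ext_bin2 (l := X.-2) _ _ D0).
- by rewrite /B2; field; rewrite hN hN1 x0 x1 e0.
- by clear -NXY pN X0; lia.
- by rewrite XY pY F2; field; rewrite x0 x1.
Qed.
End Extrapolation.

Section ExtrapolationValue.
Variables (p : nat) (p_pr : prime p) (p_gt3 : (3 < p)%N).
Let p_gt2 : (2 < p)%N := ltnW p_gt3.
Variables (N K L : nat) (pN : p = N.*2.+1) (NKL : N = (K + L)%N).
Let Np : (N < p)%N. Proof. by lia. Qed.
Let Kp : (K < p)%N. Proof. by lia. Qed.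
Let Lp : (L < p)%N. Proof. by lia. Qed.
Variables (kap lam : rat).
Hypotheses (kE : p%:R * kap = 1 / 8 + K%:R) (lE : p%:R * lam = 3 / 8 + L%:R).
Let u2 := zpu2 p_pr p_gt3.
Let u8 := zpu8 p_pr p_gt3.
Let i2 : 2^-1 \in zp p := zpu_inv_zp u2.
Let i8 : 8^-1 \in zp p := zpu_inv_zp u8.
Let NR : N%:R = (p%:R - 1) / 2 :> rat.
Proof. by rewrite pN -natr1 -mul2n natrM; field. Qed.

Let C0z : 'C(N, K)%:R \in zp p. Proof. exact: zp_nat. Qed.
Let swap : K`!%:R * L`!%:R = L`!%:R * K`!%:R :> rat. Proof. exact: mulrC. Qed.
Let NLK : N = (L + K)%N. Proof. by rewrite addnC. Qed.

Let jet8 (x : rat) (m b : int) : x = m%:~R / 8 + p%:R * (b%:~R / 8) ->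
  jet p x (m%:~R / 8) (b%:~R / 8) 0.
Proof. by move=> ->; apply: jet_lin => //; rewrite rpredM ?zp_int. Qed.

Let zpu_m8 (m : int) : ~~ (p %| `|m|)%N -> zpu p (m%:~R / 8).
Proof. by move=> pm; apply: zpuM; [apply: zpu_int | apply: zpuV]. Qed.

Let small m : (0 < `|m|)%N -> (`|m| <= 4)%N \/ `|m|%N = 12%N -> ~~ (p %| `|m|)%N.
Proof.
move=> m0 [m4 | ->]; first rewrite gtnNdvd //.
  have p4 : p != 4%N by apply: contraTneq p_pr => ->.
  by clear -m4 p_gt3 p4; lia.
rewrite (_ : 12 = 2 * (2 * 3))%N // !Euclid_dvdM // !gtnNdvd //.
Qed.

Let jE X b := jet_eps p_pr p_gt2 (N := X) (t := b).
Let one_zp : 1 \in zp p. Proof. by rewrite rpred1. Qed.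
Let two_zp : 2 \in zp p. Proof. by rewrite zp_nat. Qed.
Let hz : - (1 / 2) \in zp p. Proof. by rewrite rpredN mul1r. Qed.

(** After division by C(N, K) both sides are products of linear functions of p, values of [eps] and
    C(2p, p) = 2 modulo p^3. Their second order expansions agree identically in the harmonic sums of
    K, L and N. *)
Lemma ext_value_split : p = (8 * K + 1)%N -> L = (3 * K)%N -> kap = 1 / 8 -> lam = 3 / 8 ->
  cong p 3 ((p%:R - 1) * (15 * 'C(N, K)%:R - 10 * ('C(3 * N, K)%:R + 'C(3 * N, L)%:R)
    + 3 * ('C(5 * N, K)%:R + 'C(5 * N, K + 2 * N)%:R + 'C(5 * N, L)%:R)))
  (- 8 * Tval N K L).
Proof.
move=> pK LK kapE lamE.
have kz : kap \in zp p by rewrite kapE mul1r.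
have lz : lam \in zp p by rewrite lamE rpredM ?zp_nat.
rewrite (Tval_eps p_pr p_gt3 pN NKL kE lE kz lz).
rewrite !(ext_split1 p_pr p_gt3 pN NKL NKL Kp Lp erefl, ext_split1 p_pr p_gt3 pN NKL NLK Lp Kp swap).
rewrite !(ext_split2 p_pr p_gt3 pN NKL NKL Kp Lp erefl, ext_split2 p_pr p_gt3 pN NKL NLK Lp Kp swap).
rewrite (ext_middle p_pr p_gt3 pN NKL).
have KR : K%:R = (p%:R - 1) / 8 :> rat by move: kE; rewrite kapE; lra.
have LR : L%:R = 3 * (p%:R - 1) / 8 :> rat by move: lE; rewrite lamE; lra.
have jN1 : jet p (N%:R + p%:R) ((-4)%:~R / 8) (12%:~R / 8) 0 by apply: jet8; rewrite NR; field.
have jN2 : jet p (N%:R + 2 * p%:R) ((-4)%:~R / 8) (20%:~R / 8) 0 by apply: jet8; rewrite NR; field.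
have jN3 : jet p (N%:R + 2 * p%:R - 1) ((-12)%:~R / 8) (20%:~R / 8) 0 by apply: jet8; rewrite NR; field.
have jK1 : jet p (K%:R + p%:R) ((-1)%:~R / 8) (9%:~R / 8) 0 by apply: jet8; rewrite KR; field.
have jK2 : jet p (K%:R + 2 * p%:R) ((-1)%:~R / 8) (17%:~R / 8) 0 by apply: jet8; rewrite KR; field.
have jK3 : jet p (K%:R + 2 * p%:R - 1) ((-9)%:~R / 8) (17%:~R / 8) 0 by apply: jet8; rewrite KR; field.
have jL1 : jet p (L%:R + p%:R) ((-3)%:~R / 8) (11%:~R / 8) 0 by apply: jet8; rewrite LR; field.
have jL2 : jet p (L%:R + 2 * p%:R) ((-3)%:~R / 8) (19%:~R / 8) 0 by apply: jet8; rewrite LR; field.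
have jL3 : jet p (L%:R + 2 * p%:R - 1) ((-11)%:~R / 8) (19%:~R / 8) 0 by apply: jet8; rewrite LR; field.
have jp : jet p (p%:R - 1) ((-8)%:~R / 8) (8%:~R / 8) 0 by apply: jet8; field.
have jm : jet p 'C(p.*2, p)%:R 2 0 0 := jet_trans (bin2p_cong p_pr p_gt3 pN) (jet_const two_zp).
have v1 := zpu1 p.
have un1 : zpu p ((-4)%:~R / 8) by apply: zpu_m8; apply: small => //; left.
have un2 : zpu p ((-12)%:~R / 8) by apply: zpu_m8; apply: small => //; right.
have kNz : - kap \in zp p by rewrite rpredN.
have lNz : - lam \in zp p by rewrite rpredN.
have eN1 := jE Np one_zp; have eN2 := jE Np two_zp; have eNh := jE Np hz.
have eK1 := jE Kp one_zp; have eK2 := jE Kp two_zp; have eKh := jE Kp kNz.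
have eL1 := jE Lp one_zp; have eL2 := jE Lp two_zp; have eLh := jE Lp lNz.
have jB1 := jetM p_pr eN1 (jetV p_pr un1 jN1).
have un12 : zpu p ((-4)%:~R / 8 * ((-12)%:~R / 8)) by apply: zpuM.
have jB2 := jetM p_pr eN2 (jetV p_pr un12 (jetM p_pr jN2 jN3)).
have v11 : zpu p (1 * 1) by apply: zpuM.
have jC1 := jetM p_pr jB1 (jetD (jetM p_pr jL1 (jetV p_pr v1 eL1)) (jetM p_pr jK1 (jetV p_pr v1 eK1))).
have jC2 := jetM p_pr jB2 (jetD (jetD
  (jetM p_pr (jetM p_pr jL2 jL3) (jetV p_pr v1 eL2))
  (jetM p_pr (jetM p_pr (jetM p_pr jm jK1) jL1) (jetV p_pr v11 (jetM p_pr eK1 eL1))))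
  (jetM p_pr (jetM p_pr jK2 jK3) (jetV p_pr v1 eK2))).
have z15 : 15 \in zp p by rewrite zp_nat.
have z10 : -10 \in zp p by rewrite rpredN zp_nat.
have z3 : 3 \in zp p by rewrite zp_nat.
have z8 : -8 \in zp p by rewrite rpredN zp_nat.
have jl := jetM p_pr jp (jetD (jetD (jet_const z15) (jetM p_pr (jet_const z10) jC1))
   (jetM p_pr (jet_const z3) jC2)).
have jr := jetM p_pr (jet_const z8) (jetM p_pr eNh (jetV p_pr v11 (jetM p_pr eKh eLh))).
have fin0 := jet_cong jl jr ltac:(by field).
have fin1 := fin0 ltac:(by rewrite kapE lamE; field).
have fin := fin1 ltac:(by rewrite kapE lamE; field).
have := congMl C0z fin; congr cong; ring.
Qed.

Lemma ext_value_inert : p = (8 * L + 3)%N -> K = (3 * L).+1 -> kap = 3 / 8 -> lam = 1 / 8 ->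
  cong p 3 ((p%:R + 1) * (15 * 'C(N, K)%:R - 10 * ('C(3 * N, K.-1)%:R + 'C(3 * N, p + K)%:R)
    + 3 * ('C(5 * N, K.-2)%:R + 'C(5 * N, K + 2 * N)%:R + 'C(5 * N, 2 * p + K)%:R)))
  (8 * Tval N K L).
Proof.
move=> pL KL kapE lamE.
have kz : kap \in zp p by rewrite kapE rpredM ?zp_nat.
have lz : lam \in zp p by rewrite lamE mul1r.
have L0 : (0 < L)%N.
  by case: (posnP L) pL p_gt3 => // -> ->.
have K1 : (1 < K)%N by clear -KL L0; lia.
rewrite (Tval_eps p_pr p_gt3 pN NKL kE lE kz lz).
rewrite (@ext_inert1 p p_pr p_gt3 N K L pN NKL K.-1 K L (ltnW K1) Lp erefl (or_introl (conj erefl NKL))).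
rewrite (@ext_inert1 p p_pr p_gt3 N K L pN NKL (p + K) L K L0 Kp swap (or_intror (conj erefl NLK))).
rewrite (@ext_inert2 p p_pr p_gt3 N K L pN NKL K.-2 K L K1 Lp erefl (or_introl (conj erefl NKL))).
(* For L = 1, that is p = 11, the index 2p + K exceeds 5N and the complementary index L - 2 is
   negative; both sides vanish then because of the factor L - 1. *)
have E2 : 'C(5 * N, 2 * p + K)%:R = 'C(N, K)%:R *
   (eps p N 2 / ((N%:R + 2 * p%:R) * (N%:R + 2 * p%:R - 1))) * (L%:R * (L%:R - 1) / eps p K 2) :> rat.
  have [L1 | L1] := ltnP 1 L.
    exact: (@ext_inert2 p p_pr p_gt3 N K L pN NKL (2 * p + K) L K L1 Kp swap (or_intror (conj erefl NLK))).
  have -> : L = 1%N by clear -L0 L1; lia.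
  rewrite bin_small; last by clear -pL KL L0 L1 pN; lia.
  by rewrite subrr mulr0 mul0r mulr0.
rewrite E2 (ext_middle p_pr p_gt3 pN NKL).
have KR : K%:R = (3 * p%:R - 1) / 8 :> rat by move: kE; rewrite kapE; lra.
have LR : L%:R = (p%:R - 3) / 8 :> rat by move: lE; rewrite lamE; lra.
have jN1 : jet p (N%:R + p%:R) ((-4)%:~R / 8) (12%:~R / 8) 0 by apply: jet8; rewrite NR; field.
have jN2 : jet p (N%:R + 2 * p%:R) ((-4)%:~R / 8) (20%:~R / 8) 0 by apply: jet8; rewrite NR; field.
have jN3 : jet p (N%:R + 2 * p%:R - 1) ((-12)%:~R / 8) (20%:~R / 8) 0 by apply: jet8; rewrite NR; field.
have jK0 : jet p K%:R ((-1)%:~R / 8) (3%:~R / 8) 0 by apply: jet8; rewrite KR; field.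
have jK1 : jet p (K%:R + p%:R) ((-1)%:~R / 8) (11%:~R / 8) 0 by apply: jet8; rewrite KR; field.
have jK3 : jet p (K%:R - 1) ((-9)%:~R / 8) (3%:~R / 8) 0 by apply: jet8; rewrite KR; field.
have jL0 : jet p L%:R ((-3)%:~R / 8) (1%:~R / 8) 0 by apply: jet8; rewrite LR; field.
have jL1 : jet p (L%:R + p%:R) ((-3)%:~R / 8) (9%:~R / 8) 0 by apply: jet8; rewrite LR; field.
have jL3 : jet p (L%:R - 1) ((-11)%:~R / 8) (1%:~R / 8) 0 by apply: jet8; rewrite LR; field.
have jp : jet p (p%:R + 1) (8%:~R / 8) (8%:~R / 8) 0 by apply: jet8; field.
have jm : jet p 'C(p.*2, p)%:R 2 0 0 := jet_trans (bin2p_cong p_pr p_gt3 pN) (jet_const two_zp).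
have v1 := zpu1 p.
have un1 : zpu p ((-4)%:~R / 8) by apply: zpu_m8; apply: small => //; left.
have un2 : zpu p ((-12)%:~R / 8) by apply: zpu_m8; apply: small => //; right.
have kNz : - kap \in zp p by rewrite rpredN.
have lNz : - lam \in zp p by rewrite rpredN.
have eN1 := jE Np one_zp; have eN2 := jE Np two_zp; have eNh := jE Np hz.
have eK1 := jE Kp one_zp; have eK2 := jE Kp two_zp; have eKh := jE Kp kNz.
have eL1 := jE Lp one_zp; have eL2 := jE Lp two_zp; have eLh := jE Lp lNz.
have jB1 := jetM p_pr eN1 (jetV p_pr un1 jN1).
have un12 : zpu p ((-4)%:~R / 8 * ((-12)%:~R / 8)) by apply: zpuM.
have jB2 := jetM p_pr eN2 (jetV p_pr un12 (jetM p_pr jN2 jN3)).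
have v11 : zpu p (1 * 1) by apply: zpuM.
have jC1 := jetM p_pr jB1 (jetD (jetM p_pr jK0 (jetV p_pr v1 eL1)) (jetM p_pr jL0 (jetV p_pr v1 eK1))).
have jC2 := jetM p_pr jB2 (jetD (jetD
  (jetM p_pr (jetM p_pr jK0 jK3) (jetV p_pr v1 eL2))
  (jetM p_pr (jetM p_pr (jetM p_pr jm jK1) jL1) (jetV p_pr v11 (jetM p_pr eK1 eL1))))
  (jetM p_pr (jetM p_pr jL0 jL3) (jetV p_pr v1 eK2))).
have z15 : 15 \in zp p by rewrite zp_nat.
have z10 : -10 \in zp p by rewrite rpredN zp_nat.
have z3 : 3 \in zp p by rewrite zp_nat.
have z8 : 8 \in zp p by rewrite zp_nat.
have jl := jetM p_pr jp (jetD (jetD (jet_const z15) (jetM p_pr (jet_const z10) jC1))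
   (jetM p_pr (jet_const z3) jC2)).
have jr := jetM p_pr (jet_const z8) (jetM p_pr eNh (jetV p_pr v11 (jetM p_pr eKh eLh))).
have fin0 := jet_cong jl jr ltac:(by field).
have fin1 := fin0 ltac:(by rewrite kapE lamE; field).
have fin := fin1 ltac:(by rewrite kapE lamE; field).
have := congMl C0z fin; congr cong; ring.
Qed.
End ExtrapolationValue.

(* Both (xY - yX)(xY + yX) = p (Y^2 - y^2) and
   p^2 = (xX + 2yY)^2 + 2 (xY - yX)^2, so p divides a factor, which vanishes. *)
Lemma rep_unique (p : nat) (x y X Y : int) : prime p ->
  p%:Z = x ^+ 2 + 2 * y ^+ 2 -> p%:Z = X ^+ 2 + 2 * Y ^+ 2 ->
  x ^+ 2 = X ^+ 2 /\ y ^+ 2 = Y ^+ 2.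
Proof.
move=> p_pr h H.
suff yY : y ^+ 2 = Y ^+ 2.
  by split=> //; move: h H; rewrite yY => -> /addIr.
have p_gt0 : 0 < p%:Z by have := prime_gt0 p_pr.
have factor (u v : int) : u ^+ 2 = X ^+ 2 -> v ^+ 2 = Y ^+ 2 ->
    (p%:Z %| x * v - y * u)%Z -> y ^+ 2 = Y ^+ 2.
  move=> uX vY /dvdzP[k kE].
  have E1 : p%:Z ^+ 2 = (x * u + 2 * (y * v)) ^+ 2 + 2 * (x * v - y * u) ^+ 2.
    by rewrite expr2 {1}h H -uX -vY; ring.
  have k0 : k = 0.
    have : p%:Z ^+ 2 * (1 - 2 * k ^+ 2) >= 0.
      rewrite (_ : _ * _ = (x * u + 2 * (y * v)) ^+ 2); first exact: sqr_ge0.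
      have -> : (x * u + 2 * (y * v)) ^+ 2 = p%:Z ^+ 2 - 2 * (x * v - y * u) ^+ 2 by rewrite E1; ring.
      by rewrite kE; ring.
    rewrite pmulr_rge0 ?exprn_gt0 // => k1.
    apply/eqP; rewrite -sqrf_eq0; apply/eqP; have k2 := sqr_ge0 k.
    by clear -k1 k2; move: (k ^+ 2) k1 k2 => z k1 k2; lia.
  have E : p%:Z * (Y ^+ 2 - y ^+ 2) = (x * v - y * u) * (x * v + y * u).
    rewrite mulrBr {1}h H -uX -vY; ring.
  by move: E; rewrite kE k0 !mul0r => /eqP; rewrite mulf_eq0 gt_eqF //= subr_eq0 => /eqP->.
have : (p%:Z %| (x * Y - y * X) * (x * Y + y * X))%Z.
  have -> : (x * Y - y * X) * (x * Y + y * X) = p%:Z * (Y ^+ 2 - y ^+ 2).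
    rewrite mulrBr {1}h H; ring.
  by rewrite dvdz_mulr.
rewrite dvdzE abszM Euclid_dvdM // => /orP[d | d].
  exact: (factor X Y).
apply: (factor (- X) Y) => //; first by rewrite sqrrN.
by rewrite mulrN opprK.
Qed.

(** * Unit roots of t^2 - 2xt + p *)

Section Roots.
Variables (p : nat) (p_pr : prime p) (p_gt3 : (3 < p)%N).

Lemma zpu_rep (x y : int) : p%:Z = x ^+ 2 + 2 * y ^+ 2 -> zpu p x%:~R /\ zpu p y%:~R.
Proof.
move=> h.
have ndvd z : (p%:Z ^+ 2 %| z)%Z -> z != p%:Z.
  move=> /dvdzP[k kE]; apply/eqP => zp; have := prime_gt1 p_pr.
  have p0 : p%:Z != 0 by have := prime_gt0 p_pr; lia.
  have : 1 = k * p%:Z.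
    by apply: (mulIf p0); rewrite mul1r -zp {1}kE zp; ring.
  move=> /(congr1 absz); rewrite abszM /= => /esym/eqP; rewrite muln_eq1 => /andP[_ /eqP->] //.
have xy : (p %| `|x|)%N = (p %| `|y|)%N.
  have p2 : (p%:Z %| 2)%Z = false.
    by apply/negP => /dvdn_leq; rewrite /= => /(_ isT); lia.
  have dsq (z : int) : (p%:Z %| z ^+ 2)%Z = (p %| `|z|)%N.
    by rewrite dvdzE abszX Euclid_dvdX ?andbT.
  rewrite -!dsq.
  have -> : x ^+ 2 = p%:Z - 2 * y ^+ 2 by rewrite h; ring.
  rewrite rpredBl ?dvdzz //.
  by rewrite !dvdzE abszM Euclid_dvdM // -[(p %| `|2|)%N]/((p%:Z %| 2)%Z) p2.
suff nx : ~~ (p %| `|x|)%N by split; apply: zpu_int; rewrite // -xy.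
apply/negP => px; have py : (p %| `|y|)%N by rewrite -xy.
have dx : (p%:Z ^+ 2 %| x ^+ 2)%Z by rewrite dvdz_exp2r.
have dy : (p%:Z ^+ 2 %| y ^+ 2)%Z by rewrite dvdz_exp2r.
have d : (p%:Z ^+ 2 %| p%:Z)%Z by rewrite [X in (_ %| X)%Z]h rpredD // dvdz_mull.
by have := ndvd _ d; rewrite eqxx.
Qed.

(** The truncated expansion t satisfies the same quadratic congruence, and w, being a unit, is 2x
    modulo p like t. Subtraction gives (w - t)(w + t - 2x) = 0 modulo p^3, whose second factor is 2x
    modulo p, a unit. *)
Lemma root_expansion (w x : rat) : zpu p w -> zpu p x ->
  cong p 3 (w ^+ 2 - 2 * x * w + p%:R) 0 ->
  cong p 3 w (2 * x - p%:R / (2 * x) - p%:R ^+ 2 / (8 * x ^+ 3)).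
Proof.
move=> wu xu /(congP p_pr)[c cz cE].
have u2 := zpu2 p_pr p_gt3; have u8 := zpu8 p_pr p_gt3.
have wz := zpu_zp wu; have xz := zpu_zp xu; have xiz := zpu_inv_zp xu.
have i2 := zpu_inv_zp u2; have i8 := zpu_inv_zp u8.
have x0 := zpu_neq0 xu; have w0 := zpu_neq0 wu.
set t := _ - _.
have tz : t \in zp p.
  rewrite /t invfM [(8 * _)^-1]invfM -exprVn.
  by rewrite !rpredB ?rpredM ?rpredX ?zp_nat.
have t1 : cong p 1 t (2 * x).
  apply/(congP p_pr); exists (- (1 / (2 * x) + p%:R / (8 * x ^+ 3))).
    rewrite rpredN invfM [(8 * _)^-1]invfM -exprVn.
    by rewrite rpredD ?rpredM ?rpredX ?rpred1 ?zp_nat.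
  by rewrite /t; field.
have w1 : cong p 1 w (2 * x).
  apply/(congP p_pr); exists (w^-1 * (p%:R ^+ 2 * c - 1)).
    by rewrite rpredM ?zpu_inv_zp // rpredB ?rpredM ?rpredX ?zp_nat ?rpred1.
  have p0 := p_neq0 p_pr.
  have -> : c = (w ^+ 2 - 2 * x * w + p%:R) / p%:R ^+ 3.
    by move: cE; rewrite subr0 => ->; field; exact: p0.
  by field; rewrite p0 w0.
have tE : cong p 3 (t ^+ 2 - 2 * x * t + p%:R) 0.
  apply/(congP p_pr); exists (1 / (8 * x ^+ 4) + p%:R / (64 * x ^+ 6)).
    have x4 : (x ^+ 4)^-1 \in zp p by apply: zpu_inv_zp; apply: zpuX.
    have x6 : (x ^+ 6)^-1 \in zp p by apply: zpu_inv_zp; apply: zpuX.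
    rewrite [(8 * x ^+ 4)^-1]invfM [(64 * x ^+ 6)^-1]invfM.
    have -> : 64^-1 = 8^-1 * 8^-1 :> rat by field.
    by apply: rpredD; apply: rpredM; rewrite ?rpred1 ?zp_nat //; apply: rpredM => //; apply: rpredM.
  by rewrite /t; field.
have u : zpu p (w + t - 2 * x).
  apply: (@cong_unit p p_pr 0 _ (2 * x)); last by apply: zpuM.
  have -> : 2 * x = 2 * x + 2 * x - 2 * x by ring.
  by apply: congB; [apply: congD | rewrite addrK; apply: cong_refl].
apply: (congMIl u).
have wE : cong p 3 (w ^+ 2 - 2 * x * w + p%:R) 0.
  by apply/(congP p_pr); exists c.
have := congD (congB wE tE) (cong_refl p 3 ((w + t - 2 * x) * t)).
rewrite subrr add0r; congr cong; ring.
Qed.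
End Roots.

(** The integer whose class modulo p^3 is 8 times the sum of the lifts of phi ([phi_sum_split]). The
    factor p - 1 is the number of roots of unity summed over; it becomes p + 1 in [ext_inert]. *)
Definition ext_split (p N K L : nat) : int :=
  (-1) ^+ K * ((p%:Z - 1) * (15 * 'C(N, K)%:Z - 10 * ('C(3 * N, K)%:Z + 'C(3 * N, L)%:Z)
    + 3 * ('C(5 * N, K)%:Z + 'C(5 * N, K + 2 * N)%:Z + 'C(5 * N, L)%:Z))).

Definition ext_inert (p N K : nat) : int :=
  (-1) ^+ K * ((p%:Z + 1) * (15 * 'C(N, K)%:Z - 10 * ('C(3 * N, K.-1)%:Z + 'C(3 * N, p + K)%:Z)
    + 3 * ('C(5 * N, K.-2)%:Z + 'C(5 * N, K + 2 * N)%:Z + 'C(5 * N, 2 * p + K)%:Z))).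

Lemma ext_splitE p N K L : (ext_split p N K L)%:~R =
  (-1) ^+ K * ((p%:R - 1) * (15 * 'C(N, K)%:R - 10 * ('C(3 * N, K)%:R + 'C(3 * N, L)%:R)
    + 3 * ('C(5 * N, K)%:R + 'C(5 * N, K + 2 * N)%:R + 'C(5 * N, L)%:R))) :> rat.
Proof.
by rewrite /ext_split !(rmorphD, rmorphB, rmorphM, rmorphXn, rmorphN, rmorph1, rmorph_nat) /= -!pmulrn.
Qed.

Lemma ext_inertE p N K : (ext_inert p N K)%:~R =
  (-1) ^+ K * ((p%:R + 1) * (15 * 'C(N, K)%:R - 10 * ('C(3 * N, K.-1)%:R + 'C(3 * N, p + K)%:R)
    + 3 * ('C(5 * N, K.-2)%:R + 'C(5 * N, K + 2 * N)%:R + 'C(5 * N, 2 * p + K)%:R))) :> rat.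
Proof.
by rewrite /ext_inert !(rmorphD, rmorphB, rmorphM, rmorphXn, rmorphN, rmorph1, rmorph_nat) /= -!pmulrn.
Qed.



(** * From the Jacobi sum to the congruences for p = 1, 3 mod 8 *)

Section Final.
Variables (p : nat) (p_pr : prime p) (p_gt3 : (3 < p)%N).
Let p_gt2 : (2 < p)%N := ltnW p_gt3.
Let sz m : (-1) ^+ m \in zp p. Proof. by rewrite rpredX // rpredN rpred1. Qed.
Let u8 := zpu8 p_pr p_gt3.

Lemma signr_sqr m : (-1) ^+ m * (-1) ^+ m = 1 :> rat.
Proof. by rewrite -exprMn mulrNN mulr1 expr1n. Qed.

(* The integer b is 8 times the p-adic unit root of T^2 - 2XT + p. *)
Lemma unit_root_T (b X : int) (t : rat) : t \in zp p ->
  cong p 3 b%:~R (8 * t) -> (p%:Z ^+ 3 %| b ^+ 2 - 16 * X * b + 64 * p%:Z)%Z ->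
  cong p 3 (t ^+ 2 - 2 * X%:~R * t + p%:R) 0.
Proof.
move=> tz bt dv.
have h : cong p 3 (b ^+ 2 - 16 * X * b + 64 * p%:Z)%:~R 0%:~R by apply/cong_int; rewrite // subr0.
rewrite !(rmorphD, rmorphB, rmorphM, rmorphXn) /= in h.
have u64 : zpu p 64 by have -> : 64 = 8 * 8 :> rat by [field]; apply: zpuM.
apply: (congMIl u64); rewrite mulr0; apply: (cong_trans _ h).
have Xz : X%:~R \in zp p := zp_int p X.
have bz : b%:~R \in zp p := zp_int p b.
have t8 : 8 * t \in zp p by rewrite rpredM ?zp_nat.
have c1 := congX p_pr 2 bz t8 bt.
have X16 : 16 * X%:~R \in zp p by rewrite rpredM ?zp_nat.
have c2 := congMl X16 bt.
apply: (cong_congr (congD (congB (cong_sym c1) (cong_sym c2)) (cong_refl p 3 (64 * p%:R)))); ring.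
Qed.

(** The hypotheses are what the Jacobi sum supplies: a representation of p with X = -1 mod 4, a unit
    root equation for b, and a number a of values of phi (namely [octic] at 5) that governs both Y
    and the sign of 4^K. The same parity decides T = V or -V and equals that of K + y/2, hence the
    sign (-1)^(y/2). *)
Lemma binom_sum_1 (K : nat) (X : int) (a : nat) : p = (8 * K + 1)%N ->
  let b := ext_split p (4 * K) K (3 * K) in
  p%:Z = X ^+ 2 + 2 * (2 * (K%:Z - a%:Z)) ^+ 2 -> (4 %| X + 1)%Z ->
  (p%:Z %| 4 ^+ K - (-1) ^+ a)%Z ->
  (p%:Z ^+ 3 %| b ^+ 2 - 16 * X * b + 64 * p%:Z)%Z ->
  forall x y : int, p%:Z = x ^+ 2 + 2 * y ^+ 2 -> (4 %| x - 1)%Z ->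
  pcongr p 4 (binom_sum p)
    (3 * p%:R * (-1) ^ (y %/ 2)%Z
     * (2 * x%:~R - p%:R / (2 * x%:~R) - p%:R ^+ 2 / (8 * x%:~R ^+ 3))).
Proof.
move=> pK b XY X4 sgn broot x y xy x4.
have pN : p = (4 * K).*2.+1 by clear -pK; lia.
have NKL : (4 * K = K + 3 * K)%N by clear; lia.
have pR : p%:R = 8 * K%:R + 1 :> rat by rewrite pK natrD natrM.
have kE : p%:R * (1 / 8) = 1 / 8 + K%:R :> rat by rewrite pR; field.
have lE : p%:R * (3 / 8) = 3 / 8 + (3 * K)%:R :> rat by rewrite pR natrM; field.
have kz : 1 / 8 \in zp p by rewrite mul1r zpu_inv_zp.
have lz : 3 / 8 \in zp p by rewrite rpredM ?zp_nat // zpu_inv_zp.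
have Tu := Tval_zpu p_pr p_gt3 pN NKL kE lE kz lz.
have Wu := Wval_zpu p_pr p_gt3 pN NKL kE lE kz lz.
have TW := Tval_Wval_mod p_pr p_gt3 pN NKL kE lE kz lz.
have T2 := Tval_sqr_1 p_pr p_gt3 pN NKL kE lE kz lz erefl erefl.
have TB := ext_value_split p_pr p_gt3 pN NKL kE lE pK erefl erefl erefl.
have Lp : (3 * K < p)%N by clear -pK; lia.
have S := binom_sum_simple_zero p_pr p_gt3 Lp lz (esym lE).
set V := _ * _ / _ in S.
have VW : V = (-1) ^+ K * Wval (3 * K).
  rewrite /V /Wval -mulN1r exprMn -!mulrA; congr (_ * _).
  by rewrite (@signr_parity _ K) //; clear; lia.
set T := Tval _ _ _ in Tu TW T2 TB.
move: Wu TW T2 VW; set W := Wval _ => Wu TW T2 VW.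
clearbody T W V.
have Tz := zpu_zp Tu; have Wz := zpu_zp Wu.
(* 4^(4K) = 2^(p - 1) is 1 modulo p, so 4^(3K) is inverse to 4^K, whose residue is (-1)^a. *)
have TV1 : cong p 1 T ((-1) ^+ a * V).
  have c4 : cong p 1 (4 ^+ K) ((-1) ^+ a).
    have : cong p 1 (4 ^+ K)%:~R ((-1) ^+ a)%:~R by apply/cong_int; rewrite // expr1.
    by rewrite !rmorphXn rmorphN1.
  have f : cong p 1 (4 ^+ (4 * K)) 1.
    have := fermat_cong p_pr (zpu2 p_pr p_gt3).
    have -> : p.-1 = (2 * (4 * K))%N by clear -pK; lia.
    by rewrite exprM (_ : 2%:R ^+ 2 = 4 :> rat); [|ring].
  have e : 4 ^+ (4 * K) = 4 ^+ (3 * K) * 4 ^+ K :> rat by rewrite -exprD; congr (_ ^+ _); clear; lia.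
  have h1 := congMr (zp_nat p 4 : 4 \in zp p) TW.
  have k4z : 4 ^+ K \in zp p by rewrite rpredX ?zp_nat.
  have {}h1 := congMr k4z TW.
  have sWz : (-1) ^+ (K + 4 * K) * W \in zp p by rewrite rpredM.
  have h2 := congMl sWz c4.
  have h3 := congMl Tz f; rewrite mulr1 in h3.
  apply: (cong_trans (cong_sym h3)); rewrite e mulrA; apply: (cong_trans h1); apply: (cong_trans h2).
  apply: cong_eq; rewrite VW (@signr_parity (K + 4 * K) K); [ring | clear; lia].
have TV : cong p 3 T ((-1) ^+ a * V).
  apply: (cong_sqr p_pr p_gt2) => //.
    by rewrite VW; apply: zpuM; [exact: sgn_zpu | apply: zpuM; [exact: sgn_zpu |]].
  apply: (cong_congr T2) => //; rewrite VW.
  have -> : ((-1) ^+ a * ((-1) ^+ K * W)) ^+ 2 =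
    ((-1) ^+ a * (-1) ^+ a) * ((-1) ^+ K * (-1) ^+ K) * W ^+ 2 by ring.
  by rewrite !signr_sqr !mul1r.
have Vz : V \in zp p by rewrite VW rpredM.
have Vu : zpu p V by rewrite VW; apply: zpuM => //; exact: sgn_zpu.
(* w is the unit root of T^2 + 2XT + p *)
pose w := (-1) ^+ (K + a) * V.
have wz : w \in zp p by rewrite rpredM.
have bw : cong p 3 b%:~R (8 * - w).
  rewrite /b ext_splitE.
  have h := congMl (sz K) TB.
  have s8 : (-1) ^+ K * -8 \in zp p by rewrite rpredM ?rpredN ?zp_nat.
  have h2 := congMl s8 TV.
  apply: (cong_trans h); rewrite mulrA; apply: (cong_trans h2).
  apply: cong_eq; rewrite /w exprD; ring.
have root := unit_root_T (rpredNr wz) bw broot.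
have [xX yY] := rep_unique p_pr xy XY.
(* x is 1 and X is -1 modulo 4. *)
have xE : x = - X.
  move: xX => /eqP; rewrite eqf_sqr => /orP[/eqP E | /eqP //].
  exfalso; move: x4 X4; rewrite E => /dvdzP[k kE1] /dvdzP[l lE1]; clear -kE1 lE1; lia.
have [xu _] := zpu_rep p_pr p_gt3 xy.
have wu : zpu p w by apply: zpuM => //; exact: sgn_zpu.
have wroot : cong p 3 (w ^+ 2 - 2 * x%:~R * w + p%:R) 0.
  by apply: (cong_congr root) => //; rewrite xE rmorphN /=; ring.
have wE := root_expansion p_pr p_gt3 wu xu wroot.
have sgE : (-1) ^ (y %/ 2)%Z = (-1) ^+ (K + a) :> rat.
  have : y = 2 * (K%:Z - a%:Z) \/ y = 2 * (a%:Z - K%:Z).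
    move: yY => /eqP; rewrite eqf_sqr => /orP[/eqP-> | /eqP->]; [left | right]; [by []|].
    by ring.
  have expB (m n : nat) : (-1) ^ (m%:Z - n%:Z) = (-1) ^+ (m + n) :> rat.
    rewrite expfzDr ?oppr_eq0 ?oner_eq0 // -exprnP -exprnN exprD.
    by rewrite -exprVn invrN invr1.
  by move=> [->|->]; rewrite mulKz // expB // addnC.
apply: (cong_pcongr p_pr).
  apply: (cong_trans S).
  have -> : 3 * p%:R * (-1) ^ (y %/ 2)%Z * (2 * x%:~R - p%:R / (2 * x%:~R) - p%:R ^+ 2 / (8 * x%:~R ^+ 3)) =
    p%:R * (3 * (-1) ^+ (K + a) * (2 * x%:~R - p%:R / (2 * x%:~R) - p%:R ^+ 2 / (8 * x%:~R ^+ 3))) :> rat.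
    by rewrite sgE; ring.
  apply: (cong_p p_pr).
  have s3 : 3 * (-1) ^+ (K + a) \in zp p by rewrite rpredM ?zp_nat.
  apply: (cong_trans _ (congMl s3 wE)); apply: cong_eq.
  have ss := signr_sqr (K + a).
  have -> : 3 * (-1) ^+ (K + a) * w = 3 * ((-1) ^+ (K + a) * (-1) ^+ (K + a)) * V by rewrite /w; ring.
  by rewrite ss; field.
have tz : 2 * x%:~R - p%:R / (2 * x%:~R) - p%:R ^+ 2 / (8 * x%:~R ^+ 3) \in zp p.
  exact: (cong_zp p_pr (cong_sym wE) wz).
by apply: rpredM => //; rewrite sgE rpredM // rpredM ?zp_nat.
Qed.

(** The quartic is 4 (V^2 + 2yV + p/2)(V^2 - 2yV + p/2), and v is the expansion of the unit root of
    its first factor. As both V^2 and v^2 are 4y^2 modulo p, the cofactor of V^2 - v^2 is 16y^2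
    modulo p, a unit; the residue of V then separates v from -v. *)
Lemma quartic_root_expansion (y V : rat) (v := - (2 * y) + p%:R / (4 * y) + p%:R ^+ 2 / (32 * y ^+ 3)) :
  zpu p y -> V \in zp p -> cong p 1 V (-2 * y) ->
  cong p 3 (4 * (V ^+ 2) ^+ 2 + (4 * p%:R - 16 * y ^+ 2) * V ^+ 2 + p%:R ^+ 2) 0 ->
  v \in zp p /\ cong p 3 V v.
Proof.
move=> yu Vz V1 Vroot.
have y0 := zpu_neq0 yu; have yz := zpu_zp yu; have pz := zp_nat p p.
have u2 := zpu2 p_pr p_gt3; have u4 := zpu4 p_pr p_gt3.
have i2 := zpu_inv_zp u2.
have u32 : zpu p 32 by have -> : 32 = 4 * 8 :> rat by [field]; exact: zpuM u4 u8.
have i4y := zpu_inv_zp (zpuM u4 yu).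
have i32y := zpu_inv_zp (zpuM u32 (zpuX 3 yu)).
have m2y : zpu p (-2 * y) := zpuM (zpuN u2) yu.
move: i4y i32y; set g := (4 * y)^-1; set h := (32 * y ^+ 3)^-1 => gz hz.
have vE : v = -2 * y + p%:R * g + p%:R ^+ 2 * h by rewrite /v mulNr.
have gE : g * (4 * y) = 1 by exact: mulVf (zpu_neq0 (zpuM u4 yu)).
have ghE : g ^+ 2 = 2 * y * h by rewrite /g /h; field; exact: y0.
clearbody g h v.
have vz : v \in zp p.
  by rewrite vE; exact: zpD (zpD (zpu_zp m2y) (zpM pz gz)) (zpM (zpX 2 pz) hz).
split; first exact: vz.
have v1 : cong p 1 v (-2 * y).
  apply/(congP p_pr); exists (g + p%:R * h); last by rewrite vE; ring.
  exact: zpD gz (zpM pz hz).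
have vu : zpu p v := cong_unit p_pr v1 m2y.
have vroot : cong p 3 (v ^+ 2 + 2 * y * v + p%:R / 2) 0.
  apply/(congP p_pr); exists (2 * g * h + p%:R * h ^+ 2).
    exact: zpD (zpM (zpM (zp_nat p 2) gz) hz) (zpM pz (zpX 2 hz)).
  have -> : p%:R / 2 = p%:R * (g * (4 * y)) / 2 by rewrite gE mulr1.
  have -> : p%:R ^+ 3 * (2 * g * h + p%:R * h ^+ 2) =
    p%:R ^+ 2 * (g ^+ 2 - 2 * y * h) + p%:R ^+ 3 * (2 * g * h + p%:R * h ^+ 2).
    by rewrite ghE subrr mulr0 add0r.
  by rewrite vE subr0; field.
have fz : 4 * (v ^+ 2 - 2 * y * v + p%:R / 2) \in zp p.
  exact: zpM (zp_nat p 4) (zpD (zpD (zpX 2 vz) (zpN (zpM (zpM (zp_nat p 2) yz) vz))) (zpM pz i2)).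
have qv := congMl fz vroot; rewrite mulr0 in qv.
have v2 := congX p_pr 2 vz (zpu_zp m2y) v1.
have V2 := congX p_pr 2 Vz (zpu_zp m2y) V1.
apply: (cong_sqr p_pr p_gt2 vu); last exact: cong_trans V1 (cong_sym v1).
have u : zpu p (4 * (V ^+ 2 + v ^+ 2) + (4 * p%:R - 16 * y ^+ 2)).
  apply: (@cong_unit p p_pr 0 _ (16 * y ^+ 2)); last first.
    by have -> : 16 = 4 * 4 :> rat by [field]; exact: zpuM (zpuM u4 u4) (zpuX 2 yu).
  have p0 := congMl (zp_nat p 4) (cong_p0 p_pr); rewrite mulr0 in p0.
  have h1 := congD (congMl (zp_nat p 4) (congD V2 v2)) (congB p0 (cong_refl p 1 (16 * y ^+ 2))).
  by apply: (cong_congr h1); [ | ring].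
apply: (congMIl u).
have h1 := congD (congB Vroot qv) (cong_refl p 3 ((4 * (V ^+ 2 + v ^+ 2) + (4 * p%:R - 16 * y ^+ 2)) * v ^+ 2)).
apply: (cong_congr h1); [by field | by ring].
Qed.

(** Multiplying t^2 - 2Xt + p by t^2 + 2Xt + p leaves only t^2 = T^2 = -2 V^2 and X^2 = p - 2y^2,
    which is the quartic for V. The sign of V is fixed by the residue of b, expressed through Y. *)
Lemma binom_sum_3 (L : nat) (X : int) (a : nat) : p = (8 * L + 3)%N ->
  let b := ext_inert p (4 * L).+1 (3 * L).+1 in
  let Y := 2 * L%:Z + 1 - 2 * a%:Z in
  p%:Z = X ^+ 2 + 2 * Y ^+ 2 ->
  (p%:Z %| 4 ^+ L * b - 16 * (-1) ^+ a * Y)%Z ->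
  (p%:Z ^+ 3 %| b ^+ 2 - 16 * X * b + 64 * p%:Z)%Z ->
  forall x y : int, p%:Z = x ^+ 2 + 2 * y ^+ 2 -> (4 %| y - 1)%Z ->
  pcongr p 4 (binom_sum p)
    (p%:R * (- (2 * y%:~R) + p%:R / (4 * y%:~R) + p%:R ^+ 2 / (32 * y%:~R ^+ 3))).
Proof.
move=> pL b Y XY sgn broot x y xy y4.
have pN : p = (4 * L).+1.*2.+1 by clear -pL; lia.
have NKL : (4 * L).+1 = ((3 * L).+1 + L)%N by clear; lia.
have pR : p%:R = 8 * L%:R + 3 :> rat by rewrite pL natrD natrM.
have kE : p%:R * (3 / 8) = 1 / 8 + (3 * L).+1%:R :> rat.
  by rewrite pR -(natr1 (3 * L)) natrM; field.
have lE : p%:R * (1 / 8) = 3 / 8 + L%:R :> rat by rewrite pR; field.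
have lz : 1 / 8 \in zp p by rewrite mul1r zpu_inv_zp.
have kz : 3 / 8 \in zp p by rewrite rpredM ?zp_nat // zpu_inv_zp.
have Tu := Tval_zpu p_pr p_gt3 pN NKL kE lE kz lz.
have Wu := Wval_zpu p_pr p_gt3 pN NKL kE lE kz lz.
have TW := Tval_Wval_mod p_pr p_gt3 pN NKL kE lE kz lz.
have T2 := Tval_sqr_3 p_pr p_gt3 pN NKL kE lE kz lz erefl erefl.
have TB := ext_value_inert p_pr p_gt3 pN NKL kE lE pL erefl erefl erefl.
have Lp : (L < p)%N by clear -pL; lia.
have S := binom_sum_simple_zero p_pr p_gt3 Lp lz (esym lE).
set V := _ * _ / _ in S.
have VW : V = (-1) ^+ L * Wval L.
  by rewrite /V /Wval -mulN1r exprMn -!mulrA.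
set T := Tval _ _ _ in Tu TW T2 TB.
move: Wu TW T2 VW; set W := Wval _ => Wu TW T2 VW.
clearbody T W V.
have Tz := zpu_zp Tu; have Wz := zpu_zp Wu.
have Vz : V \in zp p by rewrite VW rpredM.
have Vu : zpu p V by rewrite VW; apply: zpuM => //; exact: sgn_zpu.
have TV2 : cong p 3 (T ^+ 2) (-2 * V ^+ 2).
  apply: (cong_congr T2) => //; rewrite VW.
  have -> : ((-1) ^+ L * W) ^+ 2 = ((-1) ^+ L * (-1) ^+ L) * W ^+ 2 by ring.
  by rewrite signr_sqr mul1r.
have TV1 : cong p 1 (T * 4 ^+ L) V.
  apply: (cong_congr TW) => //; rewrite VW (@signr_parity ((3 * L).+1 + (4 * L).+1) L) //.
  by clear; lia.
pose t := (-1) ^+ (3 * L).+1 * T.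
have tz : t \in zp p by rewrite rpredM.
have bt : cong p 3 b%:~R (8 * t).
  rewrite /b ext_inertE.
  have h := congMl (sz (3 * L).+1) TB.
  by apply: (cong_trans h); apply: cong_eq; rewrite /t mulrCA.
have root := unit_root_T tz bt broot.
have [xX yY] := rep_unique p_pr xy XY.
have [xu yu] := zpu_rep p_pr p_gt3 xy.
(* Y = 1 + 2 (L - a) is 1 or -1 modulo 4 according to the parity of L + a, while y is 1 modulo 4. *)
have yE : y = (-1) ^+ (L + a) * Y.
  have sq1 : (-1 : int) ^+ (L + a) = 1 /\ ~~ odd (L + a) \/ (-1 : int) ^+ (L + a) = -1 /\ odd (L + a).
    by rewrite -signr_odd; case: (odd _); [right | left].
  move: yY => /eqP; rewrite eqf_sqr => /orP E.
  move: y4 => /dvdzP[k kE1]; have {}kE1 : y = 4 * k + 1 by clear -kE1; lia.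
  have {}E : y = Y \/ y = - Y by case: E => /eqP ->; [left | right].
  by case: sq1 => -[-> od]; rewrite ?mul1r ?mulN1r; move: E kE1; rewrite /Y; clear -od; lia.
clearbody b Y.
have V1 : cong p 1 V (-2 * y%:~R).
  have h : cong p 1 (4 ^+ L * b - 16 * (-1) ^+ a * Y)%:~R 0%:~R.
    by apply/cong_int; rewrite // subr0 expr1.
  rewrite !(rmorphB, rmorphM, rmorphXn, rmorphN1, rmorph_nat) /= in h.
  have b1 := cong_le p_pr (isT : (1 <= 3)%N) bt.
  have k4z : 4 ^+ L \in zp p by rewrite rpredX ?zp_nat.
  have b2 := congMl k4z b1.
  have s8 : 8 * (-1) ^+ (3 * L).+1 \in zp p by rewrite rpredM ?zp_nat.
  have c1 := congMl s8 TV1.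
  have c2 : cong p 1 (8 * (-1) ^+ (3 * L).+1 * V) (16 * (-1) ^+ a * Y%:~R).
    apply: (cong_trans (cong_sym c1)); apply: (cong_congr (x := 4 ^+ L * (8 * t)) (y := 16 * (-1) ^+ a * Y%:~R)) => //.
      apply: (cong_trans (cong_sym b2)).
      apply: (cong_congr (congD h (cong_refl p 1 (16 * (-1) ^+ a * Y%:~R)))); last by rewrite add0r.
      ring.
    by rewrite /t; ring.
  apply: (congMIl (u := 8 * (-1) ^+ (3 * L).+1)).
    by apply: zpuM => //; exact: sgn_zpu.
  apply: (cong_congr c2) => //.
  rewrite yE !(rmorphM, rmorphXn, rmorphN1) /= exprD.
  rewrite (@signr_parity (3 * L).+1 L.+1); last by clear; lia.
  rewrite exprSr.
  have -> : 8 * ((-1) ^+ L * -1) * (-2 * ((-1) ^+ L * (-1) ^+ a * Y%:~R)) =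
    16 * ((-1) ^+ L * (-1) ^+ L) * (-1) ^+ a * Y%:~R :> rat by ring.
  by rewrite signr_sqr mulr1.
have pR2 : p%:R = X%:~R ^+ 2 + 2 * y%:~R ^+ 2 :> rat.
  have := congr1 (fun z : int => z%:~R : rat) XY.
  by rewrite -yY !(rmorphD, rmorphM, rmorphXn) /= -pmulrn.
have Vroot : cong p 3 (4 * (V ^+ 2) ^+ 2 + (4 * p%:R - 16 * y%:~R ^+ 2) * V ^+ 2 + p%:R ^+ 2) 0.
  have tt : t ^+ 2 = T ^+ 2.
    have -> : t ^+ 2 = ((-1) ^+ (3 * L).+1 * (-1) ^+ (3 * L).+1) * T ^+ 2 by rewrite /t; ring.
    by rewrite signr_sqr mul1r.
  have Xz : X%:~R \in zp p by exact: zp_int.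
  have fz : t ^+ 2 + 2 * X%:~R * t + p%:R \in zp p.
    exact: zpD (zpD (zpX 2 tz) (zpM (zpM (zp_nat p 2) Xz) tz)) (zp_nat p p).
  have h := congMl fz root; rewrite mulr0 in h.
  have {}h : cong p 3 ((T ^+ 2) ^+ 2 + (2 * p%:R - 4 * X%:~R ^+ 2) * T ^+ 2 + p%:R ^+ 2) 0.
    by apply: (cong_congr h) => //; rewrite -tt; ring.
  have T2z : T ^+ 2 \in zp p by rewrite rpredX.
  have V2z : -2 * V ^+ 2 \in zp p by rewrite rpredM ?rpredN ?rpredX ?zp_nat.
  have cz : 2 * p%:R - 4 * X%:~R ^+ 2 \in zp p by rewrite rpredB ?rpredM ?rpredX ?zp_nat.
  have c1 := congX p_pr 2 T2z V2z TV2.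
  have c2 := congMl cz TV2.
  have c3 := cong_trans (cong_sym (congD (congD c1 c2) (cong_refl p 3 (p%:R ^+ 2)))) h.
  by apply: (cong_congr c3) => //; rewrite pR2; ring.
have [vz Vv] := quartic_root_expansion yu Vz V1 Vroot.
apply: (cong_pcongr p_pr); last exact: zpM (zp_nat p p) vz.
apply: (cong_trans S); apply: (cong_p p_pr).
have E : 8 * (1 / 8) * V = V by field.
by rewrite E.
Qed.
End Final.

(** * Teichmueller lifts and Jacobi sums *)

(* R plays the role of the Witt vectors of length 3 over k. *)
Record witt3 (p : nat) (k : finFieldType) (R : comNzRingType) := Witt3 {
  wproj : {rmorphism R -> k};
  wsec : k -> R;
  wsecK : cancel wsec wproj;
  wker : forall x, wproj x = 0 -> exists y, x = p%:R * y;
  wp3 : p%:R ^+ 3 = 0 :> R;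
  wchar : forall n : nat, n%:R = 0 :> R -> (p ^ 3 %| n)%N;
  wfrob : forall x : k, x ^+ (p ^ 2) = x
}.

Section Teichmuller.
Variables (p : nat) (p_pr : prime p) (p_odd : odd p) (k : finFieldType) (R : comNzRingType).
Variable W : witt3 p k R.
Notation pr := (wproj W).

Lemma wproj_p : p%:R = 0 :> k.
Proof.
have : pr (p%:R ^+ 3) = 0 by rewrite (wp3 W) rmorph0.
by rewrite rmorphXn rmorph_nat => /eqP; rewrite expf_eq0 => /andP[_ /eqP].
Qed.

Lemma wproj_eq x y : pr x = pr y -> exists z, x = y + p%:R * z.
Proof.
move=> xy; have [|z zE] := @wker _ _ _ W (x - y); first by rewrite rmorphB xy subrr.
by exists z; rewrite -zE addrC subrK.
Qed.

(** Each p-th power raises the order of the difference by one factor p: u^p - v^p is u - v times a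
    sum of p terms with equal residues. *)
Lemma wpow_p2 x y : pr x = pr y -> x ^+ (p ^ 2) = y ^+ (p ^ 2).
Proof.
move=> xy.
have step u v w i : pr u = pr v -> u - v = p%:R ^+ i * w ->
    exists w', u ^+ p - v ^+ p = p%:R ^+ i.+1 * w'.
  move=> uv E; have [|z zE] := @wker _ _ _ W (\sum_(j < p) u ^+ (p.-1 - j) * v ^+ j).
    rewrite rmorph_sum /= (eq_bigr (fun=> pr v ^+ p.-1)).
      by rewrite sumr_const card_ord -mulr_natr wproj_p mulr0.
    move=> j _; rewrite rmorphM !rmorphXn uv -exprD subnK //.
    by rewrite -ltnS prednK ?prime_gt0.
  by exists (w * z); rewrite subrXX zE E exprSr; ring.
have [z zE] := wproj_eq xy.
have [|w1 E1] := @step x y z 1%N xy; first by rewrite zE addrC addKr expr1.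
have xyp : pr (x ^+ p) = pr (y ^+ p) by rewrite !rmorphXn xy.
have [w2 E2] := step _ _ _ _ xyp E1.
apply/eqP; rewrite -subr_eq0 -!mulnn !exprM E2.
by rewrite (wp3 W) mul0r.
Qed.

(** The exponent serves twice: raising to the power p^2 removes the dependence on the chosen lift,
    as p^3 = 0 in R, and it fixes the residue, as k is contained in the field with p^2 elements. *)
Definition teichmuller (x : k) : R := wsec W x ^+ (p ^ 2).

Lemma teich_proj z : teichmuller (pr z) = z ^+ (p ^ 2).
Proof. by apply: wpow_p2; rewrite (wsecK W). Qed.
Lemma wproj_teich x : pr (teichmuller x) = x.
Proof. by rewrite /teichmuller rmorphXn (wsecK W) (wfrob W). Qed.
Lemma teichM x y : teichmuller (x * y) = teichmuller x * teichmuller y.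
Proof. by rewrite -exprMn; apply: wpow_p2; rewrite rmorphM !(wsecK W). Qed.
Lemma teich1 : teichmuller 1 = 1.
Proof. by rewrite -[1 in LHS](rmorph1 pr) teich_proj expr1n. Qed.
Lemma teich0 : teichmuller 0 = 0.
Proof. by rewrite -[0 in LHS](rmorph0 pr) teich_proj expr0n expn_eq0 eqn0Ngt prime_gt0. Qed.
Lemma teichX x n : teichmuller (x ^+ n) = teichmuller x ^+ n.
Proof. by elim: n => [|n IH]; rewrite ?teich1 // !exprS teichM IH. Qed.
Lemma teichN x : teichmuller (- x) = - teichmuller x.
Proof.
have tN1 : teichmuller (- 1) = - 1.
  by rewrite -(rmorphN1 pr) teich_proj -signr_odd oddX p_odd expr1.
by rewrite -mulN1r teichM tN1 mulN1r.
Qed.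
Lemma wunit z : pr z != 0 -> exists y, z * y = 1.
Proof.
move=> z0; exists (z ^+ (p ^ 2).-1 * teichmuller (pr z)^-1).
rewrite mulrA -exprS prednK ?expn_gt0 ?prime_gt0 // -teich_proj -teichM.
by rewrite divff // teich1.
Qed.
Lemma wmulI z x : pr z != 0 -> z * x = 0 -> x = 0.
Proof. by move=> /wunit[y yE] zx; rewrite -[x]mul1r -yE mulrAC zx mul0r. Qed.

Lemma wchar_int (n : int) : n%:~R = 0 :> R -> (p%:Z ^+ 3 %| n)%Z.
Proof.
have -> : p%:Z ^+ 3 = (p ^ 3)%N by rewrite !exprS expr0 mulr1 !expnS expn0 muln1.
move=> n0; rewrite dvdzE; apply: (wchar W).
case: n n0 => n n0 //=; move: n0; rewrite NegzE rmorphN /= => /eqP.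
by rewrite oppr_eq0 => /eqP.
Qed.

Lemma wchar_mod (n : int) : n%:~R = 0 :> k -> (p%:Z %| n)%Z.
Proof.
move=> n0; have : pr n%:~R = 0 by rewrite rmorph_int.
move=> /(@wker _ _ _ W)[y yE].
have : (p%:Z ^+ 3 %| p%:Z ^+ 2 * n)%Z.
  by apply: wchar_int; rewrite rmorphM rmorphXn /= yE -pmulrn mulrA -exprSr (wp3 W) mul0r.
rewrite (exprSr _ 2) dvdz_mul2l // expf_neq0 //.
by have := prime_gt0 p_pr; case: (p).
Qed.

(* For w = y ^ ((p^3 - 1) / 2) one has w^2 y = 1 and
   8 w^5 - 15 w^4 + 10 w^2 - 3 = (w - 1)^3 (8 w^2 + 9 w + 3) = 0: this is the
   quadratic extrapolation of m |-> y ^ m from m = 0, 1, 2 to m = -1/2. *)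
Lemma extrapolate_half y : pr y = 1 ->
  8 * y ^+ ((p ^ 3).-1)./2 = 15 - 10 * y + 3 * y ^+ 2.
Proof.
move=> y1; set w := y ^+ _.
have w1 : pr w = 1 by rewrite rmorphXn y1 expr1n.
have wy : w ^+ 2 * y = 1.
  rewrite -exprM -exprSr muln2.
  have -> : (((p ^ 3).-1)./2.*2.+1 = p ^ 2 * p)%N.
    rewrite -expnSr; have : odd (p ^ 3) by rewrite oddX p_odd.
    have : (0 < p ^ 3)%N by rewrite expn_gt0 prime_gt0.
    by clear; move: (p ^ 3)%N => q; lia.
  by rewrite exprM -teich_proj y1 teich1 expr1n.
have [z zE] : exists z, w = 1 + p%:R * z by apply: wproj_eq; rewrite w1 rmorph1.
have h : 8 * w ^+ 5 = 15 * w ^+ 4 - 10 * w ^+ 2 + 3.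
  apply/eqP; rewrite -subr_eq0; apply/eqP.
  have -> : 8 * w ^+ 5 - (15 * w ^+ 4 - 10 * w ^+ 2 + 3) = (w - 1) ^+ 3 * (8 * w ^+ 2 + 9 * w + 3) by ring.
  by rewrite zE addrC addKr exprMn (wp3 W) !mul0r.
have -> : 8 * w = 8 * w ^+ 5 * y ^+ 2.
  by rewrite [in LHS](_ : w = w * (w ^+ 2 * y) ^+ 2); [ring | rewrite wy expr1n mulr1].
rewrite h; have -> : (15 * w ^+ 4 - 10 * w ^+ 2 + 3) * y ^+ 2 =
  15 * (w ^+ 2 * y) ^+ 2 - 10 * (w ^+ 2 * y) * y + 3 * y ^+ 2 by ring.
by rewrite wy expr1n !mulr1.
Qed.
End Teichmuller.

(** * Sums over roots of unity and their extrapolation *)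

Section RootSums.
Variables (p : nat) (p_pr : prime p) (p_odd : odd p) (k : finFieldType) (R : comNzRingType).
Variable W : witt3 p k R.
Notation pr := (wproj W).
Notation teich := (teichmuller W).
Variables (M : nat).
Definition mu : {set k} := [set u : k | u ^+ M == 1].
Hypotheses (M_gt0 : (0 < M)%N) (card_mu : #|mu| = M).

Lemma muP u : (u \in mu) = (u ^+ M == 1). Proof. by rewrite inE. Qed.
Lemma mu_neq0 u : u \in mu -> u != 0.
Proof.
by rewrite muP; apply: contraTneq => ->; rewrite expr0n gtn_eqF //= eq_sym oner_eq0.
Qed.
Lemma mu1 : 1 \in mu. Proof. by rewrite muP expr1n. Qed.

Lemma card_unity_roots (A : {set k}) j (c : k) : (0 < j)%N ->
  {in A, forall u, u ^+ j = c} -> (#|A| <= j)%N.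
Proof.
move=> j0 Ac; have pn0 : 'X^j - c%:P != 0 :> {poly k} by rewrite -size_poly_eq0 size_XnsubC.
have := @max_poly_roots _ ('X^j - c%:P) (enum A) pn0.
rewrite size_XnsubC // ltnS -cardE; apply; last exact: enum_uniq.
apply/allP => u; rewrite mem_enum => uA.
by rewrite rootE !hornerE Ac // subrr.
Qed.

Lemma mu_nontrivial j : ~~ (M %| j)%N -> exists2 g, g \in mu & g ^+ j != 1.
Proof.
move=> Mj; have [/existsP[g /andP[]]|] := boolP [exists g, (g \in mu) && (g ^+ j != 1)].
  by exists g.
rewrite negb_exists => /forallP all1.
have /card_unity_roots : {in mu, forall u, u ^+ (j %% M) = 1}.
  move=> u um; have := all1 u; rewrite um /= negbK {1}(divn_eq j M) exprD mulnC exprM.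
  by move: um; rewrite muP => /eqP->; rewrite expr1n mul1r => /eqP.
rewrite card_mu lt0n -/(dvdn M j) => /(_ Mj).
by rewrite leqNgt ltn_mod M_gt0.
Qed.

Lemma mu_sum j : \sum_(u in mu) teich u ^+ j = if (M %| j)%N then M%:R else 0.
Proof.
case: ifPn => [/dvdnP[t ->] | /mu_nontrivial[g gm gj]].
  rewrite (eq_bigr (fun=> 1)) ?sumr_const ?card_mu // => u.
  by rewrite muP => /eqP um; rewrite -[LHS]teichX // mulnC exprM um expr1n teich1.
have g0 := mu_neq0 gm.
apply: (@wmulI _ p_pr _ _ W (teich g ^+ j - 1)).
  by rewrite rmorphB rmorphXn rmorph1 wproj_teich subr_eq0.
rewrite mulrBl mul1r; apply/eqP; rewrite subr_eq0; apply/eqP.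
rewrite mulr_sumr [RHS](reindex_inj (mulfI g0)) /=.
apply: eq_big => u; last by move=> _; rewrite (teichM p_pr) exprMn.
by rewrite !muP exprMn; move: gm; rewrite muP => /eqP->; rewrite mul1r.
Qed.

Lemma sum_residues (n e : nat) (F : nat -> R) (s : seq nat) : uniq s ->
  {in s, forall i, (i < n)%N} -> (forall i, (i < n)%N -> (M %| e + i)%N = (i \in s)) ->
  \sum_(i < n) F i * (if (M %| e + i)%N then M%:R else 0) = M%:R * \sum_(i <- s) F i.
Proof.
move=> us sn sM; rewrite mulr_sumr.
rewrite (eq_bigr (fun i : 'I_n => if (i : nat) \in s then M%:R * F i else 0)); last first.
  by move=> i _; rewrite sM //; case: ifP => _; rewrite ?mulr0 // mulrC.
rewrite -big_mkcond -(big_mkord (mem s) (fun i => M%:R * F i)) -big_filter.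
apply: perm_big; apply: uniq_perm => //; first by rewrite filter_uniq ?iota_uniq.
move=> i; rewrite mem_filter mem_index_iota /=.
by apply/andP/idP => [[]|si] //; split=> //; apply: sn.
Qed.

(** Orthogonality keeps the terms of the binomial expansion whose exponent is divisible by M. The
    index range is allowed to reach B + 1, where the coefficient is zero: for p = 11 the index 2p +
    K equals 5N + 1, and the list can be uniform in p. *)
Lemma mu_binomial_sum (e B : nat) (s : seq nat) : uniq s ->
  {in s, forall i, (i < B.+2)%N} -> (forall i, (i < B.+2)%N -> (M %| e + i)%N = (i \in s)) ->
  \sum_(u in mu) teich u ^+ e * (1 - teich u) ^+ B =
  M%:R * \sum_(i <- s) (-1) ^+ i * 'C(B, i)%:R.
Proof.
move=> us sn sM.
rewrite -(sum_residues (e := e) (fun i => (-1) ^+ i * 'C(B, i)%:R) us sn sM).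
under eq_bigr => u _ do rewrite exprBn mulr_sumr.
rewrite exchange_big /= [RHS]big_ord_recr /= bin_small // mulr0 mul0r addr0.
apply: eq_bigr => i _; rewrite -mu_sum mulr_sumr; apply: eq_bigr => u _.
by rewrite expr1n mulr1 exprD -mulr_natr; ring.
Qed.

Variables (N K : nat) (pN : p = N.*2.+1) (KM : (K <= M)%N) (v : k -> k).
Hypothesis vE : forall u, u \in mu -> u != 1 -> v u * (1 - u) ^+ N.*2 = 1.

(** On the M-th roots of unity u^(M - K) is u^-K; the natural exponent allows binomial expansion. *)
Definition jacobi_term (u : k) : k := u ^+ (M - K) * (1 - u) ^+ N.

Let N_gt0 : (0 < N)%N.
Proof. by have := prime_gt1 p_pr; rewrite pN; case: (N). Qed.

Lemma phi1 : jacobi_term 1 = 0.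
Proof. by rewrite /jacobi_term subrr expr0n gtn_eqF // mulr0. Qed.

Lemma phi_extrapolate : 8 * \sum_(u in mu) teich (jacobi_term u) =
  \sum_(u in mu) teich u ^+ (M - K) * (15 * (1 - teich u) ^+ N
    - 10 * (teich (v u) * (1 - teich u) ^+ (3 * N))
    + 3 * (teich (v u) ^+ 2 * (1 - teich u) ^+ (5 * N))).
Proof.
rewrite mulr_sumr; apply: eq_bigr => u um.
have [->|u1] := eqVneq u 1.
  rewrite phi1 (teich0 p_pr) (teich1 p_pr) subrr !expr0n !muln_eq0 (gtn_eqF N_gt0) /=.
  by rewrite !mulr0 subrr addr0 mulr0.
set z := 1 - teich u.
have zp : pr z = 1 - u by rewrite rmorphB rmorph1 wproj_teich.
pose y := teich (v u) * z ^+ N.*2.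
have y1 : pr y = 1 by rewrite rmorphM wproj_teich rmorphXn zp vE.
have := extrapolate_half p_pr p_odd y1; set m0 := _./2 => ext.
have m0E : (m0.*2.+1 = p ^ 2 * p)%N.
  rewrite -expnSr /m0; have : odd (p ^ 3) by rewrite oddX p_odd.
  have : (0 < p ^ 3)%N by rewrite expn_gt0 prime_gt0.
  by clear; move: (p ^ 3)%N => q; lia.
(* The exponent of z is N + 2N m0 = N p^3, so the left side is a Teichmueller representative, and
   its residue identifies it. *)
have zw : z ^+ N * y ^+ m0 = teich ((1 - u) ^+ N).
  have -> : z ^+ N * y ^+ m0 = teich (v u) ^+ m0 * (z ^+ (p ^ 2)) ^+ (p * N).
    rewrite /y exprMn -!exprM mulrCA -exprD; congr (_ * _ ^+ _).
    by rewrite mulnA -m0E; clear; move: m0 => m; nia.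
  rewrite -(teich_proj p_pr W) zp -!(teichX p_pr) -(teichM p_pr); congr (teich _).
  rewrite -[in LHS](wfrob W (1 - u)) -exprM mulnA -m0E.
  have -> : (m0.*2.+1 * N = N.*2 * m0 + N)%N by clear; move: m0 => m; nia.
  by rewrite exprD exprM mulrA -exprMn vE // expr1n mul1r.
have -> : teich (jacobi_term u) = teich u ^+ (M - K) * (z ^+ N * y ^+ m0).
  by rewrite zw /jacobi_term (teichM p_pr) (teichX p_pr).
have -> : 8 * (teich u ^+ (M - K) * (z ^+ N * y ^+ m0)) =
  teich u ^+ (M - K) * z ^+ N * (8 * y ^+ m0) by ring.
rewrite ext -mulrA; congr (_ * _).
have -> : (3 * N = N + N.*2)%N by clear; lia.
have -> : (5 * N = N + (N.*2 + N.*2))%N by clear; lia.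
by rewrite !exprD /y; ring.
Qed.
End RootSums.

Section Extrapolated.
Variables (p : nat) (p_pr : prime p) (p_odd : odd p) (k : finFieldType) (R : comNzRingType).
Variable W : witt3 p k R.
Notation teich := (teichmuller W).
Variables (N K L : nat) (pN : p = N.*2.+1) (NKL : N = (K + L)%N) (K0 : (0 < K)%N) (L0 : (0 < L)%N).

Let odd_even i : (-1) ^+ i.*2 = 1 :> R.
Proof. by rewrite -mul2n exprM sqrrN !expr1n. Qed.

Lemma phi_sum_split : #|mu k N.*2| = N.*2 ->
  (forall u : k, u \in mu k N.*2 -> u != 1 -> (1 - u) ^+ N.*2 = 1) ->
  8 * \sum_(u in mu k N.*2) teich (jacobi_term N.*2 N K u) = (ext_split p N K L)%:~R.
Proof.
move=> cM v1; have M0 : (0 < N.*2)%N by clear -NKL K0; lia.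
rewrite (phi_extrapolate p_pr p_odd W K pN (v := fun=> 1)); last first.
  by move=> u um u1; rewrite mul1r v1.
rewrite (teich1 p_pr) expr1n.
under eq_bigr => u _ do rewrite mulrDr mulrBr !mul1r ![_ * (_%:R * _)]mulrCA.
rewrite !(big_split, sumrN) /= -!mulr_sumr.
rewrite (mu_binomial_sum p_pr W M0 cM (s := [:: K])) //; first last.
- by move=> i iN; rewrite inE; clear -iN NKL K0 L0; apply/idP/eqP => [/dvdnP[[|[|t]] tE]|->]; [lia|lia|nia|apply/dvdnP; exists 1%N; lia].
- by move=> i; rewrite inE => /eqP->; clear -NKL; lia.
rewrite (mu_binomial_sum p_pr W M0 cM (s := [:: K; K + 2 * N])) //; first last.
- move=> i iN; rewrite !inE; clear -iN NKL K0 L0.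
  apply/idP/orP => [/dvdnP[[|[|[|t]]] tE]|[/eqP->|/eqP->]]; try (by lia); try (by exfalso; nia);
    by apply/dvdnP; first [exists 1%N; lia | exists 2%N; lia | exists 3%N; lia].
- by move=> i; rewrite !inE => /orP[/eqP->|/eqP->]; clear -NKL L0; lia.
- by rewrite /= inE; clear -NKL K0; lia.
rewrite (mu_binomial_sum p_pr W M0 cM (s := [:: K; K + 2 * N; K + 4 * N])) //; first last.
- move=> i iN; rewrite !inE; clear -iN NKL K0 L0.
  apply/idP/idP => [/dvdnP[[|[|[|[|t]]]] tE]|/or3P[/eqP->|/eqP->|/eqP->]]; try (by lia); try (by exfalso; nia);
    by apply/dvdnP; first [exists 1%N; lia | exists 2%N; lia | exists 3%N; lia].
- by move=> i; rewrite !inE => /or3P[/eqP->|/eqP->|/eqP->]; clear -NKL L0; lia.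
- by rewrite /= !inE; clear -NKL K0; lia.
rewrite !big_cons !big_nil !addr0.
have s2 : (-1) ^+ (K + 2 * N) = (-1) ^+ K :> R by rewrite mul2n exprD odd_even mulr1.
have s4 : (-1) ^+ (K + 4 * N) = (-1) ^+ K :> R.
  by rewrite (_ : (4 * N)%N = (2 * N).*2) ?exprD ?odd_even ?mulr1 //; clear; lia.
have C1 : 'C(3 * N, K + 2 * N) = 'C(3 * N, L).
  by rewrite -bin_sub; [congr 'C(_, _) |]; clear -NKL; lia.
have C2 : 'C(5 * N, K + 4 * N) = 'C(5 * N, L).
  by rewrite -bin_sub; [congr 'C(_, _) |]; clear -NKL; lia.
rewrite s2 s4 C1 C2 /ext_split.
have -> : (N.*2)%:R = p%:R - 1 :> R by rewrite pN -natr1 addrK.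
rewrite !(rmorphD, rmorphB, rmorphM, rmorphXn, rmorphN, rmorph1, rmorph_nat) /= -!pmulrn.
ring.
Qed.

(** Each factor v(u) = -u shifts the exponent of u by one, which moves the surviving indices to K -
    1, p + K and then K - 2, K + 2N, 2p + K. At the two odd shifts the sign is opposite to (-1)^K,
    which restores the coefficient -10. *)
Lemma phi_sum_inert : K = (3 * L).+1 -> #|mu k p.+1| = p.+1 ->
  (forall u : k, u \in mu k p.+1 -> u != 1 -> - u * (1 - u) ^+ N.*2 = 1) ->
  8 * \sum_(u in mu k p.+1) teich (jacobi_term p.+1 N K u) = (ext_inert p N K)%:~R.
Proof.
move=> KL cM v1; have M0 : (0 < p.+1)%N by [].
rewrite (phi_extrapolate p_pr p_odd W K pN (v := fun u => - u)) //.
have E u : teich u ^+ (p.+1 - K) * (15 * (1 - teich u) ^+ N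
   - 10 * (teich (- u) * (1 - teich u) ^+ (3 * N))
   + 3 * (teich (- u) ^+ 2 * (1 - teich u) ^+ (5 * N))) =
   15 * (teich u ^+ (p.+1 - K) * (1 - teich u) ^+ N)
   + 10 * (teich u ^+ (p.+1 - K).+1 * (1 - teich u) ^+ (3 * N))
   + 3 * (teich u ^+ (p.+1 - K).+2 * (1 - teich u) ^+ (5 * N)).
  by rewrite (teichN p_pr p_odd) !exprS; ring.
under eq_bigr => u _ do rewrite E.
rewrite !big_split /= -!mulr_sumr.
rewrite (mu_binomial_sum p_pr W M0 cM (s := [:: K])) //; first last.
- move=> i iN; rewrite inE; clear -iN NKL KL K0 L0 pN.
  by apply/idP/eqP => [/dvdnP[[|[|t]] tE]|->]; [lia|lia|nia|apply/dvdnP; exists 1%N; lia].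
- by move=> i; rewrite inE => /eqP->; clear -NKL; lia.
rewrite (mu_binomial_sum p_pr W M0 cM (s := [:: K.-1; p + K]%N)) //; first last.
- move=> i iN; rewrite !inE; clear -iN NKL KL K0 L0 pN.
  apply/idP/orP => [/dvdnP[[|[|[|t]]] tE]|[/eqP->|/eqP->]]; try (by lia); try (by exfalso; nia);
    by apply/dvdnP; first [exists 1%N; lia | exists 2%N; lia | exists 3%N; lia].
- by move=> i; rewrite !inE => /orP[/eqP->|/eqP->]; clear -NKL KL L0 pN; lia.
- by rewrite /= inE; clear -NKL K0 pN; lia.
rewrite (mu_binomial_sum p_pr W M0 cM (s := [:: K.-2; K + 2 * N; 2 * p + K]%N)) //; first last.
- move=> i iN; rewrite !inE; clear -iN NKL KL K0 L0 pN.
  apply/idP/idP => [/dvdnP[[|[|[|[|t]]]] tE]|/or3P[/eqP->|/eqP->|/eqP->]]; try (by lia); try (by exfalso; nia);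
    by apply/dvdnP; first [exists 1%N; lia | exists 2%N; lia | exists 3%N; lia].
- by move=> i; rewrite !inE => /or3P[/eqP->|/eqP->|/eqP->]; clear -NKL KL L0 pN; lia.
- by rewrite /= !inE; clear -NKL KL L0 pN; lia.
rewrite !big_cons !big_nil !addr0.
have sg i j : (i + j = (i + j)./2.*2)%N -> (-1) ^+ i = (-1) ^+ j :> R.
  move=> ij; have -> : (-1) ^+ i = (-1) ^+ (i + j) * (-1) ^+ j :> R.
    by rewrite -exprD -addnA addnn exprD odd_even mulr1.
  by rewrite ij odd_even mul1r.
have s1 : (-1) ^+ K.-1 = - (-1) ^+ K :> R by rewrite KL /= exprS mulN1r opprK.
have s2 : (-1) ^+ (p + K) = - (-1) ^+ K :> R.
  by rewrite pN addSn exprS exprD odd_even mul1r mulN1r.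
have s3 : (-1) ^+ K.-2 = (-1) ^+ K :> R by apply: sg; clear -KL L0; lia.
have s4 : (-1) ^+ (K + 2 * N) = (-1) ^+ K :> R by apply: sg; clear; lia.
have s5 : (-1) ^+ (2 * p + K) = (-1) ^+ K :> R by apply: sg; clear; lia.
rewrite s1 s2 s3 s4 s5 /ext_inert.
have -> : (p.+1)%:R = p%:R + 1 :> R by rewrite natr1.
rewrite !(rmorphD, rmorphB, rmorphM, rmorphXn, rmorphN, rmorph1, rmorph_nat) /= -!pmulrn.
ring.
Qed.
End Extrapolated.

(** * The norm of the Jacobi sum *)

Section Norm.
Variables (p : nat) (p_pr : prime p) (p_odd : odd p) (k : finFieldType) (R : comNzRingType).
Variable W : witt3 p k R.
Notation teich := (teichmuller W).
Variables (M : nat) (M_gt0 : (0 < M)%N) (card_mu : #|mu k M| = M).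
Variables (N K : nat) (N_gt0 : (0 < N)%N).
Notation mu := (mu k M).
Notation phi := (jacobi_term M N K : k -> k).

Definition moebius (w v : k) := (1 - w * v) / (1 - v).

Lemma moebius_inj w : w != 1 -> {in mu :\ 1 &, injective (moebius w)}.
Proof.
move=> w1 u v; rewrite !in_setD1 => /andP[u1 _] /andP[v1 _].
have u0 : 1 - u != 0 by rewrite subr_eq0 eq_sym.
have v0 : 1 - v != 0 by rewrite subr_eq0 eq_sym.
move=> /eqP; rewrite /moebius eqr_div // => /eqP E; apply/eqP; rewrite -subr_eq0.
have : (u - v) * (1 - w) == 0.
  have -> : (u - v) * (1 - w) = (1 - w * u) * (1 - v) - (1 - w * v) * (1 - u) by ring.
  by rewrite E subrr.
by rewrite mulf_eq0 [1 - w == 0]subr_eq0 [1 == w]eq_sym (negPf w1) orbF.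
Qed.

(** Substitute u = w v in the double sum: phi(w v) / phi(v) = w^-K ((1 - w v) / (1 - v))^N. The
    excluded v = 1 contributes 0 since phi(1) = 0 and 0 is its own inverse by convention. *)
Lemma norm_sum : (\sum_(u in mu) teich (phi u)) * (\sum_(u in mu) teich (phi u)^-1) =
  \sum_(w in mu) teich w ^+ (M - K) * \sum_(v in mu :\ 1) teich (moebius w v) ^+ N.
Proof.
rewrite mulr_sumr.
transitivity (\sum_(v in mu) \sum_(w in mu) teich w ^+ (M - K) *
   (if v == 1 then 0 else teich (moebius w v) ^+ N)).
  apply: eq_bigr => v vm; have v0 := mu_neq0 M_gt0 vm.
  rewrite mulr_suml (reindex_inj (mulIf v0)) /=.
  apply: eq_big => [w|w wm].
    by rewrite !muP exprMn; move: vm; rewrite muP => /eqP->; rewrite mulr1.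
  rewrite -(teichM p_pr).
  case: eqP => [->|/eqP v1]; first by rewrite [jacobi_term _ _ _ 1]/jacobi_term subrr expr0n (gtn_eqF N_gt0) mulr0 invr0 mulr0 (teich0 p_pr) mulr0.
  rewrite -!(teichX p_pr) -(teichM p_pr); congr (teichmuller W _).
  have v1' : 1 - v != 0 by rewrite subr_eq0 eq_sym.
  rewrite /jacobi_term /moebius invfM !expr_div_n !exprMn; field.
  by rewrite !expf_neq0.
rewrite exchange_big /=; apply: eq_bigr => w _; rewrite -mulr_sumr; congr (_ * _).
rewrite (bigD1 1) ?mu1 //= eqxx add0r.
apply: eq_big => [v|v /andP[_ /negPf->] //]; by rewrite in_setD1 andbC.
Qed.

Lemma moebius_sum1 : \sum_(v in mu :\ 1) teich (moebius 1 v) ^+ N = (M.-1)%:R.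
Proof.
rewrite (eq_bigr (fun=> 1)) ?sumr_const.
  by rewrite -[X in X.-1]card_mu (cardsD1 1 mu) mu1.
move=> v; rewrite in_setD1 => /andP[v1 _].
by rewrite /moebius mul1r divff ?subr_eq0 1?eq_sym // (teich1 p_pr) expr1n.
Qed.

(** The Moebius map sends 0, 1, infinity to 1, infinity, w, so for w other than 1 the inner sum is a
    complete character sum, which is 0, without its terms at 1 and w. *)
Lemma norm_split : #|k| = p -> p = M.+1 -> M = N.*2 -> (0 < K < N)%N ->
  (\sum_(u in mu) teich (phi u)) * (\sum_(u in mu) teich (phi u)^-1) = p%:R.
Proof.
move=> cardk pM MN KN.
have S w : w \in mu -> w != 1 ->
    \sum_(v in mu :\ 1) teich (moebius w v) ^+ N = - 1 - teich w ^+ N.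
  move=> wm w1.
  rewrite -(big_imset (fun m => teich m ^+ N) (moebius_inj w1)) /=.
  have -> : moebius w @: (mu :\ 1) = [set~ 1] :\ w.
    apply/eqP; rewrite eqEcard; apply/andP; split.
      apply/subsetP => m /imsetP[v]; rewrite in_setD1 => /andP[v1 vm] ->.
      have v0 : 1 - v != 0 by rewrite subr_eq0 eq_sym.
      have vn0 := mu_neq0 M_gt0 vm.
      rewrite !inE; apply/andP; split; rewrite /moebius -subr_eq0.
        rewrite (_ : _ - _ = (1 - w) / (1 - v)); last by field.
        by rewrite mulf_neq0 ?invr_eq0 // subr_eq0 eq_sym.
      rewrite (_ : _ - _ = v * (1 - w) / (1 - v)); last by field.
      by rewrite !mulf_neq0 ?invr_eq0 // subr_eq0 eq_sym.
    rewrite card_in_imset; last exact: moebius_inj.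
    have c1 : M = #|mu :\ 1|.+1 by rewrite -[LHS]card_mu (cardsD1 1 mu) mu1.
    have c2 : M = #|[set~ 1] :\ w|.+1.
      have := cardsC1 (1 : k); rewrite cardk pM /= (cardsD1 w) !inE w1 add1n => ->.
      by [].
    by rewrite -ltnS -c1 -c2.
  have tot : \sum_(m : k) teich m ^+ N = 0.
    have tmu : \sum_(u in mu) teich u ^+ N = 0.
      by rewrite (mu_sum p_pr W M_gt0 card_mu) gtnNdvd // MN; clear -N_gt0; lia.
    rewrite (bigD1 0) //= (teich0 p_pr) expr0n gtn_eqF // add0r -[RHS]tmu.
    apply: eq_bigl => u; apply/idP/idP => [u0|/(mu_neq0 M_gt0) //].
    have : [set~ (0 : k)] == mu.
      rewrite eq_sym eqEcard; apply/andP; split.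
        by apply/subsetP => x xm; rewrite !inE (mu_neq0 M_gt0 xm).
      by rewrite cardsC1 cardk pM card_mu.
    by move=> /eqP <-; rewrite !inE.
  move: tot; rewrite (bigD1 1) //= (bigD1 w) //= (teich1 p_pr) expr1n => /eqP.
  rewrite addrA addrC addr_eq0 => /eqP.
  rewrite (eq_bigl (fun m => m \in [set~ 1] :\ w)) => [->|m]; last by rewrite !inE andbC.
  by rewrite opprD.
rewrite norm_sum (bigD1 1) ?mu1 //= moebius_sum1 (teich1 p_pr) expr1n mul1r.
rewrite (eq_bigr (fun w => - (teich w ^+ (M - K)) - teich w ^+ (M - K + N))); last first.
  by move=> w /andP[wm w1]; rewrite S // exprD; ring.
have S1 j : ~~ (M %| j)%N -> \sum_(w in mu | w != 1) teich w ^+ j = - 1.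
  move=> Mj; have := mu_sum p_pr W M_gt0 card_mu j.
  rewrite (negPf Mj) (bigD1 1) ?mu1 //= (teich1 p_pr) expr1n addrC => /eqP.
  by rewrite addr_eq0 => /eqP.
rewrite big_split /= !sumrN !S1; first last.
- by rewrite gtnNdvd; clear -MN KN; lia.
- have -> : (M - K + N = M + (N - K))%N by clear -MN KN; lia.
  by rewrite dvdn_addr // gtnNdvd; clear -MN KN; lia.
rewrite opprK pM -(natr1 M) -[in RHS](prednK M_gt0) -natr1; ring.
Qed.

(** For w other than 1 the Moebius map takes the elements of norm 1 other than 1 onto the F_p-line
    m^p = w^-1 m. This line is stable under negation and N is odd, so the inner sum vanishes and
    only w = 1 contributes. *)
Lemma norm_inert : odd N -> M = p.+1 ->
  (\sum_(u in mu) teich (phi u)) * (\sum_(u in mu) teich (phi u)^-1) = p%:R.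
Proof.
move=> oN Mp.
have chk : p \in [pchar k] by rewrite inE p_pr /= (wproj_p W).
have frobB (x y : k) : (x - y) ^+ p = x ^+ p - y ^+ p.
  exact: (rmorphB (pFrobenius_aut chk)).
have mup v : v \in mu -> v ^+ p = v^-1.
  move=> vm; have v0 := mu_neq0 M_gt0 vm; apply: (mulfI v0).
  by rewrite -exprS -Mp divff //; apply/eqP; rewrite -muP.
have S w : w \in mu -> w != 1 -> \sum_(v in mu :\ 1) teich (moebius w v) ^+ N = 0.
  move=> wm w1; have w0 := mu_neq0 M_gt0 wm.
  rewrite -(big_imset (fun m => teich m ^+ N) (moebius_inj w1)) /=.
  pose L := [set m : k | m ^+ p == w^-1 * m].
  have -> : moebius w @: (mu :\ 1) = L.
    apply/eqP; rewrite eqEcard; apply/andP; split.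
      apply/subsetP => m /imsetP[v]; rewrite in_setD1 => /andP[v1 vm] ->.
      have v0 := mu_neq0 M_gt0 vm.
      have v1' : 1 - v != 0 by rewrite subr_eq0 eq_sym.
      rewrite inE /moebius expr_div_n !frobB expr1n exprMn !mup //.
      have -> : 1 - v^-1 = - (1 - v) / v by field.
      by apply/eqP; field; rewrite v0 w0 v1' oppr_eq0.
    rewrite card_in_imset; last exact: moebius_inj.
    have -> : #|mu :\ 1| = p.
      by apply: succn_inj; rewrite -Mp -[RHS]card_mu (cardsD1 1 mu) mu1.
    have p1 := prime_gt1 p_pr.
    have sz : size ('X^p - w^-1 *: 'X : {poly k}) = p.+1.
      rewrite size_polyDl size_polyXn // size_polyN.
      by rewrite (leq_ltn_trans (size_scale_leq _ _)) // size_polyX.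
    have pn0 : 'X^p - w^-1 *: 'X != 0 :> {poly k} by rewrite -size_poly_eq0 sz.
    have := max_poly_roots (rs := enum L) pn0; rewrite sz ltnS -cardE; apply.
      apply/allP => m; rewrite mem_enum inE => /eqP mL.
      by rewrite rootE !hornerE mL subrr.
    exact: enum_uniq.
  have : \sum_(m in L) teich m ^+ N = - \sum_(m in L) teich m ^+ N.
    rewrite {1}(reindex_inj oppr_inj) /= -sumrN; apply: eq_big => m.
      rewrite !inE exprNn -signr_odd p_odd expr1 mulN1r mulrN eqr_opp //.
    by rewrite (teichN p_pr p_odd) exprNn -signr_odd oN expr1 mulN1r.
  move=> /eqP; rewrite -addr_eq0 => /eqP e.
  apply: (@wmulI _ p_pr _ _ W 2).
    rewrite rmorph_nat; apply/eqP => two0.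
    have : (2 \in [pchar k])%N by rewrite inE /= two0.
    by rewrite (pcharf_eq chk) inE => /eqP p2; move: p_odd; rewrite -p2.
  by rewrite mulr_natl mulr2n.
rewrite norm_sum (bigD1 1) ?mu1 //= moebius_sum1 (teich1 p_pr) expr1n mul1r.
rewrite big1 ?addr0; first by rewrite Mp.
by move=> w /andP[wm w1]; rewrite S // mulr0.
Qed.
End Norm.

(** * Functions with values among the eighth roots of unity *)

Section Octic.
Variables (p : nat) (p_pr : prime p) (p_odd : odd p) (k : finFieldType) (R : comNzRingType).
Variable W : witt3 p k R.
Notation teich := (teichmuller W).
Variables (A : {set k}) (f : k -> k) (z : k) (z4 : z ^+ 4 = - 1).
Hypothesis f8 : forall u, u \in A -> f u = 0 \/ f u ^+ 8 = 1.
Hypothesis fV : forall u, u \in A -> u^-1 \in A /\ f u^-1 = f u ^+ 3.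

Lemma two_neq0 : 2 != 0 :> k.
Proof.
apply/eqP => two0.
have chk : p \in [pchar k] by rewrite inE p_pr /= (wproj_p W).
have : (2 \in [pchar k])%N by rewrite inE /= two0.
by rewrite (pcharf_eq chk) inE => /eqP p2; move: p_odd; rewrite -p2.
Qed.

Lemma z_neq0 : z != 0.
Proof. by apply/eqP => z0; move: z4; rewrite z0 expr0n => /eqP; rewrite eq_sym oppr_eq0 oner_eq0. Qed.

Lemma z_prim : 8.-primitive_root z.
Proof.
have z8 : z ^+ 8 = 1 by rewrite (exprM z 4 2) z4 sqrrN expr1n.
have [m mz m8] := @prim_order_exists _ 8 z isT z8.
have mp := prim_order_dvd mz.
have n4 : ~~ (m %| 4)%N.
  rewrite mp z4 eq_sym -addr_eq0 -mulr2n; exact: two_neq0.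
have m8' : m = 8%N.
  have : (m <= 8)%N by apply: dvdn_leq.
  by move: m8 n4; clear; case: m => [|[|[|[|[|[|[|[|[|m]]]]]]]]].
by rewrite -m8'.
Qed.

Definition octic (j : nat) : nat := #|[set u in A | f u == z ^+ j]|.

Lemma octic_sum (S : nmodType) (G : k -> S) : G 0 = 0 ->
  \sum_(u in A) G (f u) = \sum_(j < 8) G (z ^+ j) *+ octic j.
Proof.
move=> G0.
have key u : u \in A -> G (f u) = \sum_(j < 8) (if f u == z ^+ j then G (z ^+ j) else 0).
  move=> uA; case: (f8 uA) => [fu | /(prim_rootP z_prim)[i fi]].
    rewrite fu G0 big1 // => j _; case: eqP => // z0.
    by have := expf_neq0 j z_neq0; rewrite -z0 eqxx.
  rewrite (bigD1 i) //= fi eqxx big1 ?addr0 // => j ji.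
  rewrite (eq_prim_root_expr z_prim) !modn_small //.
  by case: eqP => // e; move: ji; rewrite -val_eqE /= e eqxx.
rewrite (eq_bigr _ key) exchange_big /=; apply: eq_bigr => j _.
rewrite -big_mkcondr /= sumr_const /octic; congr (_ *+ _).
by apply: eq_card => u; rewrite !inE.
Qed.

Lemma octic_le j : (octic j <= octic (3 * j))%N.
Proof.
rewrite /octic -(card_imset _ (@invr_inj k)); apply: subset_leq_card; apply/subsetP => v.
move=> /imsetP[u]; rewrite !inE => /andP[uA /eqP fu] ->.
by have [-> ->] := fV uA; rewrite fu -exprM mulnC eqxx.
Qed.

Lemma octic_mod j : octic (j %% 8) = octic j.
Proof. by rewrite /octic (prim_expr_mod z_prim). Qed.

(** Inversion of u maps the fibre over z^j into the one over z^(3j); applied twice it returns to j,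
    as 9j = j modulo 8. *)
Lemma octic3 j : octic (3 * j) = octic j.
Proof.
apply/eqP; rewrite eqn_leq octic_le andbT.
apply: leq_trans (octic_le (3 * j)) _.
by rewrite -(octic_mod (3 * (3 * j))) mulnA -modnMml mul1n octic_mod.
Qed.

Let s := teich z + teich z ^+ 3.
Let X : int := (octic 0)%:Z - (octic 4)%:Z.
Let Y : int := (octic 1)%:Z - (octic 5)%:Z.

Let tz4 : teich z ^+ 4 = -1.
Proof. by rewrite -(teichX p_pr) z4 (teichN p_pr p_odd) (teich1 p_pr). Qed.

Let o26 : octic 6 = octic 2. Proof. exact: (octic3 2). Qed.
Let o13 : octic 3 = octic 1. Proof. exact: (octic3 1). Qed.
Let o57 : octic 7 = octic 5. Proof. by rewrite -(octic3 5) -(octic_mod (3 * 5)). Qed.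

Lemma octic_sqrtm2 : s ^+ 2 = - 2.
Proof.
have -> : s ^+ 2 = teich z ^+ 2 + 2 * teich z ^+ 4 + teich z ^+ 4 * teich z ^+ 2 by rewrite /s; ring.
by rewrite tz4; ring.
Qed.

(** By the symmetry j -> 3j the powers occur as 1, z^4, z + z^3, z^5 + z^7 and z^2 + z^6; the last
    is 0, and z^4 = -1 pairs the others. *)
Lemma octic_sumE : \sum_(u in A) teich (f u) = X%:~R + Y%:~R * s.
Proof.
rewrite (octic_sum (teich0 p_pr W)) !big_ord_recr big_ord0 /= !(teichX p_pr).
rewrite o26 o13 o57 /X /Y /s !rmorphB /= -!pmulrn.
move: tz4; move: (teich z) => t t4.
have e5 : t ^+ 5 = t ^+ 4 * t by ring.
have e6 : t ^+ 6 = t ^+ 4 * t ^+ 2 by ring.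
have e7 : t ^+ 7 = t ^+ 4 * t ^+ 3 by ring.
rewrite e5 e6 e7 t4; ring.
Qed.

Lemma octic_sumVE : \sum_(u in A) teich (f u)^-1 = X%:~R - Y%:~R * s.
Proof.
have z7 : z * - z ^+ 3 = 1 by rewrite mulrN -exprS z4 opprK.
have zV : z^-1 = - z ^+ 3.
  by apply: (mulfI z_neq0); rewrite z7 divff // z_neq0.
have tzV : teich z^-1 = - teich z ^+ 3 by rewrite zV (teichN p_pr p_odd) (teichX p_pr).
rewrite (octic_sum (G := fun x => teich x^-1)); last by rewrite invr0 (teich0 p_pr).
rewrite !big_ord_recr big_ord0 /=.
have tV j : teich (z ^+ j)^-1 = (- teich z ^+ 3) ^+ j by rewrite -exprVn (teichX p_pr) tzV.
rewrite !tV o26 o13 o57 /X /Y /s !rmorphB /= -!pmulrn.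
move: tz4; move: (teich z) => t t4.
have e2 : (- t ^+ 3) ^+ 2 = t ^+ 4 * t ^+ 2 by ring.
have e3 : (- t ^+ 3) ^+ 3 = - (t ^+ 4) ^+ 2 * t by ring.
have e4 : (- t ^+ 3) ^+ 4 = (t ^+ 4) ^+ 3 by ring.
have e5 : (- t ^+ 3) ^+ 5 = - (t ^+ 4) ^+ 3 * t ^+ 3 by ring.
have e6 : (- t ^+ 3) ^+ 6 = (t ^+ 4) ^+ 4 * t ^+ 2 by ring.
have e7 : (- t ^+ 3) ^+ 7 = - (t ^+ 4) ^+ 5 * t by ring.
rewrite e2 e3 e4 e5 e6 e7 t4; ring.
Qed.

(* The bounds |X| + 2|Y| <= p make the congruence X^2 + 2Y^2 = p mod p^3 an equality. *)
Lemma octic_norm : (#|A| <= p.+1)%N ->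
  (\sum_(u in A) teich (f u)) * (\sum_(u in A) teich (f u)^-1) = p%:R ->
  (exists2 u, u \in A & f u = 0) ->
  p%:Z = X ^+ 2 + 2 * Y ^+ 2.
Proof.
move=> Ap nrm [u0 u0A fu0].
have bound : (octic 0 + octic 4 + 2 * (octic 1 + octic 5) <= p)%N.
  have E := octic_sum (G := fun x : k => nat_of_bool (x != 0)); rewrite eqxx in E.
  have mn (n : nat) : (1%N : nat) *+ n = n by elim: n => // n IH; rewrite mulrS IH.
  have {}E : (\sum_(u in A) nat_of_bool (f u != 0%R) = \sum_(j < 8) octic j)%N.
    apply: etrans (E erefl) _; apply: eq_bigr => j _.
    by rewrite expf_neq0 ?z_neq0 // mn.
  have : (\sum_(u in A) nat_of_bool (f u != 0%R) <= p)%N.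
    rewrite (bigD1 u0) //= fu0 eqxx add0n -ltnS; apply: leq_trans Ap.
    rewrite (cardsD1 u0) u0A ltnS -sum1_card.
    rewrite [X in (X <= _)%N](eq_bigl (fun u => u \in A :\ u0)) => [|u]; last by rewrite !inE andbC.
    by apply: leq_sum => u _; case: (_ != _).
  rewrite E !big_ord_recr big_ord0 /= o26 o13 o57; clear; lia.
have h : (p%:Z ^+ 3 %| X ^+ 2 + 2 * Y ^+ 2 - p%:Z)%Z.
  apply: (wchar_int W).
  have -> : (X ^+ 2 + 2 * Y ^+ 2 - p%:Z)%:~R = X%:~R ^+ 2 + 2 * Y%:~R ^+ 2 - p%:R :> R.
    by move: X Y => x y; rewrite !expr2 intrB intrD !intrM.
  rewrite -nrm.
  rewrite octic_sumE octic_sumVE.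
  have -> : (X%:~R + Y%:~R * s) * (X%:~R - Y%:~R * s) = X%:~R ^+ 2 - Y%:~R ^+ 2 * s ^+ 2 by ring.
    rewrite octic_sqrtm2; ring.
have p2 := prime_gt1 p_pr.
move: h; rewrite /X /Y; move: (octic 0) (octic 4) (octic 1) (octic 5) bound => a d b c bound h.
clear -bound h p2.
have h1 : (a%:Z - d%:Z) ^+ 2 <= (a%:Z + d%:Z) ^+ 2 by nia.
have h2 : (b%:Z - c%:Z) ^+ 2 <= (b%:Z + c%:Z) ^+ 2 by nia.
have n0 : 0 <= (a%:Z - d%:Z) ^+ 2 + 2 * (b%:Z - c%:Z) ^+ 2.
  by apply: addr_ge0; [exact: sqr_ge0 | apply: mulr_ge0 => //; exact: sqr_ge0].
have n1 : (a%:Z - d%:Z) ^+ 2 + 2 * (b%:Z - c%:Z) ^+ 2 <= p%:Z ^+ 2.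
  have : (a%:Z + d%:Z + 2 * (b%:Z + c%:Z)) ^+ 2 <= p%:Z ^+ 2.
    by rewrite ler_sqr ?nnegrE; lia.
  move: h1 h2; have : 0 <= a%:Z + d%:Z by lia.
  have : 0 <= b%:Z + c%:Z by lia.
  move: (a%:Z + d%:Z) (b%:Z + c%:Z) => x y y0 x0.
  rewrite (_ : (x + 2 * y) ^+ 2 = x ^+ 2 + 4 * (x * y) + 4 * y ^+ 2); last by ring.
  have := mulr_ge0 x0 y0; have := sqr_ge0 y; clear.
  move: (x ^+ 2) (y ^+ 2) (x * y) ((a%:Z - d%:Z) ^+ 2) ((b%:Z - c%:Z) ^+ 2) (p%:Z ^+ 2).
  by clear; move=> *; lia.
move: h n0 n1; move: (_ + 2 * _) => n /dvdzP[t tE] n0 n1.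
have t0 : t = 0.
  have p3 : p%:Z ^+ 2 < p%:Z ^+ 3 by rewrite ltr_eXn2l; lia.
  have pp : p%:Z <= p%:Z ^+ 2 by rewrite ler_eXnr //; lia.
  have p0 : 0 < p%:Z ^+ 3 by rewrite exprn_gt0 //; lia.
  move: tE p3 pp p0; move: (p%:Z ^+ 3) (p%:Z ^+ 2) n1 => q r n1 tE p3 pp p0.
  by have : - q < t * q < q; [lia | nia].
by move: tE; rewrite t0 mul0r => /eqP; rewrite subr_eq0 => /eqP.
Qed.
End Octic.

(** * Fibres of u -> u^m and products over them *)

Section Fibers.
Variables (k : finFieldType) (m d : nat) (m0 : (0 < m)%N) (d0 : (0 < d)%N).
Hypothesis card_mu : #|mu k (m * d)| = (m * d)%N.

Definition fiber (c : k) : {set k} := [set u | u ^+ m == c].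

(** There are at most d fibres with at most m elements each, and together they hold m d elements, so
    every bound is attained. *)
Lemma card_fiber c : c ^+ d = 1 -> #|fiber c| = m.
Proof.
move=> cd.
have le c' : (#|fiber c'| <= m)%N.
  by apply: (@card_unity_roots k _ m c') => // u; rewrite inE => /eqP.
have cmu : c \in mu k d by rewrite muP cd.
have cover_mu : (#|mu k (m * d)| <= \sum_(c' in mu k d) #|fiber c'|)%N.
  rewrite -sum1_card (partition_big (fun u => u ^+ m) (mem (mu k d))) /=; last first.
    by move=> u; rewrite !muP exprM.
  apply: leq_sum => c' _; rewrite sum1_card; apply: subset_leq_card; apply/subsetP => u.
  by rewrite !inE => /andP[_].
have cd' : (#|mu k d| <= d)%N.
  by apply: (@card_unity_roots k _ d 1) => // u; rewrite muP => /eqP.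
apply/eqP; rewrite eqn_leq le /= leqNgt; apply/negP => lt.
move: cover_mu; rewrite card_mu leqNgt => /negP; apply.
rewrite (bigD1 c) //=.
have s1 : (\sum_(c' in mu k d | c' != c) #|fiber c'| <= \sum_(c' in mu k d | c' != c) m)%N.
  by apply: leq_sum => c' _.
rewrite sum_nat_const in s1.
have := cardsD1 c (mu k d); rewrite cmu /= => s2.
have s3 : #|[pred i in mu k d | i != c]| = #|mu k d :\ c|.
  by apply: eq_card => i; rewrite !inE andbC.
rewrite s3 in s1.
have s4 : (#|mu k d :\ c|.+1 * m <= d * m)%N by rewrite leq_mul2r -add1n -s2 cd' orbT.
rewrite mulSn [(d * m)%N]mulnC in s4; apply: leq_trans s4.
exact: leq_add lt s1.
Qed.

Lemma prod_fiber c : c ^+ d = 1 -> \prod_(u in fiber c) ('X - u%:P) = 'X^m - c%:P.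
Proof.
move=> cd; rewrite -big_enum /=.
have sz : size ('X^m - c%:P : {poly k}) = (size (enum (fiber c))).+1.
  by rewrite size_XnsubC // -cardE card_fiber.
rewrite [RHS](all_roots_prod_XsubC sz).
- by rewrite lead_coefXnsubC // scale1r.
- apply/allP => u; rewrite mem_enum inE => /eqP uc.
  by rewrite rootE !hornerE uc subrr.
- by rewrite uniq_rootsE enum_uniq.
Qed.

Lemma prod_fiber_1B c : c ^+ d = 1 -> \prod_(u in fiber c) (1 - u) = 1 - c.
Proof.
move=> cd; have := congr1 (fun q : {poly k} => q.[1]) (prod_fiber cd).
rewrite horner_prod !hornerE expr1n => <-.
by apply: eq_bigr => u _; rewrite !hornerE.
Qed.

Lemma prod_fiber_id c : c ^+ d = 1 -> \prod_(u in fiber c) u = (-1) ^+ m.+1 * c.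
Proof.
move=> cd; have := congr1 (fun q : {poly k} => q.[0]) (prod_fiber cd).
rewrite horner_prod !hornerE expr0n gtn_eqF // sub0r.
rewrite (eq_bigr (fun u => - u)); last by move=> u _; rewrite !hornerE.
rewrite prodrN card_fiber // => E.
have -> : \prod_(u in fiber c) u = (-1) ^+ m * ((-1) ^+ m * \prod_(u in fiber c) u).
  by rewrite mulrA -exprMn mulrNN mulr1 expr1n mul1r.
by rewrite E exprS; ring.
Qed.

(** The value at 1 of (X^m - 1) / (X - 1) = 1 + X + ... + X^(m - 1). *)
Lemma prod_fiber1_1B : \prod_(u in fiber 1 :\ 1) (1 - u) = m%:R.
Proof.
have F1 : 1 \in fiber 1 by rewrite inE expr1n.
have := prod_fiber (expr1n _ d); rewrite (big_setD1 1) //= subrX1.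
have x1 : 'X - 1%:P != 0 :> {poly k} by rewrite polyXsubC_eq0.
move=> /(mulfI x1) E; have := congr1 (fun q : {poly k} => q.[1]) E.
rewrite horner_prod horner_sum => E1.
rewrite (eq_bigr (fun u => ('X - u%:P).[1])); last by move=> u _; rewrite !hornerE.
rewrite E1 (eq_bigr (fun=> 1)) ?sumr_const ?card_ord // => i _.
by rewrite !hornerE expr1n.
Qed.
End Fibers.

Section Common.
Variables (p : nat) (p_pr : prime p) (p_odd : odd p) (k : finFieldType) (R : comNzRingType).
Variable W : witt3 p k R.
Notation teich := (teichmuller W).

Lemma unit_root_dvd (b X Y : int) (s : R) : s ^+ 2 = - 2 ->
  8 * (X%:~R + Y%:~R * s) = b%:~R -> p%:Z = X ^+ 2 + 2 * Y ^+ 2 ->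
  (p%:Z ^+ 3 %| b ^+ 2 - 16 * X * b + 64 * p%:Z)%Z.
Proof.
move=> s2 bE pE; apply: (wchar_int W); rewrite pE.
have -> : (b ^+ 2 - 16 * X * b + 64 * (X ^+ 2 + 2 * Y ^+ 2))%:~R =
  b%:~R ^+ 2 - 16 * X%:~R * b%:~R + 64 * (X%:~R ^+ 2 + 2 * Y%:~R ^+ 2) :> R.
  rewrite !expr2 !(intrD, intrB, intrM); ring.
rewrite -bE; move: X%:~R Y%:~R => x y.
have -> : (8 * (x + y * s)) ^+ 2 - 16 * x * (8 * (x + y * s)) + 64 * (x ^+ 2 + 2 * y ^+ 2) =
  64 * y ^+ 2 * (s ^+ 2 + 2) by ring.
by rewrite s2 addNr mulr0.
Qed.

Lemma signr_odd_inj (a b : nat) : (-1) ^+ a = (-1) ^+ b :> k -> odd a = odd b.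
Proof.
rewrite -(signr_odd _ a) -(signr_odd _ b).
have h : (1 : k) != -1.
  by rewrite -subr_eq0 opprK -mulr2n; exact: (two_neq0 p_pr p_odd W).
by case: (odd a); case: (odd b) => //= /eqP; rewrite ?expr1 ?expr0 ?[-1 == _]eq_sym (negPf h).
Qed.

(** Recovers the parity of the number of values -w from a product that can be evaluated in closed
    form over a fibre. *)
Lemma sign_prod (C : {set k}) (f : k -> k) (w : k) : w != 0 ->
  {in C, forall u, f u ^+ 2 = w ^+ 2} ->
  (#|[set u in C | f u == w]| + #|[set u in C | f u == - w]| = #|C|)%N /\
  \prod_(u in C) f u = w ^+ #|C| * (-1) ^+ #|[set u in C | f u == - w]|.
Proof.
move=> w0 fw.
have ww : - w != w.
  rewrite -subr_eq0 -opprD oppr_eq0 -mulr2n -mulr_natl mulf_neq0 //.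
  exact: (two_neq0 p_pr p_odd W).
have fv u : u \in C -> f u = (if f u == - w then -1 else 1) * w /\
    ((f u == w) = ~~ (f u == - w)).
  move=> uC; have := fw u uC => /eqP; rewrite eqf_sqr => /orP[/eqP-> | /eqP->].
    by rewrite eqxx eq_sym (negPf ww) mul1r.
  by rewrite eqxx (negPf ww) mulN1r.
split.
  rewrite -cardsUI (_ : _ :&: _ = set0) ?cards0 ?addn0.
    by apply: eq_card => u; rewrite !inE; case uC: (u \in C) => //=; have [_ ->] := fv u uC; rewrite orNb.
  by apply/setP => u; rewrite !inE; case uC: (u \in C) => //=; have [_ ->] := fv u uC; rewrite andNb.
rewrite (eq_bigr (fun u => (if f u == - w then -1 else 1) * w)); last by move=> u /fv[].
rewrite big_split /= prodr_const mulrC; congr (_ * _).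
rewrite -big_mkcondr /= prodr_const; congr (_ ^+ _).
by apply: eq_card => u; rewrite !inE.
Qed.
End Common.

(** * The Jacobi sum for p = 1 mod 8 *)

Section Split.
Variables (p : nat) (p_pr : prime p) (p_odd : odd p) (k : finFieldType) (R : comNzRingType).
Variable W : witt3 p k R.
Notation teich := (teichmuller W).
Variables (K : nat) (pK : p = (8 * K + 1)%N) (cardk : #|k| = p).
Let N := (4 * K)%N.
Let M := N.*2.
Notation phi := (jacobi_term M N K : k -> k).

Let K_gt0 : (0 < K)%N.
Proof. by have := prime_gt1 p_pr; rewrite pK; case: (K). Qed.
Let N_gt0 : (0 < N)%N. Proof. by rewrite /N; clear -K_gt0; lia. Qed.
Let M_gt0 : (0 < M)%N. Proof. by rewrite /M; clear -N_gt0; lia. Qed.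
Let pM : p = M.+1. Proof. by rewrite pK /M /N; clear; lia. Qed.
Let M8 : M = (8 * K)%N. Proof. by rewrite /M /N; clear; lia. Qed.

Let powM (u : k) : u != 0 -> u ^+ M = 1.
Proof.
move=> u0; apply: (mulfI u0); rewrite mulr1 -exprS -pM -cardk; exact: expf_card.
Qed.

Let muE (u : k) : (u \in mu k M) = (u != 0).
Proof. by apply/idP/idP => [/(mu_neq0 M_gt0)|/powM e]; rewrite // muP e. Qed.

Let card_mu : #|mu k M| = M.
Proof.
have -> : mu k M = [set~ 0] by apply/setP => u; rewrite muE !inE.
by rewrite cardsC1 cardk pM.
Qed.

Lemma exists_zeta_split : exists z : k, z ^+ 4 = - 1.
Proof.
have [g gm gN] : exists2 g, g \in mu k M & g ^+ N != 1.
  apply: (mu_nontrivial M_gt0 card_mu); rewrite gtnNdvd // /M; clear -N_gt0; lia.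
exists (g ^+ K); rewrite -exprM mulnC -/N; apply/eqP; rewrite eq_sym -subr_eq0.
have : (g ^+ N - 1) * (g ^+ N + 1) = 0.
  have -> : (g ^+ N - 1) * (g ^+ N + 1) = (g ^+ N) ^+ 2 - 1 by ring.
  by rewrite -exprM muln2 -/M (powM (mu_neq0 M_gt0 gm)) subrr.
have gN1 : g ^+ N - 1 != 0 by rewrite subr_eq0.
by move=> /eqP; rewrite mulf_eq0 (negPf gN1) /= => /eqP e; rewrite -opprD addrC e oppr0.
Qed.

Section Zeta.
Variables (z : k) (z4 : z ^+ 4 = - 1).

Let phiE (u : k) : u != 0 -> phi u = u^-1 ^+ K * (1 - u) ^+ N.
Proof.
move=> u0; rewrite /jacobi_term; congr (_ * _).
have uK : u ^+ K != 0 by rewrite expf_neq0.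
apply: (mulfI uK); rewrite -exprD subnKC; last by rewrite M8; clear; lia.
by rewrite powM // -exprMn divff // expr1n.
Qed.

Let d2 (u : k) : u != 1 -> (1 - u) ^+ N * (1 - u) ^+ N = 1.
Proof. by move=> u1; rewrite -exprD addnn -/M powM // subr_eq0 eq_sym. Qed.

Let phi2 (u : k) : u != 0 -> u != 1 -> phi u ^+ 2 = u^-1 ^+ (2 * K).
Proof.
move=> u0 u1; rewrite phiE // exprMn -!exprM [(1 - u) ^+ _]exprM expr2 d2 // mulr1.
by rewrite mulnC.
Qed.

Let phi8 (u : k) : u \in mu k M -> phi u = 0 \/ phi u ^+ 8 = 1.
Proof.
rewrite muE => u0; have [->|u1] := eqVneq u 1; [left|right].
  by rewrite /jacobi_term subrr expr0n (gtn_eqF N_gt0) mulr0.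
rewrite (exprM _ 2 4) phi2 // -exprM (_ : (2 * K * 4)%N = M) ?powM ?invr_eq0 //.
by rewrite M8; clear; lia.
Qed.

Let phiV (u : k) : u \in mu k M -> u^-1 \in mu k M /\ phi u^-1 = phi u ^+ 3.
Proof.
rewrite !muE invr_eq0 => u0; split => //.
have [->|u1] := eqVneq u 1.
  by rewrite invr1 /jacobi_term subrr expr0n (gtn_eqF N_gt0) mulr0 expr0n.
rewrite (exprS _ 2) phi2 // !phiE ?invr_eq0 // invrK.
have -> : 1 - u^-1 = - (1 - u) * u^-1 by field.
rewrite exprMn exprNn.
have -> : (-1) ^+ N = 1 :> k by rewrite /N exprM -(signr_odd _ 4) !expr1n.
have uK : u ^+ K != 0 by rewrite expf_neq0.
have e : u ^+ K * u^-1 ^+ N = u^-1 ^+ K * u^-1 ^+ (2 * K).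
  have -> : N = (K + (K + 2 * K))%N by rewrite /N; clear; lia.
  by rewrite exprD mulrA -exprMn divff // expr1n mul1r exprD.
by rewrite mul1r [(1 - u) ^+ N * _]mulrC mulrA e; ring.
Qed.

Notation oct := (octic (mu k M) phi z).

Lemma split_norm : p%:Z = ((oct 0)%:Z - (oct 4)%:Z) ^+ 2 + 2 * ((oct 1)%:Z - (oct 5)%:Z) ^+ 2.
Proof.
apply: (octic_norm p_pr p_odd z4 phi8 phiV (W := W)).
- by rewrite card_mu pM; clear; lia.
- apply: (norm_split p_pr W M_gt0 card_mu N_gt0 cardk pM) => //.
  by rewrite K_gt0 /N; clear -K_gt0; lia.
- by exists 1; [exact: mu1 | rewrite /jacobi_term subrr expr0n (gtn_eqF N_gt0) mulr0].
Qed.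

Lemma split_root : let b := ext_split p N K (3 * K) in
  (p%:Z ^+ 3 %| b ^+ 2 - 16 * ((oct 0)%:Z - (oct 4)%:Z) * b + 64 * p%:Z)%Z.
Proof.
apply: (unit_root_dvd W (octic_sqrtm2 p_pr p_odd W z4) _ split_norm).
rewrite -(octic_sumE p_pr p_odd W z4 phi8 phiV).
have pN : p = N.*2.+1 by rewrite pM.
have NKL : N = (K + 3 * K)%N by rewrite /N; clear; lia.
have L0 : (0 < 3 * K)%N by clear -K_gt0; lia.
apply: (phi_sum_split p_pr p_odd W pN NKL K_gt0 L0 card_mu).
by move=> u um u1; rewrite -/M powM // subr_eq0 eq_sym.
Qed.

Let cM4 : #|mu k (2 * K * 4)| = (2 * K * 4)%N.
Proof. by have -> : (2 * K * 4 = M)%N by [rewrite M8; clear; lia]; exact: card_mu. Qed.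
Let m_gt0 : (0 < 2 * K)%N. Proof. by clear -K_gt0; lia. Qed.

Let sgn2K : (-1) ^+ (2 * K) = 1 :> k. Proof. by rewrite exprM sqrrN !expr1n. Qed.

(** As phi(u)^2 = u^(-2K), the values z and z^5 = -z are taken exactly on the fibre of u -> u^(2K)
    over c = z^-2 = -z^2. The product of phi over this fibre involves (1 - c)^N = (1 + z^2)^N, and
    (1 + z^2)^2 = 2 z^2 produces the power of 4. *)
Lemma split_sign : (oct 1 + oct 5 = 2 * K)%N /\ (-1) ^+ oct 5 = 4 ^+ K :> k.
Proof.
pose c := - z ^+ 2.
have c4 : c ^+ 4 = 1.
  by rewrite /c exprNn -exprM (exprM z 4 2) z4 -signr_odd expr0 mul1r sqrrN expr1n.
have z0 := z_neq0 z4.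
have cV : c = (z ^+ 2)^-1.
  have z20 : z ^+ 2 != 0 by rewrite expf_neq0.
  by apply: (mulfI z20); rewrite divff // /c mulrN -exprD z4 opprK.
have c1 : c != 1.
  apply/eqP => e; have := z4; rewrite (exprM z 2 2).
  have -> : z ^+ 2 = -1 by rewrite -[z ^+ 2]opprK -/c e.
  rewrite sqrrN expr1n => /eqP; rewrite -addr_eq0; apply/negP.
  exact: (two_neq0 p_pr p_odd W).
have inC u : u \in fiber (2 * K) c -> u != 0 /\ u != 1.
  rewrite inE => /eqP uc; split; apply/eqP => e; move: uc; rewrite e.
    rewrite expr0n (gtn_eqF m_gt0) => /esym/eqP; rewrite oppr_eq0 expf_eq0 (negPf z0) andbF //.
  by rewrite expr1n => /esym/eqP; apply/negP.
have fC : {in fiber (2 * K) c, forall u, phi u ^+ 2 = z ^+ 2}.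
  move=> u uC; have [u0 u1] := inC u uC; rewrite phi2 // exprVn.
  by move: uC; rewrite inE => /eqP->; rewrite cV invrK.
have z5 : z ^+ 5 = - z by rewrite (exprS z 4) z4 mulrN1.
have [cardE prodE] := sign_prod p_pr p_odd W z0 fC.
rewrite -z5 in cardE prodE.
have sets j : (j == 1%N) || (j == 5%N) -> oct j = #|[set u in fiber (2 * K) c | phi u == z ^+ j]|.
  move=> j15; apply: eq_card => u; rewrite !inE -/(u \in mu k M) -muP muE.
  apply/andP/andP => -[h /eqP pu]; split; rewrite ?pu //; last first.
    by have [] := inC u; rewrite ?inE.
  have u1 : u != 1.
    apply/eqP => e; move: pu; rewrite e /jacobi_term subrr expr0n (gtn_eqF N_gt0) mulr0 => /esym/eqP.
    by rewrite expf_eq0 (negPf z0) andbF.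
  have : phi u ^+ 2 = z ^+ 2.
    rewrite pu; case/orP: j15 => /eqP->; rewrite ?expr1 //.
    by rewrite -exprM (exprD z 8 2) (exprM z 4 2) z4 sqrrN expr1n mul1r.
  rewrite phi2 // exprVn cV => <-; by rewrite invrK.
rewrite (sets 1%N) // (sets 5%N) // expr1.
split; first by rewrite cardE (card_fiber m_gt0 (isT : (0 < 4)%N) cM4 c4).
rewrite (card_fiber m_gt0 (isT : (0 < 4)%N) cM4 c4) // in prodE.
have zK : z ^+ (2 * K) != 0 by rewrite expf_neq0.
apply: (mulfI zK); rewrite -prodE.
rewrite (eq_bigr (fun u => u^-1 ^+ K * (1 - u) ^+ N)); last first.
  by move=> u uC; have [u0 u1] := inC u uC; rewrite phiE.
rewrite big_split /= !prodrXl prodfV (prod_fiber_id m_gt0 (isT : (0 < 4)%N) cM4 c4) // (prod_fiber_1B m_gt0 (isT : (0 < 4)%N) cM4 c4) //.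
rewrite exprS sgn2K mulr1 mulN1r /c opprK.
have -> : (1 + z ^+ 2) ^+ N = (-1) ^+ K * 4 ^+ K.
  have -> : N = (2 * (2 * K))%N by rewrite /N; clear; lia.
  rewrite exprM.
  have -> : (1 + z ^+ 2) ^+ 2 = 2 * z ^+ 2 by rewrite (_ : _ ^+ 2 = 1 + 2 * z ^+ 2 + z ^+ 4); [rewrite z4|]; ring.
  rewrite exprM [(2 * z ^+ 2) ^+ 2]exprMn -(exprM z 2 2) z4 (_ : 2 ^+ 2 = 4 :> k); last by ring.
  by rewrite mulrC -exprMn mulrC.
have -> : (z ^+ 2)^-1 = - z ^+ 2 by rewrite -cV.
rewrite mulrA -exprMn mulrNN mulr1 -exprM; by [].
Qed.

(** The values 1 and -1 are taken on the fibre over 1 without u = 1 itself. Consequently [oct 0] -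
    [oct 4] is 2K - 1 - 2 [oct 4], which is -1 modulo 4. *)
Lemma split_parity : (oct 0 + oct 4 = 2 * K - 1)%N /\ odd (oct 4) = odd K.
Proof.
have c4 : 1 ^+ 4 = 1 :> k by rewrite expr1n.
have F1 : 1 \in fiber (2 * K) (1 : k) by rewrite inE expr1n.
set C := fiber (2 * K) (1 : k) :\ 1.
have inC u : u \in C -> u != 0 /\ u != 1.
  rewrite !inE => /andP[u1 /eqP uc]; split => //; apply/eqP => e; move: uc.
  by rewrite e expr0n (gtn_eqF m_gt0) => /eqP; rewrite eq_sym oner_eq0.
have fC : {in C, forall u, phi u ^+ 2 = 1 ^+ 2}.
  move=> u uC; have [u0 u1] := inC u uC; rewrite phi2 // exprVn.
  by move: uC; rewrite !inE => /andP[_ /eqP->]; rewrite invr1 expr1n.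
have [cardE prodE] := sign_prod p_pr p_odd W (oner_neq0 k) fC.
rewrite -{1}[1](expr0 z) -z4 in cardE; rewrite expr1n mul1r -z4 in prodE.
have sets j : (j == 0%N) || (j == 4%N) -> oct j = #|[set u in C | phi u == z ^+ j]|.
  move=> j04; apply: eq_card => u; rewrite !inE -/(u \in mu k M) -muP muE.
  apply/andP/andP => -[h /eqP pu]; split; rewrite ?pu //; last first.
    by have [] := inC u; rewrite ?inE.
  have u1 : u != 1.
    apply/eqP => e; move: pu; rewrite e /jacobi_term subrr expr0n (gtn_eqF N_gt0) mulr0 => /esym/eqP.
    by rewrite expf_eq0 (negPf (z_neq0 z4)) andbF.
  rewrite u1 /=; have : phi u ^+ 2 = 1.
    by rewrite pu; case/orP: j04 => /eqP->; rewrite ?z4 ?sqrrN !expr1n.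
  by rewrite phi2 // exprVn => /eqP; rewrite invr_eq1.
rewrite (sets 0%N) // (sets 4%N) //.
have cardC : #|C| = (2 * K - 1)%N.
  have := cardsD1 1 (fiber (2 * K) (1 : k)).
  by rewrite F1 (card_fiber m_gt0 (isT : (0 < 4)%N) cM4 c4) -/C => ->; rewrite addKn.
split; first by rewrite cardE cardC.
apply: (signr_odd_inj p_pr p_odd W); rewrite -[X in X ^+ _ = _]z4 -prodE.
rewrite (eq_bigr (fun u => u^-1 ^+ K * (1 - u) ^+ N)); last first.
  by move=> u uC; have [u0 u1] := inC u uC; rewrite phiE.
rewrite big_split /= !prodrXl prodfV (prod_fiber1_1B m_gt0 (isT : (0 < 4)%N) cM4).
have := prod_fiber_id m_gt0 (isT : (0 < 4)%N) cM4 c4.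
rewrite (big_setD1 1) //= mul1r -/C exprS sgn2K !mulr1 => ->.
(* 8K = p - 1, so the product 2K of the 1 - u is the inverse of -4, whose N-th power is 1. *)
have K4 : (2 * K)%:R * -4 = 1 :> k.
  have : p%:R = 0 :> k := wproj_p W.
  rewrite pK natrD !natrM; move: (K%:R : k) => x e.
  by have -> : 2 * x * -4 = 1 - (8 * x + 1) by [ring]; rewrite e subr0.
have : ((2 * K)%:R * -4) ^+ N = 1 :> k by rewrite K4 expr1n.
have -> : ((2 * K)%:R * -4) ^+ N = (2 * K)%:R ^+ N * (-4) ^+ N :> k by exact: exprMn.
have -> : (-4) ^+ N = 1 :> k.
  have -> : -4 = - (2 ^+ 2) :> k by ring.
  rewrite exprNn -exprM mul2n -/M powM ?(two_neq0 p_pr p_odd W) // mulr1.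
  by rewrite /N exprM -(signr_odd _ 4) !expr1n.
by rewrite mulr1 => ->; rewrite mulr1 invrN1.
Qed.
End Zeta.
End Split.

(** * The Jacobi sum for p = 3 mod 8 *)

Section Inert.
Variables (p : nat) (p_pr : prime p) (p_gt3 : (3 < p)%N) (k : finFieldType) (R : comNzRingType).
Variable W : witt3 p k R.
Notation teich := (teichmuller W).
Variables (L : nat) (pL : p = (8 * L + 3)%N) (cardk : #|k| = (p ^ 2)%N).
Let p_odd := p_odd p_pr p_gt3.
Let N := (4 * L).+1.
Let K := (3 * L).+1.
Let m := (2 * L).+1.
Notation M := p.+1.
Notation phi := (jacobi_term M N K : k -> k).

Let pN : p = N.*2.+1. Proof. by rewrite pL /N; clear; lia. Qed.
Let M4 : M = (m * 4)%N. Proof. by rewrite pL /m; clear; lia. Qed.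

Let powM2 (u : k) : u != 0 -> u ^+ (M * p.-1) = 1.
Proof.
move=> u0; apply: (mulfI u0); rewrite mulr1 -exprS -[RHS](expf_card u) cardk.
by congr (_ ^+ _); rewrite pL; clear; lia.
Qed.

Let card_mu2 : #|mu k (M * p.-1)| = (M * p.-1)%N.
Proof.
have -> : mu k (M * p.-1) = [set~ 0].
  apply/setP => u; rewrite !inE; apply/eqP/idP => [e|/powM2 //].
  by apply: contra_eq_neq e => ->; rewrite expr0n /= muln_eq0 /= pN /= eq_sym oner_neq0.
rewrite cardsC1 cardk pL; clear; lia.
Qed.

Let card_mu : #|mu k M| = M.
Proof.
have p0 : (0 < p.-1)%N by rewrite pN.
exact: (card_fiber (ltn0Sn p) p0 card_mu2 (expr1n _ _)).
Qed.

Let cM4 : #|mu k (m * 4)| = (m * 4)%N. Proof. by rewrite -M4; exact: card_mu. Qed.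

Lemma exists_zeta_inert : exists z : k, z ^+ 4 = - 1.
Proof.
have M2_gt0 : (0 < M * p.-1)%N by rewrite muln_gt0 /= pN.
have half : (M * p.-1 = (4 * (N * m)) * 2)%N by rewrite pL /N /m; clear; lia.
have [g gm gN] : exists2 g, g \in mu k (M * p.-1) & g ^+ (4 * (N * m)) != 1.
  by apply: (mu_nontrivial M2_gt0 card_mu2); rewrite gtnNdvd // half; clear; lia.
exists (g ^+ (N * m)); rewrite -exprM mulnC; apply/eqP; rewrite eq_sym -subr_eq0.
have : (g ^+ (4 * (N * m)) - 1) * (g ^+ (4 * (N * m)) + 1) = 0.
  have -> : (g ^+ (4 * (N * m)) - 1) * (g ^+ (4 * (N * m)) + 1) = (g ^+ (4 * (N * m))) ^+ 2 - 1 by ring.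
  by rewrite -exprM -half (powM2 (mu_neq0 M2_gt0 gm)) subrr.
have gN1 : g ^+ (4 * (N * m)) - 1 != 0 by rewrite subr_eq0.
by move=> /eqP; rewrite mulf_eq0 (negPf gN1) /= => /eqP e; rewrite -opprD addrC e oppr0.
Qed.

Section Zeta.
Variables (z : k) (z4 : z ^+ 4 = - 1).

Let mu0 (u : k) : u \in mu k M -> u != 0. Proof. exact: mu_neq0. Qed.

Let phiE (u : k) : u \in mu k M -> phi u = u^-1 ^+ K * (1 - u) ^+ N.
Proof.
move=> um; have u0 := mu0 um; rewrite /jacobi_term; congr (_ * _).
have uK : u ^+ K != 0 by rewrite expf_neq0.
apply: (mulfI uK); rewrite -exprD subnKC; last by rewrite pL /K; clear; lia.
by move: um; rewrite muP => /eqP->; rewrite -exprMn divff // expr1n.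
Qed.

(** Frobenius inverts u, so (1 - u)^p = 1 - u^-1 = -(1 - u) / u. *)
Let d2 (u : k) : u \in mu k M -> u != 1 -> (1 - u) ^+ N * (1 - u) ^+ N = - u^-1.
Proof.
move=> um u1; have u0 := mu0 um; rewrite -exprD addnn.
have v0 : 1 - u != 0 by rewrite subr_eq0 eq_sym.
apply: (mulfI v0); rewrite -exprS -pN.
have chk : p \in [pchar k] by rewrite inE p_pr /= (wproj_p W).
have -> : (1 - u) ^+ p = 1 ^+ p - u ^+ p by exact: (rmorphB (pFrobenius_aut chk)).
have -> : u ^+ p = u^-1.
  by apply: (mulfI u0); rewrite -exprS divff //; apply/eqP; rewrite -muP.
by rewrite expr1n; field.
Qed.

Let V4m (u : k) : u \in mu k M -> u^-1 ^+ (3 * m) = u ^+ m.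
Proof.
move=> um; have u0 := mu0 um; have u3 : u ^+ (3 * m) != 0 by rewrite expf_neq0.
apply: (mulfI u3); rewrite -exprMn divff // expr1n -exprD.
by move: um; rewrite muP M4 => /eqP <-; congr (_ ^+ _); clear; lia.
Qed.

Let phi2 (u : k) : u \in mu k M -> u != 1 -> phi u ^+ 2 = - u ^+ m.
Proof.
move=> um u1; rewrite phiE // exprMn -!exprM [(1 - u) ^+ _]exprM expr2 d2 //.
rewrite mulrN -exprSr -(V4m um); congr (- (_ ^+ _)); rewrite /K /m; clear; lia.
Qed.

Let phi_1 : phi 1 = 0. Proof. by rewrite /jacobi_term subrr expr0n mulr0. Qed.

Let phi8 (u : k) : u \in mu k M -> phi u = 0 \/ phi u ^+ 8 = 1.
Proof.
move=> um; have [->|u1] := eqVneq u 1; [by left|right].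
rewrite (exprM _ 2 4) phi2 // exprNn -(signr_odd _ 4) expr0 mul1r -exprM -M4.
by apply/eqP; rewrite -muP.
Qed.

Let phiV (u : k) : u \in mu k M -> u^-1 \in mu k M /\ phi u^-1 = phi u ^+ 3.
Proof.
move=> um; have u0 := mu0 um.
have um' : u^-1 \in mu k M.
  by move: um; rewrite !muP exprVn => /eqP->; rewrite invr1.
split => //; have [->|u1] := eqVneq u 1; first by rewrite invr1 phi_1 expr0n.
rewrite (exprS _ 2) phi2 // -(V4m um) !phiE // invrK.
have -> : 1 - u^-1 = - (1 - u) * u^-1 by field.
have oN : (-1) ^+ N = -1 :> k by rewrite -signr_odd /N /= oddM /= expr1.
rewrite exprMn exprNn oN mulN1r.
have uK : u ^+ K != 0 by rewrite expf_neq0.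
have e : u ^+ K * u^-1 ^+ N = u^-1 ^+ K * u^-1 ^+ (3 * m).
  have -> : N = (K + L)%N by rewrite /N /K; clear; lia.
  rewrite exprD mulrA -exprMn divff // expr1n mul1r -exprD.
  have -> : (K + 3 * m = M + L)%N by rewrite /K /m pL; clear; lia.
  by rewrite exprD; move: um'; rewrite muP => /eqP->; rewrite mul1r.
transitivity (- (u ^+ K * u^-1 ^+ N) * (1 - u) ^+ N); last rewrite e.
  by move: (u ^+ K) (u^-1 ^+ N) ((1 - u) ^+ N) => t1 t2 t3; ring.
by move: (u^-1 ^+ K) (u^-1 ^+ (3 * m)) ((1 - u) ^+ N) => t1 t2 t3; ring.
Qed.

Notation oct := (octic (mu k M) phi z).

Lemma inert_norm : p%:Z = ((oct 0)%:Z - (oct 4)%:Z) ^+ 2 + 2 * ((oct 1)%:Z - (oct 5)%:Z) ^+ 2.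
Proof.
apply: (octic_norm p_pr p_odd z4 phi8 phiV (W := W)).
- by rewrite card_mu.
- by apply: (norm_inert p_pr p_odd W (ltn0Sn p) card_mu) => //; rewrite /N /= oddM.
- by exists 1; [exact: mu1 | exact: phi_1].
Qed.

Let L_gt0 : (0 < L)%N. Proof. by clear -pL p_gt3; lia. Qed.
Let NKL : N = (K + L)%N. Proof. by rewrite /N /K; clear; lia. Qed.

Lemma inert_sum : 8 * (((oct 0)%:Z - (oct 4)%:Z)%:~R + ((oct 1)%:Z - (oct 5)%:Z)%:~R
   * (teich z + teich z ^+ 3)) = (ext_inert p N K)%:~R.
Proof.
rewrite -(octic_sumE p_pr p_odd W z4 phi8 phiV).
apply: (phi_sum_inert p_pr p_odd W pN NKL (ltn0Sn _) L_gt0 erefl card_mu) => u um u1.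
by rewrite -addnn exprD d2 // mulNr mulrN opprK divff // mu0.
Qed.

Lemma inert_root : let b := ext_inert p N K in
  (p%:Z ^+ 3 %| b ^+ 2 - 16 * ((oct 0)%:Z - (oct 4)%:Z) * b + 64 * p%:Z)%Z.
Proof. exact: (unit_root_dvd W (octic_sqrtm2 p_pr p_odd W z4) inert_sum inert_norm). Qed.

(** The conjugate sum X - Y s vanishes modulo p: phi(u)^-1 = -u^(K + 1) (1 - u)^N on the terms with
    u other than 1, and its expansion has only exponents strictly between 0 and p + 1. This tells
    which of the two conjugates is the unit root. *)
Lemma inert_residue : ((oct 0)%:Z - (oct 4)%:Z)%:~R = ((oct 1)%:Z - (oct 5)%:Z)%:~R * (z + z ^+ 3) :> k.
Proof.
have S0 : \sum_(u in mu k M) teich u ^+ K.+1 * (1 - teich u) ^+ N = 0.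
  rewrite (mu_binomial_sum p_pr W (ltn0Sn p) card_mu (s := [::])) ?big_nil ?mulr0 // => i iN; rewrite in_nil.
  apply/negbTE; rewrite gtnNdvd // pL /K; clear -iN L_gt0; rewrite /N in iN; lia.
have := octic_sumVE p_pr p_odd W z4 phi8 phiV => /(congr1 (wproj W)).
have wE (x y : int) t : wproj W (x%:~R - y%:~R * (t + t ^+ 3)) =
    x%:~R - y%:~R * (wproj W t + wproj W t ^+ 3).
  by rewrite rmorphB rmorphM rmorphD rmorphXn !rmorph_int.
rewrite rmorph_sum wE !(wproj_teich W).
rewrite (eq_bigr (fun u => - wproj W (teich u ^+ K.+1 * (1 - teich u) ^+ N))).
  by rewrite sumrN -rmorph_sum S0 rmorph0 oppr0 => /esym/eqP; rewrite subr_eq0 => /eqP.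
move=> u um; have u0 := mu0 um.
have wE2 t : wproj W (t ^+ K.+1 * (1 - t) ^+ N) = wproj W t ^+ K.+1 * (1 - wproj W t) ^+ N.
  by rewrite rmorphM !rmorphXn rmorphB rmorph1.
rewrite wE2 !(wproj_teich W).
have [->|u1] := eqVneq u 1; first by rewrite phi_1 invr0 subrr !expr0n mulr0 oppr0.
have v0 : (1 - u) ^+ N != 0 by rewrite expf_neq0 // subr_eq0 eq_sym.
have uK : u ^+ K != 0 by rewrite expf_neq0.
rewrite phiE // exprVn exprS; have dd := d2 um u1.
move: (u ^+ K) uK ((1 - u) ^+ N) v0 dd => t t0 d d0 dd; apply: (mulIf d0).
transitivity (- (u * t) * (d * d)); last by ring.
by rewrite dd; field; rewrite ?t0 ?d0 ?u0.
Qed.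

(** Again by the product of phi over a fibre, now of u -> u^m over c = -z^2, because phi(u)^2 =
    -u^m. With N = 4L + 1, (1 + z^2)^4 = 4 z^4 gives 4^L, and the remaining factor 1 + z^2 gives the
    square root z + z^3 of -2. *)
Lemma inert_sign : (oct 1 + oct 5 = m)%N /\ (-1) ^+ oct 5 = 4 ^+ L * (z + z ^+ 3) :> k.
Proof.
pose c := - z ^+ 2.
have c4 : c ^+ 4 = 1.
  by rewrite /c exprNn -exprM (exprM z 4 2) z4 -signr_odd expr0 mul1r sqrrN expr1n.
have z0 := z_neq0 z4.
have cV : c^-1 = z ^+ 2.
  have z20 : c != 0 by rewrite oppr_eq0 expf_neq0.
  by apply: (mulfI z20); rewrite divff // /c mulNr -exprD z4 opprK.
have c1 : c != 1.
  apply/eqP => e; have := z4; rewrite (exprM z 2 2).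
  have -> : z ^+ 2 = -1 by rewrite -[z ^+ 2]opprK -/c e.
  rewrite sqrrN expr1n => /eqP; rewrite -addr_eq0; apply/negP.
  exact: (two_neq0 p_pr p_odd W).
have inC u : u \in fiber m c -> u \in mu k M /\ u != 1.
  rewrite inE => /eqP uc; split; first by rewrite muP M4 exprM uc c4.
  by apply/eqP => e; move: uc; rewrite e expr1n => /esym/eqP; apply/negP.
have fC : {in fiber m c, forall u, phi u ^+ 2 = z ^+ 2}.
  move=> u uC; have [um u1] := inC u uC; rewrite phi2 //.
  by move: uC; rewrite inE => /eqP->; rewrite opprK.
have z5 : z ^+ 5 = - z by rewrite (exprS z 4) z4 mulrN1.
have [cardE prodE] := sign_prod p_pr p_odd W z0 fC.
rewrite -z5 in cardE prodE.
have sets j : (j == 1%N) || (j == 5%N) -> oct j = #|[set u in fiber m c | phi u == z ^+ j]|.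
  move=> j15; apply: eq_card => u; rewrite !inE.
  apply/andP/andP => -[h /eqP pu]; split; rewrite ?pu //; last first.
    by have [] := inC u; rewrite ?inE.
  have um : u \in mu k M by rewrite muP.
  have u1 : u != 1.
    apply/eqP => e; move: pu; rewrite e phi_1 => /esym/eqP.
    by rewrite expf_eq0 (negPf z0) andbF.
  rewrite /c -eqr_oppLR -phi2 // pu; case/orP: j15 => /eqP->; rewrite ?expr1 //.
  by rewrite -exprM (exprD z 8 2) (exprM z 4 2) z4 sqrrN expr1n mul1r.
rewrite (sets 1%N) // (sets 5%N) // expr1.
split; first by rewrite cardE (card_fiber (ltn0Sn _) (isT : (0 < 4)%N) cM4 c4).
rewrite (card_fiber (ltn0Sn _) (isT : (0 < 4)%N) cM4 c4) // in prodE.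
have zm : z ^+ m != 0 by rewrite expf_neq0.
apply: (mulfI zm); rewrite -prodE.
rewrite (eq_bigr (fun u => u^-1 ^+ K * (1 - u) ^+ N)); last first.
  by move=> u uC; have [um u1] := inC u uC; rewrite phiE.
rewrite big_split /= !prodrXl prodfV (prod_fiber_id (ltn0Sn _) (isT : (0 < 4)%N) cM4 c4) // (prod_fiber_1B (ltn0Sn _) (isT : (0 < 4)%N) cM4 c4) //.
have -> : (-1) ^+ m.+1 * c = c by rewrite -signr_odd /m /= oddM /= expr0 mul1r.
rewrite cV /c opprK.
have s2 : (1 + z ^+ 2) ^+ 4 = 4 * z ^+ 4.
  have -> : (1 + z ^+ 2) ^+ 4 = 4 * z ^+ 4 + (1 + z ^+ 4) * (1 + 4 * z ^+ 2 + z ^+ 4) by ring.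
  by rewrite z4 subrr mul0r addr0.
rewrite /N (exprS _ (4 * L)) (exprM _ 4 L) s2 (exprMn L).
have -> : (z ^+ 2) ^+ K = (z ^+ 4) ^+ L * z ^+ m * z.
  by rewrite -!exprM -!exprD -exprSr; congr (_ ^+ _); rewrite /K /m; clear; lia.
have zL : (z ^+ 4) ^+ L * (z ^+ 4) ^+ L = 1 by rewrite -exprMn z4 mulrNN mulr1 expr1n.
have -> : (z ^+ 4) ^+ L * z ^+ m * z * ((1 + z ^+ 2) * (4 ^+ L * (z ^+ 4) ^+ L)) =
  (z ^+ 4) ^+ L * (z ^+ 4) ^+ L * (z ^+ m * (4 ^+ L * (z + z ^+ 3))).
  by move: ((z ^+ 4) ^+ L) (z ^+ m) (4 ^+ L) => t1 t2 t3; ring.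
by rewrite zL mul1r.
Qed.
End Zeta.
End Inert.

(** * Witt vectors of length three *)

Section ZpProj.
Variables (p : nat) (p_pr : prime p) (k : finFieldType) (chk : p \in [pchar k]).

Let p3_gt1 : (1 < p ^ 3)%N.
Proof. by rewrite -(exp1n 3) ltn_exp2r // prime_gt1. Qed.

Lemma pchar_natr_inj (m n : nat) : (m < p)%N -> (n < p)%N -> m%:R = n%:R :> k -> m = n.
Proof.
wlog mn : m n / (m <= n)%N.
  by case: (leqP m n) => [|/ltnW] mn h mp np e; [exact: h | apply/esym/h].
move=> _ np /eqP; rewrite eq_sym -subr_eq0 -natrB // -(dvdn_pcharf chk) => d.
have [e|e] := posnP (n - m)%N; first by apply/eqP; rewrite eqn_leq mn -subn_eq0 e.
by have := dvdn_leq e d; rewrite leqNgt (leq_ltn_trans (leq_subr _ _) np).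
Qed.

Definition zproj (x : 'Z_(p ^ 3)) : k := (x : nat)%:R.

Let mod_p3 (n : nat) : (n %% p ^ 3)%:R = n%:R :> k.
Proof.
rewrite [in RHS](divn_eq n (p ^ 3)) natrD natrM expnS natrM (pcharf0 chk).
by rewrite mul0r mulr0 add0r.
Qed.

Lemma zproj_nat (n : nat) : zproj n%:R = n%:R.
Proof. by rewrite /zproj val_Zp_nat // mod_p3. Qed.

Let natE (x : 'Z_(p ^ 3)) : x = (x : nat)%:R.
Proof. by apply: val_inj; rewrite /= val_Zp_nat // modn_small // -[X in (_ < X)%N](Zp_cast p3_gt1). Qed.

Lemma zprojB : {morph zproj : x y / x - y}.
Proof.
have D x y : zproj (x + y) = zproj x + zproj y.
  by rewrite (natE x) (natE y) -natrD !zproj_nat natrD.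
by move=> x y; rewrite -[in RHS](subrK y x) [in RHS]D addrK.
Qed.

Lemma zprojM : monoid_morphism zproj.
Proof.
split; first exact: (zproj_nat 1).
by move=> x y; rewrite (natE x) (natE y) -natrM !zproj_nat natrM.
Qed.

Definition zproj_mor : {rmorphism 'Z_(p ^ 3) -> k} :=
  HB.pack zproj (GRing.isZmodMorphism.Build _ _ zproj zprojB)
    (GRing.isMonoidMorphism.Build _ _ zproj zprojM).

Lemma zproj_ker x : zproj x = 0 -> exists y, x = p%:R * y.
Proof.
move=> /eqP; rewrite /zproj -(dvdn_pcharf chk) => /dvdnP[q xE].
by exists q%:R; rewrite {1}(natE x) xE mulnC natrM.
Qed.

Lemma zp_p3 : p%:R ^+ 3 = 0 :> 'Z_(p ^ 3).
Proof. by rewrite -natrX pchar_Zp. Qed.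

Lemma zp_char (n : nat) : n%:R = 0 :> 'Z_(p ^ 3) -> (p ^ 3 %| n)%N.
Proof. by move=> /(congr1 val) /=; rewrite val_Zp_nat // => /eqP. Qed.

Lemma witt3_prime : #|k| = p -> inhabited (witt3 p k 'Z_(p ^ 3)).
Proof.
move=> cardk.
have surj (x : k) : exists y, zproj_mor y == x.
  have inj : injective (fun i : 'I_p => (i : nat)%:R : k).
    by move=> i j e; apply: val_inj; apply: (pchar_natr_inj (ltn_ord i) (ltn_ord j) e).
  have /(_ x) : forall x, x \in codom (fun i : 'I_p => (i : nat)%:R : k).
    by apply: inj_card_onto => //; rewrite card_ord cardk.
  by move=> /codomP[i ->]; exists (i : nat)%:R; rewrite /= zproj_nat.
have sK : cancel (fun x => xchoose (surj x)) zproj_mor.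
  by move=> x; apply/eqP/(xchooseP (surj x)).
constructor; apply: (Witt3 sK).
- exact: zproj_ker.
- exact: zp_p3.
- exact: zp_char.
- by move=> x; rewrite expnS expn1 exprM -{1}cardk expf_card -{1}cardk expf_card.
Qed.
End ZpProj.

(** A separate name for pairs, which keeps multiplication modulo i^2 = -1 apart from the
    componentwise one. *)
Definition gaussian (A : Type) := (A * A)%type.

Section Gaussian.
Variable A : comNzRingType.
HB.instance Definition _ := GRing.Zmodule.on (gaussian A).
Implicit Types x y z : gaussian A.
Definition gone : gaussian A := (1, 0).
Definition gmul x y : gaussian A := (x.1 * y.1 - x.2 * y.2, x.1 * y.2 + x.2 * y.1).

Fact gmulA : associative gmul.
Proof. by move=> [a b] [c d] [e f]; congr pair => /=; ring. Qed.
Fact gmulC : commutative gmul.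
Proof. by move=> [a b] [c d]; congr pair => /=; ring. Qed.
Fact gmul1 : left_id gone gmul.
Proof. by move=> [a b]; congr pair => /=; ring. Qed.
Fact gmulDl : left_distributive gmul +%R.
Proof. by move=> [a b] [c d] [e f]; congr pair => /=; ring. Qed.
Fact gone_neq0 : gone != 0.
Proof. by rewrite xpair_eqE oner_eq0. Qed.
HB.instance Definition _ :=
  GRing.Zmodule_isComNzRing.Build (gaussian A) gmulA gmulC gmul1 gmulDl gone_neq0.

Lemma gaussian_nat (n : nat) : n%:R = (n%:R, 0) :> gaussian A.
Proof. by elim: n => [|n IH]; rewrite // !mulrS IH; congr pair; rewrite /= addr0. Qed.
End Gaussian.

Section GaussianProj.
Variables (p : nat) (p_pr : prime p) (p_odd : odd p) (k : finFieldType) (chk : p \in [pchar k]).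
Variables (i : k) (i2 : i ^+ 2 = -1) (ip : i ^+ p = - i) (cardk : #|k| = (p ^ 2)%N).
Notation zq := (zproj_mor p_pr chk).

Definition gproj (x : gaussian 'Z_(p ^ 3)) : k := zq x.1 + zq x.2 * i.

Lemma gprojB : {morph gproj : x y / x - y}.
Proof. by move=> x y; rewrite /gproj !rmorphB; ring. Qed.

Lemma gprojM : monoid_morphism gproj.
Proof.
split; first by rewrite /gproj rmorph1 rmorph0 mul0r addr0.
move=> x y; rewrite /gproj rmorphB rmorphD !rmorphM.
move: (zq x.1) (zq x.2) (zq y.1) (zq y.2) => a b c d.
have -> : (a + b * i) * (c + d * i) = a * c + b * d * i ^+ 2 + (a * d + b * c) * i by ring.
rewrite i2; ring.
Qed.

Definition gproj_mor : {rmorphism gaussian 'Z_(p ^ 3) -> k} :=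
  HB.pack gproj (GRing.isZmodMorphism.Build _ _ gproj gprojB)
    (GRing.isMonoidMorphism.Build _ _ gproj gprojM).

(* Frobenius fixes the prime field and negates i. *)
Lemma gproj_eq0 x : gproj x = 0 -> zq x.1 = 0 /\ zq x.2 = 0.
Proof.
rewrite /gproj => e.
have fz y : zq y ^+ p = zq y by exact: (pFrobenius_aut_nat chk).
have : (zq x.1 + zq x.2 * i) ^+ p = zq x.1 - zq x.2 * i.
  have -> : (zq x.1 + zq x.2 * i) ^+ p = zq x.1 ^+ p + (zq x.2 * i) ^+ p.
    exact: (rmorphD (pFrobenius_aut chk)).
  by rewrite exprMn !fz ip mulrN.
rewrite [zq _ + _]e expr0n (gtn_eqF (prime_gt0 p_pr)); move: e.
move: (zq x.1) (zq x.2) => a b e e'.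
have two0 : 2 != 0 :> k.
  apply/eqP => two0; have : (2 \in [pchar k])%N by rewrite inE /= two0.
  by rewrite (pcharf_eq chk) inE => /eqP p2; move: p_odd; rewrite -p2.
have a0 : a = 0.
  apply: (mulfI two0); rewrite mulr0.
  by have -> : 2 * a = (a + b * i) + (a - b * i) by [ring]; rewrite e -e' addr0.
split=> //; move: e; rewrite a0 add0r => /eqP; rewrite mulf_eq0 => /orP[/eqP//|/eqP i0].
by move: i2; rewrite i0 expr0n /= => /eqP; rewrite eq_sym oppr_eq0 oner_eq0.
Qed.

(** Surjectivity of the reduction is a count: the p^2 pairs of digits have distinct images because 1
    and i are independent over the prime field. *)
Lemma witt3_gaussian : inhabited (witt3 p k (gaussian 'Z_(p ^ 3))).
Proof.
have surj (x : k) : exists y, gproj_mor y == x.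
  pose f (n : 'I_p * 'I_p) : k := gproj ((n.1 : nat)%:R, (n.2 : nat)%:R).
  have inj : injective f.
    move=> m n /eqP; rewrite -subr_eq0 -gprojB => /eqP/gproj_eq0[/= e1 e2].
    move: e1 e2; rewrite !zprojB // !zproj_nat //.
    have h (a b : 'I_p) : (a : nat)%:R - (b : nat)%:R = 0 :> k -> a = b.
      move=> /eqP; rewrite subr_eq0 => /eqP ab; apply: val_inj => /=.
      exact: (pchar_natr_inj chk (ltn_ord a) (ltn_ord b)).
    by move=> /h e1 /h e2; case: m n e1 e2 => [m1 m2] [n1 n2] /= -> ->.
  have /(_ x) : forall x, x \in codom f.
    by apply: inj_card_onto => //; rewrite card_prod card_ord cardk mulnn.
  by move=> /codomP[n ->]; exists ((n.1 : nat)%:R, (n.2 : nat)%:R).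
have sK : cancel (fun x => xchoose (surj x)) gproj_mor.
  by move=> x; apply/eqP/(xchooseP (surj x)).
have gp (y1 y2 : 'Z_(p ^ 3)) : (p%:R * y1, p%:R * y2) = p%:R * ((y1, y2) : gaussian 'Z_(p ^ 3)).
  by rewrite gaussian_nat; congr pair => /=; rewrite mul0r ?subr0 ?addr0.
constructor; apply: (Witt3 sK).
- move=> x /gproj_eq0[e1 e2].
  have [y1 {}e1] := zproj_ker p_pr chk e1; have [y2 {}e2] := zproj_ker p_pr chk e2.
  by exists ((y1, y2) : gaussian 'Z_(p ^ 3)); rewrite -gp -e1 -e2; case: (x).
- by rewrite -natrX gaussian_nat natrX zp_p3.
- by move=> n; rewrite gaussian_nat => -[] /(zp_char p_pr).
- by move=> x; rewrite -cardk expf_card.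
Qed.
End GaussianProj.

(** * Assembly for p = 1, 3 mod 8 *)

Section Main.
Variables (p : nat) (p_pr : prime p) (p_gt3 : (3 < p)%N).
Let p_odd := p_odd p_pr p_gt3.

Lemma binom_sum_split (K : nat) (x y : int) : p = (8 * K + 1)%N ->
  p%:Z = x ^+ 2 + 2 * y ^+ 2 -> (4 %| x - 1)%Z ->
  pcongr p 4 (binom_sum p)
    (3 * p%:R * (-1) ^ (y %/ 2)%Z
     * (2 * x%:~R - p%:R / (2 * x%:~R) - p%:R ^+ 2 / (8 * x%:~R ^+ 3))).
Proof.
move=> pK.
have [W] : inhabited (witt3 p 'F_p 'Z_(p ^ 3)).
  by apply: witt3_prime; [| exact: pchar_Fp | exact: card_Fp].
have cardk : #|'F_p| = p by exact: card_Fp.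
have [z z4] := exists_zeta_split p_pr pK cardk.
have nrm := split_norm p_pr p_odd W pK cardk z4.
have rt := split_root p_pr p_odd W pK cardk z4.
have [o15 sgn] := split_sign p_pr p_odd W pK cardk z4.
have [o04 par] := split_parity p_pr p_odd W pK cardk z4.
move: (octic _ _ z 0) (octic _ _ z 1) (octic _ _ z 4) (octic _ _ z 5) nrm rt o15 sgn o04 par.
move=> o0 o1 o4 o5 nrm rt o15 sgn o04 par.
have K0 : (0 < K)%N by clear -pK p_gt3; lia.
apply: (binom_sum_1 p_pr p_gt3 (a := o5) pK _ _ _ rt).
- have <- : o1%:Z - o5%:Z = 2 * (K%:Z - o5%:Z) by clear -o15; lia.
  exact: nrm.
- apply/dvdzP; exists ((K./2)%:Z - (o4./2)%:Z).
  have := odd_double_half o4; have := odd_double_half K; rewrite par.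
  by move: o04 K0; clear; lia.
- by apply: (wchar_mod p_pr W); rewrite rmorphB !rmorphXn rmorphN1 -sgn /= subrr.
Qed.

Lemma binom_sum_inert (L : nat) (x y : int) : p = (8 * L + 3)%N ->
  p%:Z = x ^+ 2 + 2 * y ^+ 2 -> (4 %| y - 1)%Z ->
  pcongr p 4 (binom_sum p)
    (p%:R * (- (2 * y%:~R) + p%:R / (4 * y%:~R) + p%:R ^+ 2 / (32 * y%:~R ^+ 3))).
Proof.
move=> pL.
(* In the field with p^2 elements the square z^2 of a primitive eighth root of unity serves as i;
   Frobenius negates it since p = 3 mod 4. *)
have [k chk cardk] := PrimePowerField p_pr (isT : (0 < 2)%N).
have [z z4] := exists_zeta_inert pL cardk.
have i2 : (z ^+ 2) ^+ 2 = -1 by rewrite -exprM.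
have ip : (z ^+ 2) ^+ p = - z ^+ 2.
  rewrite pL (exprD _ (8 * L) 3) (exprM _ 8 L) (exprM _ 2 4) (exprSr _ 2) i2.
  by rewrite -(signr_odd _ 4) !expr1n mul1r mulN1r.
have [W] := witt3_gaussian p_pr p_odd chk i2 ip cardk.
have nrm := inert_norm p_pr p_gt3 W pL cardk z4.
have rt := inert_root p_pr p_gt3 W pL cardk z4.
have [o15 sgn] := inert_sign p_pr p_gt3 W pL cardk z4.
have res := inert_residue p_pr p_gt3 W pL cardk z4.
have sm := inert_sum p_pr p_gt3 W pL cardk z4.
move: (octic _ _ z 0) (octic _ _ z 1) (octic _ _ z 4) (octic _ _ z 5) nrm rt o15 sgn res sm.
move=> o0 o1 o4 o5 nrm rt o15 sgn res sm.
have YE : o1%:Z - o5%:Z = 2 * L%:Z + 1 - 2 * o5%:Z by clear -o15; lia.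
apply: (binom_sum_3 p_pr p_gt3 (a := o5) pL _ _ rt).
  by rewrite -YE; exact: nrm.
apply: (wchar_mod p_pr W); rewrite -YE; move: res sm rt sgn.
move: (ext_inert _ _ _) (o0%:Z - o4%:Z) (o1%:Z - o5%:Z) => b X Y res sm rt sgn.
have bE : b%:~R = 16 * Y%:~R * (z + z ^+ 3) :> k.
  have wE t : wproj W (8 * (X%:~R + Y%:~R * (t + t ^+ 3))) =
      8 * (X%:~R + Y%:~R * (wproj W t + wproj W t ^+ 3)).
    by rewrite rmorphM rmorph_nat !rmorphD rmorphM rmorphD !rmorphXn !rmorph_int.
  have sm' := congr1 (wproj W) sm.
  rewrite wE (wproj_teich W z) res in sm'.
  apply: etrans (esym (etrans sm' (rmorph_int _ b))) _.
  by move: Y%:~R => t; ring.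
have -> : (4 ^+ L * b - 16 * (-1) ^+ o5 * Y)%:~R =
  4 ^+ L * b%:~R - 16 * (-1) ^+ o5 * Y%:~R :> k.
  by rewrite intrB !intrM !rmorphXn rmorphN1.
by rewrite bE sgn; ring.
Qed.
End Main.

Theorem theorem5p8 (p : nat) (p_prime : prime p) (p_gt3 : (3 < p)%N) :
  let S : rat :=
    \sum_(0 <= k < p) (16 * k%:R + 3) * gbinom (- (3 / 8)) k ^+ 4 in
  [/\ (p = 1 %[mod 8])%N ->
        forall x y : int,
          p%:Z = x ^+ 2 + 2 * y ^+ 2 -> (4 %| x - 1)%Z ->
          pcongr p 4 S
            (3 * p%:R * (-1) ^ (y %/ 2)%Z
             * (2 * x%:Q - p%:R / (2 * x%:Q) - p%:R ^+ 2 / (8 * x%:Q ^+ 3))),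
      (p = 3 %[mod 8])%N ->
        forall x y : int,
          p%:Z = x ^+ 2 + 2 * y ^+ 2 -> (4 %| y - 1)%Z ->
          pcongr p 4 S
            (p%:R * (- (2 * y%:Q) + p%:R / (4 * y%:Q)
                     + p%:R ^+ 2 / (32 * y%:Q ^+ 3))),
      (p = 5 %[mod 8])%N ->
        pcongr p 3 S
          ((-1) ^+ ((p - 5) %/ 8)%N
           * (84 * p%:R ^+ 2 / 'C((3 * p + 1) %/ 4, (3 * p + 1) %/ 8)%:R))
    & (p = 7 %[mod 8])%N ->
        pcongr p 3 S
          ((-1) ^+ ((p - 7) %/ 8)%N
           * (10 * p%:R ^+ 2 / 'C((p + 1) %/ 4, (p + 1) %/ 8)%:R))].
Proof.
move=> S; split => [p1 x y xy x4|p3 x y xy y4|p5|p7].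
- apply: (binom_sum_split p_prime p_gt3 (K := p %/ 8) _ xy x4).
  by rewrite {1}(divn_eq p 8) p1 mulnC.
- apply: (binom_sum_inert p_prime p_gt3 (L := p %/ 8) _ xy y4).
  by rewrite {1}(divn_eq p 8) p3 mulnC.
- exact: (binom_sum_5 p_prime p_gt3 p5).
- exact: (binom_sum_7 p_prime p_gt3 p7).
Qed.
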